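(* Let $n\ge2$, let $\Omega\subset\mathbb{R}^n$ be an open, connected and bounded set with smooth boundary $\partial\Omega$, let $T>0$, $\Omega_T=(0,T)\times\Omega$, and $(a,b)\in C_c^\infty(\Omega)\times C_c^\infty(\Omega)$. Then the backward wave problem $$\begin{cases}\mathcal{L}_{a,b}v(t,x):=\left(\Box-a(x)\partial_t+b(x)\right)v(t,x)=0,&(t,x)\in\Omega_T,\\ v(T,x)=\partial_tv(T,x)=0,&x\in\Omega,\end{cases}$$ admits an asymptotic solution having the form $$v(t,x)=e^{-\ell i\tau(t+x\cdot\omega)}\left(\beta_0(t,x)+\frac{\beta_1(t,x)}{\tau}+\frac{\beta_2(t,x)}{\tau^2}+\cdots+\frac{\beta_N(t,x)}{\tau^N}\right)+R_0(t,x,\tau),$$ where the functions $\beta_j$, $j=0,1,\dots,N$, satisfy the following transport systems. The function $\beta_0$ solves $$\begin{cases}L\beta_0(t,x):=\left(\partial_t-\omega\cdot\nabla_x-\dfrac{a(x)}{2}\right)\beta_0(t,x)=0,&(t,x)\in\Omega_T,\\ \beta_0(T,x)=0,\quad \partial_t\beta_0(T,x)=0,&x\in\Omega,\end{cases}$$ and, for $j=1,\dots,N$, the function $\beta_j$ solves $$\begin{cases}2\ell i\,L\beta_j(t,x)=\mathcal{L}_{a,b}\beta_{j-1}(t,x),&(t,x)\in\Omega_T,\\ \beta_j(T,x)=0,\quad \partial_t\beta_j(T,x)=0,&x\in\Omega.\end{cases}$$ The correction term $R_0(t,x,\tau)$ satisfies $$R_0(T,x,\tau)=\partial_tR_0(T,x,\tau)=0,\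 x\in\Omega,\qquad\text{and}\qquad \|R_0\|_{L^\infty(\Omega_T)}\le\frac{C}{\tau}\quad\text{for any }\tau>1,$$ where the constant $C>0$ is independent of $\tau$.
   Context: $\Box=\partial_t^2-\Delta_x$ is the standard wave operator on $\mathbb{R}^{1+n}$, $i$ is the imaginary unit, $\ell\ge2$ is an integer, $\omega\in\mathbb{S}^{n-1}$ is a unit vector, $\tau$ is a large real parameter, and the integer $N$ is the order of the expansion in negative powers of $\tau$; the statement places no further condition on $N$. *)

(* Defs.v *)
From HB Require Import structures.
From mathcomp Require Import all_boot all_order all_algebra.
From mathcomp Require Import complex.
From mathcomp Require Import all_classical all_reals all_analysis.

Set Implicit Arguments.
Unset Strict Implicit.
Unset Printing Implicit Defensive.

Import Order.TTheory GRing.Theory Num.Theory.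
Import numFieldNormedType.Exports.

Local Open Scope classical_set_scope.
Local Open Scope ring_scope.
Local Open Scope complex_scope.

(* On a finite-dimensional V this is the usual class C^k on all of V: every
   directional derivative of order at most k exists and is continuous. *)
Fixpoint classC (R : realType) (V : normedModType R) (k : nat) (f : V -> R)
    : Prop :=
  match k with
  | 0 => continuous f
  | k'.+1 => continuous f /\
      forall v : V, (forall p, derivable f p v) /\ classC k' ('D_v f)
  end.

Definition smooth (R : realType) (V : normedModType R) (f : V -> R) : Prop :=
  forall k, classC k f.

(* The type R[i] carries no real normed-module structure, hence the
   componentwise treatment of complex-valued functions. *)
Definition classCC (R : realType) (V : normedModType R) (k : nat)
    (u : V -> R[i]) : Prop :=
  classC k (fun p => complex.Re (u p)) /\ classC k (fun p => complex.Im (u p)).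

Definition smoothC (R : realType) (V : normedModType R) (u : V -> R[i]) : Prop :=
  forall k, classCC k u.

Definition deriveC (R : realType) (V : normedModType R) (v : V)
    (u : V -> R[i]) (p : V) : R[i] :=
  'D_v (fun q => complex.Re (u q)) p +i* 'D_v (fun q => complex.Im (u q)) p.

Definition boundary (X : topologicalType) (A : set X) : set X :=
  closure A `\` interior A.

(* Near each boundary point, the set is the strict sublevel set of a smooth
   function with nonvanishing differential at that point. *)
Definition smooth_boundary (R : realType) (n : nat) (Omega : set 'rV[R]_n)
    : Prop :=
  forall p, boundary Omega p ->
    exists rho : 'rV[R]_n -> R,
      [/\ smooth rho, (exists v, 'D_v rho p != 0) &
          \forall x \near p, Omega x <-> rho x < 0].

(* C_c^infinity(Omega), each function being extended by zero. *)
Definition test_function (R : realType) (n : nat) (Omega : set 'rV[R]_n)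
    (f : 'rV[R]_n -> R) : Prop :=
  let supp := closure [set x | f x != 0] in
  [/\ smooth f, compact supp & supp `<=` Omega].

Definition dotv (R : realType) (n : nat) (x y : 'rV[R]_n) : R :=
  \sum_(i < n) x 0 i * y 0 i.

(* The norm `|_| of 'rV[R]_n is the maximum norm, so it cannot be used here. *)
Definition unit_vector (R : realType) (n : nat) (w : 'rV[R]_n) : Prop :=
  dotv w w = 1.

Definition expi (R : realType) (theta : R) : R[i] := cos theta +i* sin theta.

Section Operators.
Context {R : realType} {n : nat}.
Implicit Types (u : R * 'rV[R]_n -> R[i]) (p : R * 'rV[R]_n).

Definition cylinder (T : R) (Omega : set 'rV[R]_n) : set (R * 'rV[R]_n) :=
  [set p | 0 < p.1 < T /\ Omega p.2].

Definition dt u : R * 'rV[R]_n -> R[i] := deriveC ((1, 0) : R * 'rV[R]_n) u.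

Definition dx (i : 'I_n) u : R * 'rV[R]_n -> R[i] :=
  deriveC ((0, delta_mx 0 i) : R * 'rV[R]_n) u.

Definition box u p : R[i] := dt (dt u) p - \sum_(i < n) dx i (dx i u) p.

Definition wave_op (a b : 'rV[R]_n -> R) u p : R[i] :=
  box u p - (a p.2)%:C * dt u p + (b p.2)%:C * u p.

Definition transport_op (w : 'rV[R]_n) (a : 'rV[R]_n -> R) u p : R[i] :=
  dt u p - \sum_(i < n) (w 0 i)%:C * dx i u p - (a p.2 / 2)%:C * u p.

Definition zero_final_data (T : R) (Omega : set 'rV[R]_n) u : Prop :=
  forall x, Omega x -> u (T, x) = 0 /\ dt u (T, x) = 0.

(* Classical solutions; functions that are C^2 up to the boundary of the
   cylinder are represented by functions that are C^2 on the whole space-time. *)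
Definition backward_wave_solution (T : R) (Omega : set 'rV[R]_n)
    (a b : 'rV[R]_n -> R) u : Prop :=
  [/\ classCC 2 u,
      (forall p, cylinder T Omega p -> wave_op a b u p = 0) &
      zero_final_data T Omega u].

(* The amplitudes are smooth up to the boundary of the cylinder, represented in
   the same way; c and f give the equation c L u = f. *)
Definition transport_solution (T : R) (Omega : set 'rV[R]_n) (w : 'rV[R]_n)
    (a : 'rV[R]_n -> R) (c : R[i]) (f : R * 'rV[R]_n -> R[i]) u : Prop :=
  [/\ smoothC u,
      (forall p, cylinder T Omega p -> c * transport_op w a u p = f p) &
      zero_final_data T Omega u].

(* Every function measured below is continuous and the cylinder is open, so
   that the essential supremum is the supremum. *)
Definition Linfty_norm (D : set (R * 'rV[R]_n)) u : \bar R :=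
  ereal_sup [set (complex.Re `|u p|)%:E | p in D].

End Operators.

(* Main.v *)
Require Import Defs.
From HB Require Import structures.
From mathcomp Require Import all_boot all_order all_algebra.
From mathcomp Require Import complex.
From mathcomp Require Import all_classical all_reals all_analysis.
From mathcomp Require Import ring lra.

Set Implicit Arguments.
Unset Strict Implicit.
Unset Printing Implicit Defensive.

Import Order.TTheory GRing.Theory Num.Theory.
Import numFieldNormedType.Exports.

Local Open Scope classical_set_scope.
Local Open Scope ring_scope.
Local Open Scope complex_scope.

(** The phase [t + x . w] solves the eikonal equation, as [w] is a unit vector.
   Hence, with [E = expi (- l tau (t + x . w))], the terms of order [tau ^ 2]
   cancel in [wave_op (E u) = E (wave_op u - 2 i l tau L u)], where [L] is the
   transport operator ([wave_op_plane_wave]). Amplitudes [beta j] related by the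
   transport equations therefore telescope: the sum of [E beta j / tau ^ j] over
   [j <= m] has the residual [E (wave_op (beta m)) / tau ^ m]
   ([wave_op_expansion]).

   The amplitudes of positive order are integrals along the characteristics from
   time [T] ([transport_sol]). The value of [beta0] need not be 0 everywhere: a
   characteristic may leave [Omega] before time [T]. Characteristics that start
   close to [{T} x Omega] do stay over [Omega] until time [T], so that [beta0]
   vanishes near [{T} x Omega] at earlier times ([transport_vanishes_before]).
   This property, unlike zero data at time [T], passes to derivatives, hence to
   the source of the next equation and by induction to all amplitudes
   ([amplitude_vanishes]). It gives both final conditions
   ([vanishes_before_final_data]).

   The residual is removed by a solution of the wave equation with zero data at
   time [T] and an oscillating source. Its construction uses functions that
   coincide, on a cube containing the cylinder, with a series of terms
   [h t * cos (xi . x + th)], the amplitudes being summable with the weight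
   [(1 + l1 xi) ^ 2] ([wiener]). Smooth functions are of this kind: after a
   cutoff, one-variable Fourier inversion is applied to one coordinate after the
   other ([fourier_inversion], [smooth_wiener]). For one term, the equation with
   [box r + r] on the left is an ordinary differential equation, solved by
   Duhamel's formula. The lower order terms are added by iteration, which
   converges because the norm contains the weight [growth T mu] in time, whose
   integral from [T] gains a factor [1 / mu] ([wave_solvable]). No condition is
   imposed on the lateral boundary of the cylinder, and the bound is a supremum
   bound.

   Multiplication by [E] translates the frequencies by [l tau w], which costs a
   factor [tau ^ 2] in the norm ([wiener_mul_wave], [weight_scale]). The
   expansion is therefore continued up to the order [m = N + 3]: the correction
   is then of order [tau ^ (- N - 1)], and so are the three additional terms of
   the expansion, which are moved into the remainder. *)

(** * Directional derivatives *)

Section DirectionalDerivative.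
Context {R : realType} {V : normedModType R}.
Implicit Types (f g : V -> R) (p v : V).

Lemma continuous_ball f p : {for p, continuous f} ->
  forall e : R, 0 < e ->
  exists2 d : R, 0 < d & forall q, `|q - p| < d -> `|f q - f p| < e.
Proof.
move=> /cvgrPdist_lt fp e e0; have /nbhs_ballP[d /= d0 H] := fp e e0.
exists d => // q qp; rewrite distrC; apply: H.
by rewrite -ball_normE /= distrC.
Qed.

Lemma ball_continuous f p :
  (forall e : R, 0 < e ->
   exists2 d : R, 0 < d & forall q, `|q - p| < d -> `|f q - f p| <= e) ->
  {for p, continuous f}.
Proof.
move=> H; apply/cvgrPdist_le => e e0; have [d d0 {}H] := H e e0.
apply/nbhs_ballP; exists d => // q; rewrite -ball_normE /= => pq.
by rewrite distrC; apply: H; rewrite distrC.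
Qed.

(** Without a quotient, increments can be added and bounded directly. *)
Lemma is_derive_increment f p v df :
  (forall e : R, 0 < e -> exists2 d : R, 0 < d & forall h, h != 0 -> `|h| < d ->
     `|f (h *: v + p) - f p - h * df| <= e * `|h|) ->
  is_derive p v f df.
Proof.
move=> H.
have cv : (fun h => h^-1 *: ((f \o shift p) (h *: v) - f p)) @ 0^' --> df.
  apply/cvgrPdist_le => e e0; have [d d0 {}H] := H e e0.
  rewrite near_withinE; exists d => // h /=; rewrite sub0r normrN => hd h0.
  rewrite distrC -(ler_pM2r (x := `|h|)) ?normr_gt0// -normrM mulrBl.
  rewrite /GRing.scale/= mulrAC mulVf// mul1r [df * h]mulrC; exact: H.
by split; [apply/cvg_ex; exists df|exact/cvg_lim].
Qed.

Lemma increment_is_derive f p v df : is_derive p v f df ->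
  forall e : R, 0 < e -> exists2 d : R, 0 < d & forall h, `|h| < d ->
     `|f (h *: v + p) - f p - h * df| <= e * `|h|.
Proof.
move=> [fd dfE] e e0.
have := fd; rewrite /derivable => /cvgrPdist_le; rewrite -/(derive _ _ _) dfE.
move=> /(_ e e0); rewrite near_withinE => -[d /= d0 H].
exists d => // h hd; have [->|h0] := eqVneq h 0.
  by rewrite scale0r add0r subrr mul0r subrr normr0 mulr0.
have := H h; rewrite /ball_ /= sub0r normrN => /(_ hd h0).
rewrite distrC -(ler_pM2r (x := `|h|)) ?normr_gt0// -normrM mulrBl.
by rewrite /GRing.scale/= mulrAC mulVf// mul1r [df * h]mulrC.
Qed.

(** The restriction of [f] to a line reduces every statement on directional
   derivatives to a statement on functions of one variable. *)
Lemma is_derive_line f p v (s df : R) :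
  is_derive (s *: v + p) v f df <->
  is_derive s (1 : R) (fun h => f (h *: v + p)) df.
Proof.
suff E : (fun h : R => h^-1 *: ((f \o shift (s *: v + p)) (h *: v)
      - f (s *: v + p)))
    = (fun h : R => h^-1 *: (((fun h => f (h *: v + p)) \o shift s) (h *: 1)
      - f (s *: v + p))).
  split=> -[H1 H2]; split.
  - by rewrite /derivable /= -E.
  - by rewrite /derive /= -E.
  - by rewrite /derivable /= E.
  - by rewrite /derive /= E.
apply/funext => h /=; congr (_ *: (f _ - _)).
by rewrite [_%:A]mulr1 scalerDl addrA.
Qed.

Lemma mean_value f v p h : (forall q, derivable f q v) ->
  exists2 s, `|s| <= `|h| & f (h *: v + p) - f p = h * 'D_v f (s *: v + p).
Proof.
move=> fd.
pose g s := f (s *: v + p).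
have gd s : is_derive s (1 : R) g ('D_v f (s *: v + p)).
  by apply/is_derive_line; exact: derivableP.
have gc : continuous g.
  move=> s; apply/differentiable_continuous/derivable1_diffP.
  by have [] := gd s.
have gp : f p = g 0 by rewrite /g scale0r add0r.
rewrite gp -/(g h).
have [h0|h0] := leP 0 h.
  have [|c] := MVT_segment h0 (fun s _ => gd s); first exact: continuous_subspaceT.
  rewrite in_itv/= subr0 => /andP[c0 ch] ->; exists c; last by rewrite mulrC.
  by rewrite !ger0_norm.
have [|c] := MVT_segment (ltW h0) (fun s _ => gd s).
  exact: continuous_subspaceT.
rewrite in_itv/= sub0r => /andP[ch c0] E; exists c.
  by rewrite !ler0_norm ?lerN2// ltW.
by rewrite -opprB E mulrN opprK mulrC.
Qed.

Lemma increment_le f v p h (B : R) : (forall q, derivable f q v) ->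
  (forall s, `|s| <= `|h| -> `|'D_v f (s *: v + p)| <= B) ->
  `|f (h *: v + p) - f p| <= `|h| * B.
Proof.
move=> fd fB; have [s sh ->] := mean_value p h fd.
by rewrite normrM ler_wpM2l//; exact: fB.
Qed.

Lemma derivative0_cst f v p h : (forall q, is_derive q v f 0) ->
  f (h *: v + p) = f p.
Proof.
move=> fd; apply/eqP; rewrite -subr_eq0 -normr_le0.
rewrite -(mulr0 `|h|); apply: (@increment_le _ v) => // s _.
by rewrite derive_val normr0.
Qed.

Lemma is_deriveMf f g p v df dg : is_derive p v f df -> is_derive p v g dg ->
  is_derive p v (fun q => f q * g q) (df * g p + f p * dg).
Proof.
move=> Hf Hg; apply: (is_derive_eq (is_deriveM Hf Hg)).
by rewrite /GRing.scale/= addrC mulrC.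
Qed.

Lemma is_deriveDf f g p v df dg : is_derive p v f df -> is_derive p v g dg ->
  is_derive p v (fun q => f q + g q) (df + dg).
Proof. by move=> Hf Hg; exact: is_deriveD. Qed.

Lemma is_deriveNf f p v df : is_derive p v f df ->
  is_derive p v (fun q => - f q) (- df).
Proof. by move=> Hf; exact: is_deriveN. Qed.

Lemma is_deriveZf f p v df (c : R) : is_derive p v f df ->
  is_derive p v (fun q => c * f q) (c * df).
Proof. by move=> Hf; exact: is_deriveZ. Qed.

Lemma is_derive_scale_direction f p v df (c : R) : is_derive p v f df ->
  is_derive p (c *: v) f (c * df).
Proof.
move=> /increment_is_derive H; apply: is_derive_increment => e e0.
have c1 : 0 < `|c| + 1 by rewrite ltr_wpDl.
have [d d0 {}H] := H (e / (`|c| + 1)) (divr_gt0 e0 c1).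
exists (d / (`|c| + 1)); first exact: divr_gt0.
move=> h _; rewrite ltr_pdivlMr// => hd.
rewrite scalerA mulrA.
have hc : `|h * c| <= `|h| * (`|c| + 1).
  by rewrite normrM ler_wpM2l// lerDl.
apply: le_trans (H _ (le_lt_trans hc hd)) _.
by rewrite mulrAC ler_pdivrMr// -mulrA ler_wpM2l// ltW.
Qed.

(** Continuity of one of the two directional derivatives is what makes the
   derivative additive in its direction. *)
Lemma is_derive_add_direction f p u v du :
  is_derive p u f du -> (forall q, derivable f q v) ->
  {for p, continuous ('D_v f)} ->
  is_derive p (u + v) f (du + 'D_v f p).
Proof.
move=> /increment_is_derive Hu fv /continuous_ball cv.
apply: is_derive_increment => e e0.
have e2 : 0 < e / 2 by rewrite divr_gt0.
have [d1 d10 {}Hu] := Hu _ e2; have [d2 d20 {}cv] := cv _ e2.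
have uv : 0 < `|u| + `|v| + 1 by rewrite ltr_wpDl// addr_ge0.
exists (Num.min d1 (d2 / (`|u| + `|v| + 1))); first by rewrite lt_min d10 divr_gt0.
move=> h _; rewrite lt_min => /andP[hd1]; rewrite ltr_pdivlMr// => hd2.
have [s sh E] := mean_value (h *: u + p) h fv.
have -> : h *: (u + v) + p = h *: v + (h *: u + p).
  by rewrite scalerDr addrAC addrC.
have -> : f (h *: v + (h *: u + p)) - f p - h * (du + 'D_v f p) =
  h * ('D_v f (s *: v + (h *: u + p)) - 'D_v f p) +
  (f (h *: u + p) - f p - h * du).
  by rewrite mulrBr -E; ring.
have -> : e * `|h| = `|h| * (e / 2) + e / 2 * `|h|.
  by field.
apply: le_trans (ler_normD _ _) _; apply: lerD; last exact: Hu.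
rewrite normrM ler_wpM2l// ltW//; apply: cv.
rewrite addrA addrK; apply: le_lt_trans hd2.
apply: le_trans (ler_normD _ _) _; rewrite !normrZ.
have : `|s| * `|v| <= `|h| * `|v| by rewrite ler_wpM2r.
have : 0 <= `|h| by [].
rewrite !mulrDr; lra.
Qed.

End DirectionalDerivative.

(** * Functions of class C^k *)

Section ClassC.
Context {R : realType}.
Implicit Types (V W : normedModType R) (k : nat).

Lemma classC_continuous V k (f : V -> R) : classC k f -> continuous f.
Proof. by case: k => [//|k []]. Qed.

Lemma classC_derivable V k (f : V -> R) p v : classC k.+1 f -> derivable f p v.
Proof. by move=> [_ /(_ v)[]]. Qed.

Lemma classC_is_derive V k (f : V -> R) p v :
  classC k.+1 f -> is_derive p v f ('D_v f p).
Proof. by move=> fk; apply/derivableP/classC_derivable/fk. Qed.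

Lemma classC_derive V k (f : V -> R) v : classC k.+1 f -> classC k ('D_v f).
Proof. by move=> [_ /(_ v)[]]. Qed.

Lemma classCS V k (f : V -> R) (df : V -> V -> R) : continuous f ->
  (forall v p, is_derive p v f (df v p)) -> (forall v, classC k (df v)) ->
  classC k.+1 f.
Proof.
move=> fc fd dfk; split=> // v; split=> [p|]; first by have [] := fd v p.
suff -> : 'D_v f = df v by [].
by apply/funext => p; have [_ ->] := fd v p.
Qed.

Lemma classC_le V k m (f : V -> R) : (k <= m)%N -> classC m f -> classC k f.
Proof.
elim: k m f => [|k IH] m f; first by move=> _; exact: classC_continuous.
case: m => // m km fm; split; first exact: classC_continuous fm.
move=> v; split=> [p|]; first exact: classC_derivable fm.
by apply: IH km _; exact: classC_derive.
Qed.

Lemma classC_cst V k (c : R) : classC k (fun _ : V => c).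
Proof.
elim: k c => [|k IH] c; first exact: cst_continuous.
refine (@classCS _ _ _ (fun _ _ => 0) _ _ _).
- exact: cst_continuous.
- by move=> v; exact: IH.
Qed.

Lemma classC_add V k (f g : V -> R) :
  classC k f -> classC k g -> classC k (fun p => f p + g p).
Proof.
elim: k f g => [|k IH] f g fk gk; first by move=> p; apply: cvgD; [apply: fk|apply: gk].
apply: (@classCS _ _ _ (fun v p => 'D_v f p + 'D_v g p)).
- by move=> p; apply: cvgD; [apply: classC_continuous fk p|apply: classC_continuous gk p].
- by move=> v p; exact: is_deriveDf (classC_is_derive p v fk) (classC_is_derive p v gk).
- by move=> v; apply: IH; exact: classC_derive.
Qed.

Lemma classC_mul V k (f g : V -> R) :
  classC k f -> classC k g -> classC k (fun p => f p * g p).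
Proof.
elim: k f g => [|k IH] f g fk gk; first by move=> p; apply: cvgM; [apply: fk|apply: gk].
apply: (@classCS _ _ _ (fun v p => 'D_v f p * g p + f p * 'D_v g p)).
- by move=> p; apply: cvgM; [apply: classC_continuous fk p|apply: classC_continuous gk p].
- by move=> v p; exact: is_deriveMf (classC_is_derive p v fk) (classC_is_derive p v gk).
- move=> v; apply: classC_add; apply: IH; first exact: classC_derive.
  + by apply: classC_le gk.
  + by apply: classC_le fk.
  + exact: classC_derive.
Qed.

Lemma classC_scale V k (c : R) (f : V -> R) :
  classC k f -> classC k (fun p => c * f p).
Proof. by move=> fk; apply: classC_mul => //; exact: classC_cst. Qed.

Lemma classC_opp V k (f : V -> R) : classC k f -> classC k (fun p => - f p).
Proof.
move=> fk; rewrite (_ : (fun p => - f p) = fun p => -1 * f p); last first.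
  by apply/funext => p; rewrite mulN1r.
exact: classC_scale.
Qed.

Lemma classC_sub V k (f g : V -> R) :
  classC k f -> classC k g -> classC k (fun p => f p - g p).
Proof. by move=> fk gk; apply: classC_add => //; exact: classC_opp. Qed.

Lemma classC_sum V k (I : Type) (r : seq I) (P : pred I) (F : I -> V -> R) :
  (forall i, P i -> classC k (F i)) -> classC k (fun p => \sum_(i <- r | P i) F i p).
Proof.
move=> Fk; elim: r => [|i r IH].
  rewrite (_ : (fun p => _) = fun=> 0); first exact: classC_cst.
  by apply/funext => p; rewrite big_nil.
case Pi : (P i); last first.
  rewrite (_ : (fun p => _) = fun p => \sum_(i <- r | P i) F i p)//.
  by apply/funext => p; rewrite big_cons Pi.
rewrite (_ : (fun p => _) = fun p => F i p + \sum_(i <- r | P i) F i p); last first.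
  by apply/funext => p; rewrite big_cons Pi.
by apply: classC_add => //; exact: Fk.
Qed.

Lemma classC_prod V k (I : Type) (r : seq I) (F : I -> V -> R) :
  (forall i, classC k (F i)) -> classC k (fun p => \prod_(i <- r) F i p).
Proof.
move=> Fk; elim: r => [|i r IH].
  rewrite (_ : (fun p => _) = fun=> 1); first exact: classC_cst.
  by apply/funext => p; rewrite big_nil.
rewrite (_ : (fun p => _) = fun p => F i p * \prod_(i <- r) F i p); last first.
  by apply/funext => p; rewrite big_cons.
exact: classC_mul.
Qed.

Lemma is_derive_comp_affine V W (L L0 : V -> W) (f : W -> R) p v df :
  (forall h q u, L (h *: u + q) = h *: L0 u + L q) ->
  is_derive (L p) (L0 v) f df -> is_derive p v (fun q => f (L q)) df.
Proof.
move=> LE /increment_is_derive H; apply: is_derive_increment => e e0.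
by have [d d0 {}H] := H e e0; exists d => // h _ hd; rewrite LE; exact: H.
Qed.

Lemma classC_comp_affine V W k (L L0 : V -> W) (f : W -> R) :
  continuous L -> (forall h q u, L (h *: u + q) = h *: L0 u + L q) ->
  classC k f -> classC k (fun p => f (L p)).
Proof.
move=> Lc LE; elim: k f => [|k IH] f fk.
  by move=> p; apply: continuous_comp; [exact: Lc|exact: fk].
apply: (@classCS _ _ _ (fun v p => 'D_(L0 v) f (L p))).
- move=> p; apply: continuous_comp; [exact: Lc|exact: classC_continuous fk _].
- by move=> v p; exact: is_derive_comp_affine LE (classC_is_derive (L p) (L0 v) fk).
- by move=> v; exact: (IH _ (classC_derive (L0 v) fk)).
Qed.

Lemma classC_affine V k (L : V -> R) (L0 : V -> R) :
  continuous L -> (forall h q u, L (h *: u + q) = h * L0 u + L q) -> classC k L.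
Proof.
move=> Lc LE; case: k => [//|k].
refine (@classCS _ _ _ (fun v _ => L0 v) Lc _ _); last first.
  by move=> v; exact: classC_cst.
move=> v p; apply: is_derive_increment => e e0; exists 1 => // h _ _.
by rewrite LE addrK subrr normr0 mulr_ge0// ltW.
Qed.

Lemma is_derive_comp1 V (phi : R -> R) (g : V -> R) p v dphi dg :
  is_derive (g p) (1 : R) phi dphi -> is_derive p v g dg ->
  is_derive p v (fun q => phi (g q)) (dphi * dg).
Proof.
move=> Hphi Hg.
have Hg' : is_derive (0 : R) (1 : R) (fun h : R => g (h *: v + p)) dg.
  by apply: (iffLR (is_derive_line g p v 0 dg)); rewrite scale0r add0r.
have gp : (fun h : R => g (h *: v + p)) 0 = g p by rewrite /= scale0r add0r.
have Hp' : is_derive ((fun h : R => g (h *: v + p)) 0) (1 : R) phi dphi.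
  by rewrite gp.
have := iffRL (is_derive_line (fun q => phi (g q)) p v 0 (dphi * dg))
  (is_derive1_comp Hp' Hg').
by rewrite scale0r add0r.
Qed.

Lemma is_derive_line1 (phi : R -> R) (x v d : R) :
  is_derive x (1 : R) phi d -> is_derive x v phi (v * d).
Proof.
by move=> H; have := is_derive_scale_direction v H; rewrite [v%:A]mulr1.
Qed.

Lemma classC1S k (phi dphi : R -> R) :
  (forall x : R, is_derive x (1 : R) phi (dphi x)) -> classC k dphi -> classC k.+1 phi.
Proof.
move=> H Hk; apply: (@classCS R _ _ (fun v x : R => v * dphi x)).
- move=> x; apply/differentiable_continuous/derivable1_diffP.
  by have [] := H x.
- by move=> v x; exact: is_derive_line1.
- by move=> v; exact: classC_scale.
Qed.

Lemma classC_comp1 V k (phi : R -> R) (g : V -> R) :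
  classC k phi -> classC k g -> classC k (fun p => phi (g p)).
Proof.
elim: k phi g => [|k IH] phi g Hphi Hg.
  by move=> p; apply: continuous_comp; [exact: Hg|exact: Hphi].
apply: (@classCS _ _ _ (fun v p => 'D_1 phi (g p) * 'D_v g p)).
- move=> p; apply: continuous_comp.
    exact: classC_continuous Hg _.
  exact: classC_continuous Hphi _.
- by move=> v p; exact: is_derive_comp1 (classC_is_derive (g p) 1 Hphi) (classC_is_derive p v Hg).
- move=> v; apply: classC_mul; last exact: classC_derive.
  exact: (IH _ _ (classC_derive (1 : R) Hphi) (classC_le (leqnSn k) Hg)).
Qed.

Lemma is_derive_cosD (x c : R) :
  is_derive x (1 : R) (fun y => cos (y + c)) (cos (x + c + pi / 2)).
Proof.
rewrite cosDpihalf.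
have H : is_derive x (1 : R) (fun y : R => y + c) 1.
  by rewrite -[X in is_derive _ _ _ X]addr0; apply: is_deriveDf.
have := @is_derive_comp1 _ cos (fun y => y + c) _ _ _ _ (is_derive_cos (x + c)) H.
by rewrite mulr1.
Qed.

Lemma classC_cosD k (c : R) : classC k (fun x => cos (x + c)).
Proof.
elim: k c => [|k IH] c.
  move=> x; apply: (@continuous_comp _ _ _ (fun y => y + c) cos).
    by apply: cvgD; [exact: cvg_id|exact: cvg_cst].
  exact: continuous_cos.
apply: (classC1S (dphi := fun x => cos (x + (c + pi / 2)))) => // x.
by rewrite addrA; exact: is_derive_cosD.
Qed.

Lemma classC_cos k : classC k (@cos R).
Proof.
have := classC_cosD k 0; rewrite (_ : (fun x => _) = cos)//.
by apply/funext => x; rewrite addr0.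
Qed.

Lemma sin_cosD (x : R) : sin x = cos (x + - (pi / 2)).
Proof. by rewrite cosB cos_pihalf sin_pihalf mulr0 add0r mulr1. Qed.

Lemma classC_sin k : classC k (@sin R).
Proof.
have := classC_cosD k (- (pi / 2)); rewrite (_ : (fun x => _) = sin)//.
by apply/funext => x; rewrite -sin_cosD.
Qed.

Lemma classC_expR k : classC k (@expR R).
Proof.
elim: k => [|k IH]; first exact: continuous_expR.
by apply: (classC1S (dphi := expR)).
Qed.

End ClassC.

Lemma classC_derive_add (R : realType) (V : normedModType R) k (f : V -> R) p u v :
  classC k.+1 f -> 'D_(u + v) f p = 'D_u f p + 'D_v f p.
Proof.
move=> fk; have := is_derive_add_direction (classC_is_derive p u fk)
  (fun q => classC_derivable fk)
  (@classC_continuous _ _ _ _ (classC_derive v fk) p).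
by case.
Qed.

Lemma classC_derive_scale (R : realType) (V : normedModType R) k (f : V -> R) p c v :
  classC k.+1 f -> 'D_(c *: v) f p = c * 'D_v f p.
Proof.
move=> fk; have := is_derive_scale_direction c (classC_is_derive p v fk).
by case.
Qed.

(** * Dominated series of functions *)

Section Series.
Context {R : realType}.
Implicit Types (u m : nat -> R) (K : R).

Definition bounded_sum m K :=
  (forall j, 0 <= m j) /\ forall n, \sum_(0 <= j < n) m j <= K.

Definition sumN u : R := limn (series u).

Lemma bounded_sum_ge0 m K : bounded_sum m K -> 0 <= K.
Proof. by move=> [_ /(_ 0%N)]; rewrite big_geq. Qed.

Lemma bounded_sum_le m m' K : (forall j, 0 <= m j <= m' j) ->
  bounded_sum m' K -> bounded_sum m K.
Proof.
move=> mm [_ mK]; split=> [j|n]; first by have /andP[] := mm j.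
by apply: le_trans (mK n); apply: ler_sum => j _; have /andP[] := mm j.
Qed.

Lemma bounded_sum_scale c m K : 0 <= c -> bounded_sum m K ->
  bounded_sum (fun j => c * m j) (c * K).
Proof.
move=> c0 [m0 mK]; split=> [j|n]; first exact: mulr_ge0.
by rewrite -mulr_sumr ler_wpM2l.
Qed.

Lemma bounded_sum_cvg m K : bounded_sum m K -> cvgn (series m).
Proof.
move=> [m0 mK]; apply: nondecreasing_is_cvgn.
  by apply: nondecreasing_series => j _ _; exact: m0.
by exists K => _ [n _ <-]; exact: mK.
Qed.

Lemma sumN_cvg m K u : bounded_sum m K -> (forall j, `|u j| <= m j) ->
  cvgn (series u).
Proof.
move=> mK um; apply: normed_cvg.
apply: (@bounded_sum_cvg (fun j => `|u j|) K).
by apply: bounded_sum_le mK => j; rewrite normr_ge0 um.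
Qed.

Definition tail m n : R := sumN m - series m n.

Lemma tail_to0 m K e : bounded_sum m K -> 0 < e -> exists n, tail m n < e.
Proof.
move=> mK e0; have /cvgrPdist_lt/(_ e e0)[n _ /(_ n (leqnn n))] := bounded_sum_cvg mK.
by move=> H; exists n; exact: le_lt_trans (ler_norm _) H.
Qed.

Lemma sumN_tail m K u n c : bounded_sum m K -> 0 <= c ->
  (forall j, `|u j| <= c * m j) -> `|sumN u| <= `|series u n| + c * tail m n.
Proof.
move=> mK c0 um.
have mc := bounded_sum_cvg mK.
have uc := sumN_cvg (bounded_sum_scale c0 mK) um.
have H1 : (fun k => `|series u k|) @ \oo --> `|sumN u| by apply: cvg_norm.
have H2 : (fun k => `|series u n| + c * (series m k - series m n)) @ \oo -->
    `|series u n| + c * tail m n.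
  by apply: cvgD; [exact: cvg_cst|apply: cvgMr; apply: cvgB => //; exact: cvg_cst].
apply: (ler_cvg_to H1 H2).
exists n => // k /= nk; rewrite -lerBlDl; apply: le_trans (lerB_dist _ _) _.
rewrite !sub_series_geq//; apply: le_trans (ler_norm_sum _ _ _) _.
by rewrite mulr_sumr; apply: ler_sum.
Qed.

Lemma sumN_le m K u : bounded_sum m K -> (forall j, `|u j| <= m j) ->
  `|sumN u| <= K.
Proof.
move=> mK um.
have H1 : (fun k => `|series u k|) @ \oo --> `|sumN u|.
  by apply: cvg_norm; exact: sumN_cvg mK um.
apply: (ler_cvg_to H1 (cvg_cst K)).
exists 0%N => // k _; apply: le_trans (ler_norm_sum _ _ _) _.
by apply: le_trans (mK.2 k); apply: ler_sum.
Qed.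

Lemma sumND m m' K K' u u' : bounded_sum m K -> bounded_sum m' K' ->
  (forall j, `|u j| <= m j) -> (forall j, `|u' j| <= m' j) ->
  sumN (fun j => u j + u' j) = sumN u + sumN u'.
Proof.
move=> mK mK' um um'; apply/cvg_lim => //.
rewrite (_ : series _ = series u \+ series u'); last first.
  by apply/funext => n; rewrite /series/= big_split.
by apply: cvgD; [exact: sumN_cvg mK um|exact: sumN_cvg mK' um'].
Qed.

Lemma sumNZ m K u c : bounded_sum m K -> (forall j, `|u j| <= m j) ->
  sumN (fun j => c * u j) = c * sumN u.
Proof.
move=> mK um; apply/cvg_lim => //.
rewrite (_ : series _ = fun n => c * series u n); last first.
  by apply/funext => n; rewrite /series/= mulr_sumr.
by apply: cvgMr; exact: sumN_cvg mK um.
Qed.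

Lemma sumN0 : sumN (fun=> 0) = 0.
Proof.
apply/cvg_lim => //; rewrite (_ : series _ = fun=> 0); first exact: cvg_cst.
by apply/funext => n; rewrite /series/= big1.
Qed.

End Series.

Section TermwiseDerivation.
Context {R : realType} {V : normedModType R}.
Implicit Types (u : nat -> V -> R) (v : V) (k : nat).

(** Weierstrass's condition near each point. Imposed on all derivatives of order
   at most [k], as in [dominatedC], it allows [k] termwise differentiations. *)
Definition locally_dominated u := forall p : V, exists m K,
  bounded_sum m K /\ \forall q \near p, forall j, `|u j q| <= m j.

Fixpoint dominatedC k u : Prop :=
  (forall j, continuous (u j)) /\ locally_dominated u /\
  match k with
  | 0 => True
  | k'.+1 => forall v, (forall j p, derivable (u j) p v) /\
      dominatedC k' (fun j => 'D_v (u j))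
  end.

Definition sumF u (p : V) : R := sumN (u^~ p).

Lemma sumF_continuous u : (forall j, continuous (u j)) ->
  locally_dominated u -> continuous (sumF u).
Proof.
move=> uc ud p; apply: ball_continuous => e e0.
have [m [K [mK /nbhs_ballP[d /= d0 um]]]] := ud p.
have e4 : 0 < e / 4 by rewrite divr_gt0.
have [n tn] := tail_to0 mK e4.
have sc : {for p, continuous (fun q => series (u^~ q) n)}.
  exact: (@classC_sum _ V 0 _ (index_iota 0 n) xpredT u (fun j _ => uc j) p).
have e2 : 0 < e / 2 by rewrite divr_gt0.
have [d' d'0 H] := continuous_ball sc e2.
exists (Num.min d d') => [|q]; first by rewrite lt_min d0.
rewrite lt_min => /andP[qd qd'].
have uq j : `|u j q| <= m j by apply: um; rewrite -ball_normE/= distrC.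
have up j : `|u j p| <= m j by apply: um; exact: ballxx.
have E : sumF u q - sumF u p = sumN (fun j => u j q - u j p).
  rewrite /sumF; have := sumND mK (m' := m) (u' := fun j => - u j p) mK uq.
  move=> ->; last by move=> j; rewrite normrN.
  congr (_ + _); rewrite -mulN1r -(sumNZ _ mK up); congr sumN.
  by apply/funext => j; rewrite mulN1r.
rewrite E; have B j : `|u j q - u j p| <= 2 * m j.
  by apply: le_trans (ler_normB _ _) _; rewrite mulr_natl mulr2n lerD.
apply: le_trans (sumN_tail n mK _ B) _ => //.
have -> : e = e / 2 + 2 * (e / 4) by field.
apply: lerD; last by rewrite ler_wpM2l// ltW.
rewrite [X in `|X|](_ : _ = series (u^~ q) n - series (u^~ p) n).
  exact/ltW/H.
by rewrite /series/= sumrB.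
Qed.

(** By the mean value theorem, the majorants of the derivatives also dominate the
   difference quotients, so that only finitely many terms matter. *)
Lemma sumF_is_derive u v p : (forall j q, derivable (u j) q v) ->
  locally_dominated u -> locally_dominated (fun j => 'D_v (u j)) ->
  is_derive p v (sumF u) (sumF (fun j => 'D_v (u j)) p).
Proof.
move=> du ud dud; apply: is_derive_increment => e e0.
have [m [K [mK /nbhs_ballP[d /= d0 um]]]] := ud p.
have [m' [K' [mK' /nbhs_ballP[d' /= d'0 um']]]] := dud p.
have e4 : 0 < e / 4 by rewrite divr_gt0.
have [n tn] := tail_to0 mK' e4.
have sd : is_derive p v (fun q => \sum_(j < n) u j q) (\sum_(j < n) 'D_v (u j) p).
  have := @is_derive_sum R V R n (fun j => u j) p v (fun j => 'D_v (u j) p)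
    (fun j => derivableP (du j p)).
  by rewrite (_ : \sum_i _ = fun q => \sum_(j < n) u j q)//; apply/funext => q; rewrite fct_sumE.
have e2 : 0 < e / 2 by rewrite divr_gt0.
have [d3 d30 H3] := increment_is_derive sd e2.
have v1 : 0 < `|v| + 1 by rewrite ltr_wpDl.
exists (Num.min d3 (Num.min d d' / (`|v| + 1))).
  by rewrite lt_min d30 divr_gt0// lt_min d0.
move=> h _; rewrite lt_min ltr_pdivlMr// => /andP[hd3 hd].
have nb s : `|s| <= `|h| -> `|p - (s *: v + p)| < Num.min d d'.
  move=> sh; rewrite opprD addrCA subrr addr0 normrN normrZ.
  apply: le_lt_trans hd; apply: le_trans (ler_wpM2r _ sh) _ => //.
  by rewrite ler_wpM2l// lerDl.
have uq j s : `|s| <= `|h| -> `|u j (s *: v + p)| <= m j.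
  move=> /nb; rewrite lt_min => /andP[sd' _].
  by apply: um; rewrite -ball_normE.
have uq' j s : `|s| <= `|h| -> `|'D_v (u j) (s *: v + p)| <= m' j.
  move=> /nb; rewrite lt_min => /andP[_ sd'].
  by apply: um'; rewrite -ball_normE.
have up j : `|u j p| <= m j by have := uq j 0; rewrite normr0 scale0r add0r; exact.
have up' j : `|'D_v (u j) p| <= m' j.
  by have := uq' j 0; rewrite normr0 scale0r add0r; exact.
pose w j := u j (h *: v + p) - u j p - h * 'D_v (u j) p.
have E : sumF u (h *: v + p) - sumF u p - h * sumF (fun j => 'D_v (u j)) p = sumN w.
  rewrite /sumF -(sumNZ _ mK' up') -[- sumN (u^~ p)]mulN1r -(sumNZ _ mK up).
  rewrite -[- sumN _]mulN1r.
  have hm' := bounded_sum_scale (normr_ge0 h) mK'.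
  have hm j : `|h * 'D_v (u j) p| <= `|h| * m' j by rewrite normrM ler_wpM2l.
  rewrite -(sumNZ _ hm' hm) -(sumND mK mK); last 2 first.
  - by move=> j; exact: uq.
  - by move=> j; rewrite mulN1r normrN.
  have mm : bounded_sum (fun j => m j + m j) (K + K).
    split=> [j|k]; first by rewrite addr_ge0// mK.1.
    by rewrite big_split/= lerD// mK.2.
  rewrite -(sumND mm hm'); last 2 first.
  - move=> j; apply: le_trans (ler_normD _ _) _.
    by rewrite lerD ?uq// mulN1r normrN.
  - by move=> j; rewrite mulN1r normrN.
  by congr sumN; apply/funext => j; rewrite /w !mulN1r.
rewrite E.
have wB j : `|w j| <= (2 * `|h|) * m' j.
  apply: le_trans (ler_normB _ _) _; rewrite -mulrA mulr_natl mulr2n.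
  apply: lerD; last by rewrite normrM ler_wpM2l.
  by apply: increment_le => // s sh; exact: uq'.
apply: le_trans (sumN_tail n mK' _ wB) _; first by rewrite mulr_ge0.
have -> : e * `|h| = e / 2 * `|h| + (2 * `|h|) * (e / 4) by field.
apply: lerD; last by rewrite ler_wpM2l ?mulr_ge0// ltW.
rewrite [X in `|X|](_ : _ = \sum_(j < n) u j (h *: v + p) - \sum_(j < n) u j p
  - h * \sum_(j < n) 'D_v (u j) p); first exact: H3.
by rewrite mulr_sumr -!sumrB /series/= big_mkord.
Qed.

Lemma dominatedC_continuous k u : dominatedC k u ->
  (forall j, continuous (u j)) /\ locally_dominated u.
Proof. by case: k => [|k] [? []]. Qed.

Lemma dominatedC_is_derive k u v p : dominatedC k.+1 u ->
  is_derive p v (sumF u) (sumF (fun j => 'D_v (u j)) p).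
Proof.
move=> [uc [ud /(_ v)[du /dominatedC_continuous[_ dud]]]].
exact: sumF_is_derive.
Qed.

Lemma dominatedC_classC k u : dominatedC k u -> classC k (sumF u).
Proof.
elim: k u => [|k IH] u uk; first by have [uc [ud _]] := uk; exact: sumF_continuous.
apply: (@classCS _ _ _ _ (fun v => sumF (fun j => 'D_v (u j)))).
- by have [uc [ud _]] := uk; exact: sumF_continuous.
- by move=> v p; exact: dominatedC_is_derive uk.
- by move=> v; apply: IH; have [_ [_ /(_ v)[_]]] := uk.
Qed.

End TermwiseDerivation.

(** * Primitives of continuous functions *)

Section Primitive.
Context {R : realType}.
Implicit Types (f g h H : R -> R) (a b t x : R).

Lemma derive1_continuous f : (forall x, exists d, is_derive x (1 : R) f d) ->
  continuous f.
Proof.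
move=> fd x; apply/differentiable_continuous/derivable1_diffP.
by have [d []] := fd x.
Qed.

Lemma derivative_ge0_le f df a b : a <= b ->
  (forall x, is_derive x (1 : R) f (df x)) ->
  (forall x, a <= x <= b -> 0 <= df x) -> f a <= f b.
Proof.
move=> ab fd df0.
have fc : continuous f by apply: derive1_continuous => x; exists (df x).
have [|c] := MVT_segment ab (fun x _ => fd x); first exact: continuous_subspaceT.
rewrite in_itv/= => /df0 c0 E.
by rewrite -subr_ge0 E mulr_ge0// subr_ge0.
Qed.

Lemma derivative_le_increment f g df dg a b : a <= b ->
  (forall x, is_derive x (1 : R) f (df x)) ->
  (forall x, is_derive x (1 : R) g (dg x)) ->
  (forall x, a <= x <= b -> df x <= dg x) -> f b - f a <= g b - g a.
Proof.
move=> ab fd gd dfg.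
have H : g a - f a <= g b - f b.
  apply: (derivative_ge0_le ab (fun x => is_deriveDf (gd x) (is_deriveNf (fd x)))).
  by move=> x /dfg; rewrite subr_ge0.
by lra.
Qed.

Lemma derivative_norm_increment f g df dg a b : a <= b ->
  (forall x, is_derive x (1 : R) f (df x)) ->
  (forall x, is_derive x (1 : R) g (dg x)) ->
  (forall x, a <= x <= b -> `|df x| <= dg x) -> `|f b - f a| <= g b - g a.
Proof.
move=> ab fd gd dfg; rewrite ler_norml; apply/andP; split.
  rewrite lerNl; have := @derivative_le_increment (fun x => - f x) g _ _ a b ab
    (fun x => is_deriveNf (fd x)) gd.
  rewrite opprB opprK addrC; apply => x /dfg.
  by rewrite ler_norml => /andP[+ _]; rewrite lerNl.
apply: derivative_le_increment ab fd gd _ => x /dfg.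
by rewrite ler_norml => /andP[_].
Qed.

Lemma same_derivative f g df t : (forall x, is_derive x (1 : R) f (df x)) ->
  (forall x, is_derive x (1 : R) g (df x)) -> f t - f 0 = g t - g 0.
Proof.
move=> fd gd; have := @derivative0_cst _ _ (fun x => f x - g x) 1 0 t.
rewrite addr0 [_%:A]mulr1 => H; have := H _; move=> {H}H.
have {H} : f t - g t = f 0 - g 0.
  by apply: H => q; rewrite -(subrr (df q)); exact: is_deriveDf (fd q) (is_deriveNf (gd q)).
by lra.
Qed.

(** The integral from [- c] is a primitive on the right of [- c] only. Normalized
   at 0, these primitives agree wherever two of them are defined. *)
Lemma primitive_exists h : continuous h ->
  exists H, H 0 = 0 /\ forall x, is_derive x (1 : R) H (h x).
Proof.
move=> hc.
pose F c t := (\int[lebesgue_measure]_(s in `[- c, t]) h s)%R.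
have FD c t : - c < t -> is_derive t (1 : R) (F c) (h t).
  move=> ct; have [| |Fd FE] := @continuous_FTC1_closed R h (- c) t (t + 1) _ _ ct (hc t).
  - by rewrite ltrDl.
  - apply: continuous_compact_integrable; first exact: segment_compact.
    exact: continuous_subspaceT.
  by split=> //; rewrite -derive1E.
pose G c t := F c t - F c 0.
have GE c d t : 0 < c -> 0 < d -> - c < t -> - d < t -> G c t = G d t.
  move=> c0 d0 ct dt.
  have D x : x \in `[Num.min t 0, Num.max t 0] ->
      is_derive x (1 : R) (fun s => F c s - F d s) 0.
    rewrite in_itv/= ge_min le_max => /andP[/orP tx _].
    have xc : - c < x by case: tx => ?; [exact: lt_le_trans ct _|apply: lt_le_trans (_ : 0 <= x) => //; rewrite oppr_lt0].
    have xd : - d < x by case: tx => ?; [exact: lt_le_trans dt _|apply: lt_le_trans (_ : 0 <= x) => //; rewrite oppr_lt0].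
    by rewrite -(subrr (h x)); exact: is_deriveDf (FD _ _ xc) (is_deriveNf (FD _ _ xd)).
  have mM : Num.min t 0 <= Num.max t 0 by rewrite ge_min le_max lexx.
  have [|e _] := @MVT_segment _ _ (fun=> 0) _ _ mM
      (fun x (xI : x \in `](Num.min t 0), (Num.max t 0)[) => D x (subset_itv_oo_cc xI)).
    apply: derivable_within_continuous => x xI.
    by have [] := D x xI.
  rewrite mul0r /G; case: (leP t 0) => t0; lra.
exists (fun t => G (`|t| + 1) t); split=> [|x]; first by rewrite /G subrr.
have x1 : 0 < `|x| + 2 by rewrite ltr_wpDl.
have xlt : - (`|x| + 2) < x.
  by rewrite ltrNl; apply: le_lt_trans (ler_norm _) _; rewrite normrN ltrDl.
have GD : is_derive x (1 : R) (G (`|x| + 2)) (h x).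
  rewrite -[h x]addr0; apply: is_deriveDf; first exact: FD.
apply: is_derive_increment => e e0.
have [d d0 {}GD] := increment_is_derive GD e0.
exists (Num.min d 1) => [|s _]; first by rewrite lt_min d0/=.
rewrite lt_min => /andP[sd s1].
have := GD s sd; rewrite [s%:A]mulr1.
have E y : `|y - x| < 1 -> G (`|x| + 2) y = G (`|y| + 1) y.
  move=> yx; have y1 : `|y| < `|x| + 2.
    rewrite -[y](subrK x) addrC; apply: le_lt_trans (ler_normD _ _) _.
    by rewrite ltrD2l; apply: lt_trans yx _; rewrite ltr1n.
  apply: GE; [exact: x1|by rewrite ltr_wpDl| |].
  - by rewrite ltrNl; apply: le_lt_trans (ler_norm _) _; rewrite normrN.
  - by rewrite ltrNl; apply: le_lt_trans (ler_norm _) _; rewrite normrN ltrDl.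
by rewrite !E// ?addrK// subrr normr0.
Qed.

Definition prim h : R -> R :=
  if pselect (continuous h) is left hc then projT1 (cid (primitive_exists hc))
  else fun=> 0.

Lemma prim_is_derive h x : continuous h -> is_derive x (1 : R) (prim h) (h x).
Proof.
by move=> hc; rewrite /prim; case: pselect => // hc'; case: cid => H /= [].
Qed.

Lemma prim0 h : prim h 0 = 0.
Proof. by rewrite /prim; case: pselect => // hc'; case: cid => H /= []. Qed.

Lemma primE h H t : continuous h -> (forall x, is_derive x (1 : R) H (h x)) ->
  prim h t = H t - H 0.
Proof.
move=> hc Hd; have := same_derivative t (fun x => prim_is_derive x hc) Hd.
by rewrite prim0 subr0.
Qed.

Lemma primD f g t : continuous f -> continuous g ->
  prim (fun x => f x + g x) t = prim f t + prim g t.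
Proof.
move=> fc gc; rewrite (primE (H := fun t => prim f t + prim g t) t
  (classC_add (k := 0) fc gc)
  (fun x => is_deriveDf (prim_is_derive x fc) (prim_is_derive x gc))).
by rewrite !prim0 addr0 subr0.
Qed.

Lemma primZ c f t : continuous f -> prim (fun x => c * f x) t = c * prim f t.
Proof.
move=> fc; rewrite (primE (H := fun t => c * prim f t) t
  (classC_scale (k := 0) c fc)
  (fun x => is_deriveZf c (prim_is_derive x fc))).
by rewrite !prim0 mulr0 subr0.
Qed.

Lemma primB f g t : continuous f -> continuous g ->
  prim (fun x => f x - g x) t = prim f t - prim g t.
Proof.
move=> fc gc; have := @primD f (fun x => -1 * g x) t fc (classC_scale (k := 0) (-1) gc).
rewrite primZ// mulN1r => <-; congr (prim _ t).
by apply/funext => x; rewrite mulN1r.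
Qed.

Lemma prim_increment_le f a b B : continuous f ->
  (forall s, `|s - a| <= `|b - a| -> `|f s| <= B) ->
  `|prim f b - prim f a| <= `|b - a| * B.
Proof.
move=> fc fB.
have fd x : is_derive x (1 : R) (prim f) (f x) by exact: prim_is_derive.
have := @increment_le _ _ (prim f) 1 a (b - a) B.
rewrite [(b - a)%:A]mulr1 subrK; apply=> [q|s sb]; first by have [] := fd q.
have [_ ->] := fd (s%:A + a); apply: fB.
by rewrite [s%:A]mulr1 addrK.
Qed.

Lemma prim_le f t B : continuous f -> (forall s, `|s| <= `|t| -> `|f s| <= B) ->
  `|prim f t| <= `|t| * B.
Proof.
move=> fc fB; have := @prim_increment_le f 0 t B fc.
by rewrite prim0 !subr0; apply=> s; rewrite subr0; exact: fB.
Qed.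

End Primitive.

(** * Primitives depending on a parameter *)

Lemma lipschitz_continuous {R : realType} {V W : normedModType R} (L : V -> W) C :
  (forall x y, `|L x - L y| <= C * `|x - y|) -> continuous L.
Proof.
move=> H x; apply/cvgrPdist_le => e e0.
have C1 : 0 < `|C| + 1 by rewrite ltr_wpDl.
apply/nbhs_ballP; exists (e / (`|C| + 1)); first exact: divr_gt0.
move=> y; rewrite -ball_normE /= ltr_pdivlMr// => xy.
apply: le_trans (H x y) _; apply: le_trans (ltW xy); rewrite mulrC ler_wpM2l//.
by apply: le_trans (ler_norm C) _; rewrite lerDl.
Qed.

Lemma prod_norm_sub {R : realType} {V W : normedModType R} (a c : V) (b d : W) :
  `|(a, b) - (c, d)| = Num.max `|a - c| `|b - d|.
Proof. by []. Qed.

Lemma mul_div_add1_le {R : realType} (x e : R) : 0 <= x -> 0 <= e ->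
  x * (e / (x + 1)) <= e.
Proof.
move=> x0 e0; have x1 : 0 < x + 1 by rewrite ltr_wpDl.
by rewrite mulrA ler_pdivrMr// mulrC ler_wpM2l// lerDl.
Qed.

Section ParametricPrimitive.
Context {R : realType} {V : normedModType R}.
Implicit Types (G : V * R -> R) (p q v : V) (s t : R).

Lemma continuous_pairr p : continuous (fun s : R => (p, s) : V * R).
Proof.
apply: (@lipschitz_continuous _ _ _ _ 1) => x y.
by rewrite prod_norm_sub subrr normr0 mul1r ge_max lexx normr_ge0.
Qed.

Lemma slice_continuous G p : continuous G -> continuous (fun s => G (p, s)).
Proof.
move=> Gc s.
exact: (@continuous_comp R (V * R)%type R (fun s => (p, s)) G s
  (@continuous_pairr p s) (Gc (p, s))).
Qed.

(** Compactness of the segment makes the continuity in the parameter uniform. *)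
Lemma uniform_on_segment G p (B e : R) : continuous G -> 0 < e ->
  exists2 d : R, 0 < d & forall q, `|q - p| < d -> forall s, `|s| <= B ->
    `|G (q, s) - G (p, s)| <= e.
Proof.
move=> Gc e0.
have /compact_near_coveringP cov := @segment_compact R (- B) B.
have /nbhs_ballP[d /= d0 H] : \forall q \near p,
    `[- B, B] `<=` [set s | `|G (q, s) - G (p, s)| <= e].
  apply: cov.
  move=> s _; have e2 : 0 < e / 2 by rewrite divr_gt0.
  have /cvgrPdist_lt/(_ _ e2)[[A1 A2] /= [pA1 sA2] H] := Gc (p, s).
  exists (A2, A1) => //= -[s' q] [/= sA qA].
  have H1 := H (q, s') (conj qA sA).
  have H2 := H (p, s') (conj (nbhs_singleton pA1) sA).
  rewrite (_ : G (q, s') - G (p, s') = (G (p, s) - G (p, s')) - (G (p, s) - G (q, s'))).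
    by apply: le_trans (ler_normB _ _) _; rewrite [e]splitr ltW// ltrD.
  by ring.
exists d => // q qp s sB; apply: (H q).
  by rewrite -ball_normE/= distrC.
by rewrite /= in_itv/= -ler_norml.
Qed.

Lemma bounded_on_segment G p (B : R) : continuous G ->
  exists2 M : R, 0 <= M & forall s, `|s| <= B -> `|G (p, s)| <= M.
Proof.
move=> Gc; have [B0|B0] := ltP B 0.
  by exists 0 => // s /(le_trans (normr_ge0 s)); rewrite leNgt B0.
have c : {within `[- B, B], continuous (fun s => `|G (p, s)|)}.
  apply: continuous_subspaceT => s; apply: cvg_norm; exact: slice_continuous.
have BB : - B <= B by rewrite (@le_trans _ _ 0)// oppr_le0.
have [c0 _ H] := EVT_max BB c.
exists `|G (p, c0)| => // s sB; apply: H.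
by rewrite in_itv/= -ler_norml.
Qed.

Definition prim_param G (P : V * R) : R := prim (fun s => G (P.1, s)) P.2.

Lemma prim_param_continuous G : continuous G -> continuous (prim_param G).
Proof.
move=> Gc [p t]; apply: ball_continuous => e e0.
have t1 : 0 < `|t| + 1 by rewrite ltr_wpDl.
have [M M0 HM] := bounded_on_segment p (`|t| + 1) Gc.
have e1 : 0 < Num.min 1 (e / 2 / (`|t| + 1)).
  by rewrite lt_min ltr01 divr_gt0// divr_gt0.
have [d d0 Hd] := uniform_on_segment p (`|t| + 1) Gc e1.
have M1 : 0 < 2 * (M + 1) by rewrite mulr_gt0// ltr_wpDl.
exists (Num.min d (Num.min 1 (e / (2 * (M + 1))))) => [|[q s]].
  by rewrite !lt_min d0 ltr01 divr_gt0.
rewrite lt_min prod_norm_sub gt_max => /andP[/andP[qd _] +].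
rewrite gt_max => /andP[_]; rewrite lt_min => /andP[s1 sM].
have H1 : `|prim (fun r => G (q, r)) s - prim (fun r => G (q, r)) t| <= e / 2.
  apply: (@le_trans _ _ (`|s - t| * (M + 1))).
    apply: prim_increment_le => [|r rs]; first exact: slice_continuous.
    have rt : `|r| <= `|t| + 1.
      rewrite -[r](subrK t) addrC; apply: le_trans (ler_normD _ _) _.
      by rewrite lerD2l; apply: le_trans rs _; exact: ltW.
    rewrite -[G (q, r)](subrK (G (p, r))) addrC.
    apply: le_trans (ler_normD _ _) _; rewrite lerD ?HM//.
    by have := Hd q qd r rt; rewrite le_min => /andP[].
  by rewrite -ler_pdivlMr ?ltr_wpDl// -mulrA -invfM ltW.
have H2 : `|prim (fun r => G (q, r)) t - prim (fun r => G (p, r)) t| <= e / 2.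
  rewrite -primB; [|exact: slice_continuous|exact: slice_continuous].
  apply: (@le_trans _ _ (`|t| * (e / 2 / (`|t| + 1)))).
    apply: prim_le => [|r rt]; first by apply: (@classC_sub _ _ 0); exact: slice_continuous.
    have rt1 : `|r| <= `|t| + 1 by apply: le_trans rt _; rewrite lerDl.
    by have := Hd q qd r rt1; rewrite le_min => /andP[].
  by apply: mul_div_add1_le => //; rewrite ltW// divr_gt0.
rewrite /prim_param/= (_ : _ - _ = (prim (fun r => G (q, r)) s - prim (fun r => G (q, r)) t)
  + (prim (fun r => G (q, r)) t - prim (fun r => G (p, r)) t)); last by ring.
by apply: le_trans (ler_normD _ _) _; rewrite [e]splitr lerD.
Qed.

Lemma prim_param_is_derive_param G v P : continuous G ->
  (forall Q, derivable G Q (v, 0)) -> continuous ('D_(v, 0) G) ->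
  is_derive P (v, 0) (prim_param G) (prim_param ('D_(v, 0) G) P).
Proof.
case: P => p t Gc Gd dGc; apply: is_derive_increment => e e0.
have t1 : 0 < `|t| + 1 by rewrite ltr_wpDl.
have v1 : 0 < `|v| + 1 by rewrite ltr_wpDl.
have [d d0 Hd] := uniform_on_segment p `|t| dGc (divr_gt0 e0 t1).
exists (d / (`|v| + 1)) => [|h _]; first exact: divr_gt0.
rewrite ltr_pdivlMr// => hd.
rewrite /prim_param/= scaler0 add0r.
have c1 := @slice_continuous G (h *: v + p) Gc.
have c2 := @slice_continuous G p Gc.
have c3 := @slice_continuous ('D_(v, 0) G) p dGc.
have c4 := classC_scale (k := 0) h c3.
rewrite -(primB _ c1 c2) -(primZ _ _ c3) -(primB _ (classC_sub (k := 0) c1 c2) c4).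
apply: (@le_trans _ _ (`|t| * (`|h| * (e / (`|t| + 1))))).
  apply: prim_le => [|s st]; first exact: (classC_sub (k := 0) (classC_sub (k := 0) c1 c2) c4).
  have [s' s'h] := mean_value (p, s) h Gd.
  have pE k : k *: (v, 0) + (p, s) = (k *: v + p, s) :> V * R.
    by congr pair; rewrite /= scaler0 add0r.
  rewrite !pE => ->; rewrite -mulrBr normrM ler_wpM2l// Hd//.
  rewrite addrK normrZ; apply: le_lt_trans hd.
  by apply: ler_pM => //; rewrite lerDl.
by rewrite mulrCA mulrC ler_wpM2r// mul_div_add1_le// ltW.
Qed.

Lemma prim_param_is_derive_endpoint G s P : continuous G ->
  is_derive P ((0 : V), s) (prim_param G) (s * G P).
Proof.
case: P => p t Gc; apply: is_derive_increment => e e0.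
have := increment_is_derive (is_derive_line1 s (prim_is_derive t (@slice_continuous G p Gc))) e0.
move=> [d d0 H]; exists d => // h _ hd.
by rewrite /prim_param/= scaler0 add0r; exact: H.
Qed.

Lemma prim_param_is_derive G v s P : continuous G ->
  (forall Q, derivable G Q (v, 0)) -> continuous ('D_(v, 0) G) ->
  is_derive P (v, s) (prim_param G) (prim_param ('D_(v, 0) G) P + s * G P).
Proof.
move=> Gc Gd dGc.
have H1 := prim_param_is_derive_param P Gc Gd dGc.
have H2 Q := prim_param_is_derive_endpoint s Q Gc.
have E : 'D_((0 : V), s) (prim_param G) = fun Q => s * G Q.
  by apply/funext => Q; have [_ ->] := H2 Q.
have := @is_derive_add_direction _ _ (prim_param G) P (v, 0) (0, s) _ H1.
have -> : (v, 0) + (0, s) = (v, s) :> V * R by congr pair; rewrite /= ?addr0 ?add0r.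
have [_ DE] := H2 P; rewrite E DE => H; apply: H.
- by move=> Q; have [] := H2 Q.
- exact: (classC_scale (k := 0) s Gc).
Qed.

Lemma prim_param_classC k G : classC k G -> classC k (prim_param G).
Proof.
elim: k G => [|k IH] G Gk; first exact: prim_param_continuous.
have Gc := classC_continuous Gk.
apply: (@classCS _ _ _ _ (fun (w : V * R) P => prim_param ('D_(w.1, 0) G) P + w.2 * G P)).
- exact: prim_param_continuous.
- move=> [v s] P; apply: prim_param_is_derive => //.
  + by move=> Q; exact: classC_derivable Gk.
  + by apply: classC_continuous; exact: classC_derive Gk.
- move=> w; apply: classC_add; first by apply: IH; exact: classC_derive.
  by apply: classC_scale; exact: classC_le Gk.
Qed.

End ParametricPrimitive.

(** * Trigonometric integrals on the unit interval *)

Section UnitIntegral.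
Context {R : realType}.
Implicit Types (f g d : R -> R) (x s t th B c : R) (k : nat).

Definition int1 f : R := prim f (1 / 2) - prim f (- (1 / 2)).

Lemma int1D f g : continuous f -> continuous g ->
  int1 (fun x => f x + g x) = int1 f + int1 g.
Proof. by move=> fc gc; rewrite /int1 !primD//; ring. Qed.

Lemma int1Z c f : continuous f -> int1 (fun x => c * f x) = c * int1 f.
Proof. by move=> fc; rewrite /int1 !primZ//; ring. Qed.

Lemma is_derive_scaleid (B x : R) : is_derive x (1 : R) (fun y => B * y) B.
Proof.
by have := is_deriveZf B (is_derive_id x (1 : R)); rewrite mulr1.
Qed.

Lemma int1_le f B : continuous f ->
  (forall x, `|x| <= 1 / 2 -> `|f x| <= B) -> `|int1 f| <= B.
Proof.
move=> fc fB; have h : - (1 / 2) <= 1 / 2 :> R by lra.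
have := derivative_norm_increment h (fun x => prim_is_derive x fc)
  (is_derive_scaleid B).
rewrite (_ : B * (1 / 2) - _ = B); last by field.
by apply=> x xI; apply: fB; rewrite ler_norml.
Qed.

Lemma int1_parts f df g dg : (forall x, is_derive x (1 : R) f (df x)) ->
  (forall x, is_derive x (1 : R) g (dg x)) -> continuous df -> continuous dg ->
  f (1 / 2) = 0 -> f (- (1 / 2)) = 0 ->
  int1 (fun x => df x * g x) = - int1 (fun x => f x * dg x).
Proof.
move=> fd gd dfc dgc f1 f2.
have fc : continuous f by apply: derive1_continuous => x; exists (df x).
have gc : continuous g by apply: derive1_continuous => x; exists (dg x).
have c1 := classC_mul (k := 0) dfc gc.
have c2 := classC_mul (k := 0) fc dgc.
apply/eqP; rewrite -addr_eq0 -(int1D c1 c2) /int1.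
rewrite !(primE _ (classC_add (k := 0) c1 c2) (fun x => is_deriveMf (fd x) (gd x))).
by rewrite f1 f2 !mul0r; apply/eqP; ring.
Qed.

Definition freq k : R := 2 * pi * k%:R.

Lemma cos_freqD2pi k x th : cos (freq k * (x + 1) + th) = cos (freq k * x + th).
Proof.
rewrite /freq; elim: k => [|k IH] in th *; first by rewrite !mulr0 !mul0r.
have -> : 2 * pi * k.+1%:R * (x + 1) + th =
  2 * pi * k%:R * (x + 1) + (2 * pi * x + th) + pi *+ 2 by rewrite -natr1; ring.
by rewrite cosD2pi IH; congr cos; rewrite -natr1; ring.
Qed.

Lemma continuous_coslin (a b : R) : continuous (fun x : R => cos (a * x + b)).
Proof.
apply: (@classC_comp1 _ _ 0 cos (fun x => a * x + b)).
  exact: continuous_cos.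
apply: (classC_add (k := 0)).
  by apply: (classC_scale (k := 0)) => x; exact: cvg_id.
by move=> x; exact: cvg_cst.
Qed.

Lemma is_derive_coslin (a b x : R) : is_derive x (1 : R)
  (fun y => cos (a * y + b)) (a * cos (a * x + b + pi / 2)).
Proof.
have H : is_derive x (1 : R) (fun y => a * y + b) a.
  by rewrite -[a in X in is_derive _ _ _ X]addr0; exact: is_deriveDf (is_derive_scaleid a x) (is_derive_cst b x 1).
have := @is_derive_comp1 _ _ cos (fun y => a * y + b) _ _ _ _ (is_derive_cos (a * x + b)) H.
by rewrite cosDpihalf mulrC.
Qed.

Lemma int1_cos k th : (0 < k)%N -> int1 (fun x => cos (freq k * x + th)) = 0.
Proof.
move=> k0; have f0 : freq k != 0.
  by rewrite /freq !mulf_neq0 ?pnatr_eq0 -?lt0n// gt_eqF ?pi_gt0.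
have D x : is_derive x (1 : R)
    (fun y => (freq k)^-1 * cos (freq k * y + (th - pi / 2))) (cos (freq k * x + th)).
  have := is_deriveZf (freq k)^-1 (is_derive_coslin (freq k) (th - pi / 2) x).
  by rewrite mulrA mulVf// mul1r -addrA subrK.
rewrite /int1 !(primE _ (@continuous_coslin _ _) D).
have := cos_freqD2pi k (- (1 / 2)) (th - pi / 2).
by rewrite (_ : - (1 / 2) + 1 = 1 / 2); [move=> ->; ring|field].
Qed.

Lemma cos_mul (a b : R) : cos a * cos b = 1 / 2 * cos (a + b) + 1 / 2 * cos (a - b).
Proof. by rewrite cosD cosB; field. Qed.

Lemma ltr_cos2pi (u v : R) : 0 <= u -> u < v -> v <= 1 / 2 ->
  cos (2 * pi * v) < cos (2 * pi * u).
Proof.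
move=> u0 uv v1; have p0 : 0 < pi :> R := pi_gt0 R.
have H y : 0 <= y -> y <= 1 / 2 -> 2 * pi * y \in `[0, (pi : R)].
  by move=> y0 y1; rewrite in_itv/=; apply/andP; split; nra.
rewrite ltr_cos; first by rewrite ltr_pM2l// mulr_gt0.
- by apply: H => //; lra.
- by apply: H => //; lra.
Qed.

Lemma cos2pi_norm (u : R) : cos (2 * pi * u) = cos (2 * pi * `|u|).
Proof. by rewrite -[LHS]cos_norm normrM [`|2 * pi|]ger0_norm// mulr_ge0// pi_ge0. Qed.

Lemma cos_away (e u : R) : 0 < e -> e < 1 / 4 -> e <= `|u| -> `|u| <= 1 - e ->
  cos (2 * pi * u) <= cos (2 * pi * e).
Proof.
move=> e0 e4 eu u1.
rewrite (cos2pi_norm u).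
move: eu u1; set v := `|u| => ev v1.
have mono y : e <= y -> y <= 1 / 2 -> cos (2 * pi * y) <= cos (2 * pi * e).
  rewrite le_eqVlt => /orP[/eqP <- //|ey] y1.
  by apply/ltW/ltr_cos2pi => //; exact: ltW.
have [v2|v2] := leP v (1 / 2); first exact: mono.
rewrite -cosN (_ : cos (- _) = cos (2 * pi * (1 - v))); first by apply: mono; lra.
by rewrite -(cosD2pi (- _)); congr cos; ring.
Qed.

(** Rudin's argument: the powers of the trigonometric polynomial [W] below
   concentrate near [x0], and [d] is orthogonal to all of them. *)
Lemma orthogonal_nonpos d x0 : continuous d ->
  (forall k th, int1 (fun x => d x * cos (freq k * x + th)) = 0) ->
  `|x0| < 1 / 2 -> d x0 <= 0.
Proof.
move=> dc d0 x0I; rewrite leNgt; apply/negP => dx0.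
have e0 : 0 < d x0 / 2 by rewrite divr_gt0.
have [r r0 dr] := continuous_ball (dc x0) e0.
pose e := Num.min (Num.min (r / 2) (1 / 8)) (1 / 2 - `|x0|).
have eP : 0 < e by rewrite !lt_min divr_gt0//= subr_gt0 x0I andbT; lra.
have er : e < r by rewrite /e !gt_min; apply/orP; left; apply/orP; left; lra.
have e4 : e < 1 / 4 by rewrite /e !gt_min; apply/orP; left; apply/orP; right; lra.
have ex0 : e <= 1 / 2 - `|x0| by rewrite /e ge_min lexx orbT.
pose c := 1 - cos (2 * pi * e).
pose W x := cos (2 * pi * (x - x0)) + c.
have Wc : continuous W.
  apply: (@classC_add _ _ 0); last by move=> x; exact: cvg_cst.
  rewrite /= (_ : (fun x => _) = fun x => cos (2 * pi * x + - (2 * pi * x0))).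
    exact: continuous_coslin.
  by apply/funext => x; rewrite mulrBr.
have WXc N : continuous (fun x => W x ^+ N).
  elim: N => [|N IH]; first by move=> x; exact: cvg_cst.
  rewrite (_ : (fun x => _) = fun x => W x * W x ^+ N).
    exact: (classC_mul (k := 0) Wc IH).
  by apply/funext => x; rewrite exprS.
have dWc N := classC_mul (k := 0) dc (WXc N).
(* A factor [cos (2 pi (x - x0))] splits each frequency into its two neighbours,
   so that the powers of [W] are trigonometric polynomials. *)
have ortho N k th : int1 (fun x => d x * W x ^+ N * cos (freq k * x + th)) = 0.
  elim: N k th => [|N IH] k th.
    by rewrite -[RHS](d0 k th); congr int1; apply/funext => x; rewrite expr0 mulr1.
  have C k' th' := classC_mul (k := 0) (dWc N) (@continuous_coslin (freq k') th').
  have [k' [th' Ek']] : exists k' th', forall x,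
      cos (freq k * x + th - 2 * pi * (x - x0)) = cos (freq k' * x + th').
    case: k => [|k].
      exists 1%N, (- th - 2 * pi * x0) => x.
      by rewrite -cosN /freq; congr cos; ring.
    exists k, (th + 2 * pi * x0) => x.
    by rewrite /freq -natr1; congr cos; ring.
  have -> : (fun x => d x * W x ^+ N.+1 * cos (freq k * x + th)) =
    fun x => 1 / 2 * (d x * W x ^+ N * cos (freq k.+1 * x + (th - 2 * pi * x0)))
     + (1 / 2 * (d x * W x ^+ N * cos (freq k' * x + th'))
     + c * (d x * W x ^+ N * cos (freq k * x + th))).
    apply/funext => x; rewrite exprS; set z := W x ^+ N; rewrite /W.
    have := cos_mul (freq k * x + th) (2 * pi * (x - x0)).
    rewrite Ek' (_ : freq k * x + th + _ = freq k.+1 * x + (th - 2 * pi * x0)); last first.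
      by rewrite /freq -natr1; ring.
    set A := cos _; set B := cos _ => H.
    rewrite (_ : _ * A = d x * z * (A * B) + c * (d x * z * A)); last by ring.
    by rewrite H; ring.
  have C1 := classC_scale (k := 0) (1 / 2) (C k.+1 (th - 2 * pi * x0)).
  have C2 := classC_scale (k := 0) (1 / 2) (C k' th').
  have C3 := classC_scale (k := 0) c (C k th).
  by rewrite (int1D C1 (classC_add (k := 0) C2 C3)) (int1D C2 C3)
    (int1Z _ (C _ _)) (int1Z _ (C _ _)) (int1Z _ (C _ _)) !IH !mulr0 !addr0.
have int0 N : int1 (fun x => d x * W x ^+ N) = 0.
  rewrite -[RHS](ortho N 0%N 0); congr int1; apply/funext => x.
  by rewrite /freq mulr0 mul0r add0r cos0 mulr1.
have hB : - (1 / 2) <= 1 / 2 :> R by lra.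
have [c0 _ HM] := EVT_max hB (continuous_subspaceT (fun x => cvg_norm (dc x))).
set M := `|d c0| in HM.
have dM x : `|x| <= 1 / 2 -> `|d x| <= M.
  by move=> xI; apply: HM; rewrite in_itv/= -ler_norml.
pose eta := cos (2 * pi * (e / 2)) - cos (2 * pi * e).
have eta0 : 0 < eta by rewrite subr_gt0; apply: ltr_cos2pi; lra.
have near0 x : `|x - x0| <= e -> d x0 / 2 <= d x.
  move=> xe; have := dr x (le_lt_trans xe er).
  by rewrite ltr_norml => /andP[H _]; lra.
have cosmono (u v : R) : `|u| <= v -> v <= 1 / 2 -> cos (2 * pi * v) <= cos (2 * pi * u).
  move=> uv v1; rewrite (cos2pi_norm u).
  move: uv; rewrite le_eqVlt => /orP[/eqP -> //|uv].
  exact: (ltW (ltr_cos2pi (normr_ge0 u) uv v1)).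
have W1 x : `|x - x0| <= e -> 1 <= W x.
  by move=> xe; rewrite /W /c; have := cosmono _ _ xe _; lra.
have W2 x : `|x - x0| <= e / 2 -> 1 + eta <= W x.
  by move=> xe; rewrite /W /c /eta; have := cosmono _ _ xe _; lra.
have lowM N x : `|x| <= 1 / 2 -> - M <= d x * W x ^+ N.
  move=> xI; have [xe|/ltW xe] := leP `|x - x0| e.
    apply: (@le_trans _ _ 0); first by rewrite oppr_le0 normr_ge0.
    apply: mulr_ge0; first exact: (le_trans (ltW e0) (near0 x xe)).
    exact/exprn_ge0/(le_trans ler01 (W1 x xe)).
  have W3 : `|W x| <= 1.
    rewrite /W /c ler_norml; apply/andP; split.
      by have := cos_geN1 (2 * pi * (x - x0)); have := cos_le1 (2 * pi * e); lra.
    suff : cos (2 * pi * (x - x0)) <= cos (2 * pi * e) by lra.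
    apply: cos_away => //; apply: le_trans (ler_normB _ _) _; lra.
  rewrite lerNl; apply: le_trans (ler_norm _) _; rewrite normrN normrM.
  apply: le_trans (ler_piMr _ _) (dM x xI) => //.
  by rewrite normrX exprn_ile1.
(* The integral of [d * W ^+ N] vanishes. Its part near [x0] grows
   geometrically, since [W] exceeds [1 + eta] there, and the rest is bounded,
   since [W] is at most 1 in absolute value. *)
have key N : e * (d x0 / 2) * (1 + eta) ^+ N <= 2 * M.
  pose F := prim (fun x => d x * W x ^+ N).
  have FD x : is_derive x (1 : R) F (d x * W x ^+ N).
    exact: (@prim_is_derive _ (fun x => d x * W x ^+ N) x (dWc N)).
  have x0n := ler_norm x0; have x0n' := ler_norm (- x0); rewrite normrN in x0n'.
  have L1 : (- M) * (x0 - e / 2) - (- M) * (- (1 / 2)) <= F (x0 - e / 2) - F (- (1 / 2)).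
    apply: (derivative_le_increment _ (is_derive_scaleid (- M)) FD); first by lra.
    by move=> x /andP[xl xr]; apply: lowM; rewrite ler_norml; apply/andP; split; lra.
  have L2 : (- M) * (1 / 2) - (- M) * (x0 + e / 2) <= F (1 / 2) - F (x0 + e / 2).
    apply: (derivative_le_increment _ (is_derive_scaleid (- M)) FD); first by lra.
    by move=> x /andP[xl xr]; apply: lowM; rewrite ler_norml; apply/andP; split; lra.
  set B := d x0 / 2 * (1 + eta) ^+ N.
  have L3 : B * (x0 + e / 2) - B * (x0 - e / 2) <= F (x0 + e / 2) - F (x0 - e / 2).
    apply: (derivative_le_increment _ (is_derive_scaleid B) FD); first by lra.
    move=> x /andP[xl xr]; have xe : `|x - x0| <= e / 2.
      by rewrite ler_norml; apply/andP; split; lra.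
    apply: ler_pM; rewrite ?exprn_ge0 ?(ltW e0)//; [lra| |].
      by apply: near0; apply: le_trans xe _; lra.
    by apply: lerXn2r; rewrite ?nnegrE; [lra| |exact: W2]; have := W2 x xe; lra.
  have I0 : F (1 / 2) - F (- (1 / 2)) = 0 := int0 N.
  have M0 : 0 <= M := normr_ge0 _.
  have : e * (d x0 / 2) * (1 + eta) ^+ N = e * B by rewrite /B; ring.
  by move=> ->; nra.
have bern N : 1 + N%:R * eta <= (1 + eta) ^+ N.
  elim: N => [|N IH]; first by rewrite mul0r addr0 expr0.
  rewrite exprS -natr1.
  have : (1 + eta) * (1 + N%:R * eta) <= (1 + eta) * (1 + eta) ^+ N.
    by rewrite ler_wpM2l//; lra.
  apply: le_trans; have : 0 <= N%:R :> R by []. nra.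
pose A := e * (d x0 / 2) * eta.
have A0 : 0 < A by rewrite !mulr_gt0.
have [N HN] : exists N : nat, 2 * M / A < N%:R.
  exists (Num.bound (2 * M / A)); apply: archi_boundP; apply: divr_ge0; last exact: ltW.
  by apply: mulr_ge0 => //; exact: normr_ge0.
move: HN; rewrite ltr_pdivrMr// ltNge => /negP; apply.
apply: le_trans (key N); rewrite /A.
have := bern N; have : 0 < e * (d x0 / 2) by rewrite mulr_gt0.
by nra.
Qed.

Lemma orthogonal_eq0 d x0 : continuous d ->
  (forall k th, int1 (fun x => d x * cos (freq k * x + th)) = 0) ->
  `|x0| < 1 / 2 -> d x0 = 0.
Proof.
move=> dc d0 x0I; apply/eqP; rewrite eq_le (orthogonal_nonpos dc d0)//=.
rewrite -oppr_le0; apply: (@orthogonal_nonpos (fun x => - d x)) => //.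
  exact: (classC_opp (k := 0) dc).
move=> k th; have C := classC_mul (k := 0) dc (@continuous_coslin (freq k) th).
have := int1Z (-1) C; rewrite d0 mulr0 => <-; congr int1.
by apply/funext => x; rewrite mulN1r mulNr.
Qed.

End UnitIntegral.

(** * Fourier inversion in one variable *)

Lemma globally_dominated (R : realType) (V : normedModType R)
    (u : nat -> V -> R) m K :
  bounded_sum m K -> (forall j p, `|u j p| <= m j) -> locally_dominated u.
Proof.
by move=> mK um p; exists m, K; split=> //; apply: filterE => q j; exact: um.
Qed.

Section FourierSeries.
Context {R : realType}.
Implicit Types (f g : R -> R) (x s t th phi B K : R) (k j : nat).

Lemma sumN_delta (k : nat) (c : R) : sumN (fun j => if j == k then c else 0) = c.
Proof.
apply/cvg_lim => //; apply: cvg_near_cst; exists k.+1 => // n /= kn.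
rewrite /series/= big_mkord (bigD1 (Ordinal kn))//= eqxx big1 ?addr0// => i /negPf.
by rewrite -val_eqE/= => ->.
Qed.

Lemma int1_sumF (u : nat -> R -> R) m K : (forall j, continuous (u j)) ->
  bounded_sum m K -> (forall j x, `|u j x| <= m j) ->
  int1 (sumF u) = sumN (fun j => int1 (u j)).
Proof.
move=> uc mK um.
have ld := globally_dominated mK um.
have Sc : continuous (sumF u) by exact: sumF_continuous.
have sc n : continuous (fun x => \sum_(0 <= j < n) u j x).
  exact: (@classC_sum _ _ 0 _ (index_iota 0 n) xpredT u (fun j _ => uc j)).
have sE n : int1 (fun x => \sum_(0 <= j < n) u j x) = \sum_(0 <= j < n) int1 (u j).
  elim: n => [|n IH].
    rewrite big_geq// -[RHS](mul0r (int1 (u 0%N))) -int1Z//; congr int1.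
    by apply/funext => x; rewrite big_geq// mul0r.
  rewrite big_nat_recr//= -IH -int1D//; congr int1.
  by apply/funext => x; rewrite big_nat_recr.
apply/esym/cvg_lim => //; apply/cvgrPdist_le => e e0.
have /cvgrPdist_lt/(_ e e0) := bounded_sum_cvg mK.
apply: filterS => n mn; rewrite /series/= -sE.
have C := classC_scale (k := 0) (-1) (sc n).
have -> : int1 (sumF u) - int1 (fun x => \sum_(0 <= j < n) u j x) =
   int1 (fun x => sumF u x + -1 * (\sum_(0 <= j < n) u j x)).
  by rewrite (int1D Sc C) (int1Z _ (sc n)) mulN1r.
apply: int1_le => [|x _]; first exact: (classC_add (k := 0) Sc C).
rewrite mulN1r; apply: le_trans (ltW mn).
rewrite [X in _ <= X]ger0_norm; last first.
  rewrite subr_ge0; apply: nondecreasing_cvgn_le; last exact: bounded_sum_cvg mK.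
  by apply: nondecreasing_series => j _ _; exact: mK.1.
have H1 : (fun N => `|series (u^~ x) N - series (u^~ x) n|) @ \oo -->
    `|sumF u x - series (u^~ x) n|.
  apply: cvg_norm; apply: cvgB; last exact: cvg_cst.
  exact: sumN_cvg mK (um^~ x).
have H2 : (fun N => series m N - series m n) @ \oo --> sumN m - series m n.
  by apply: cvgB; [exact: bounded_sum_cvg mK|exact: cvg_cst].
apply: (ler_cvg_to H1 H2); exists n => // N /= nN.
rewrite !sub_series_geq//; apply: le_trans (ler_norm_sum _ _ _) _.
by apply: ler_sum.
Qed.

Lemma int1_cst (c : R) : int1 (fun=> c) = c.
Proof.
rewrite /int1 !(primE _ (fun x => @cvg_cst _ c _ (nbhs x) _) (is_derive_scaleid c)).
by field.
Qed.

Lemma freqD j k : freq (j + k) = freq j + freq k :> R.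
Proof. by rewrite /freq natrD mulrDr. Qed.

Lemma freq0 : freq 0 = 0 :> R.
Proof. by rewrite /freq mulr0. Qed.

Lemma int1_cosZ c k th : (0 < k)%N -> int1 (fun x => c * cos (freq k * x + th)) = 0.
Proof. by move=> k0; rewrite (int1Z c (@continuous_coslin R (freq k) th)) int1_cos// mulr0. Qed.

Lemma trig_orthogonality j k phi th :
  int1 (fun x => cos (freq j * x + phi) * cos (freq k * x + th)) =
  if j == k then (if k == 0%N then cos phi * cos th else 1 / 2 * cos (phi - th))
  else 0.
Proof.
have C c i t := classC_scale (k := 0) c (@continuous_coslin R (freq i) t).
have Cc (c : R) : continuous (fun _ : R => c) by move=> x; exact: cvg_cst.
have [<-{k}|jk] := eqVneq j k.
  case: eqP => [->|/eqP j0].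
    rewrite -[RHS]int1_cst; congr int1; apply/funext => x.
    by rewrite freq0 !mul0r !add0r.
  rewrite -[RHS]int1_cst.
  have -> : (fun x => cos (freq j * x + phi) * cos (freq j * x + th)) =
      fun x => 1 / 2 * cos (freq (j + j) * x + (phi + th)) + 1 / 2 * cos (phi - th).
    apply/funext => x; rewrite cos_mul; congr (_ * cos _ + _ * cos _).
      by rewrite freqD; ring.
    by ring.
  by rewrite (int1D (C _ _ _) (Cc _)) int1_cosZ ?add0r// addn_gt0 lt0n j0.
wlog lt : j k phi th jk / (k < j)%N.
  move=> H; have [kj|jk'|/eqP] := ltngtP k j; first exact: H.
    rewrite -(H k j th phi)// 1?eq_sym//; congr int1.
    by apply/funext => x; rewrite mulrC.
  by rewrite eq_sym (negPf jk).
have -> : (fun x => cos (freq j * x + phi) * cos (freq k * x + th)) =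
    fun x => 1 / 2 * cos (freq (j + k) * x + (phi + th)) +
             1 / 2 * cos (freq (j - k) * x + (phi - th)).
  apply/funext => x; rewrite cos_mul; congr (_ * cos _ + _ * cos _).
    by rewrite freqD; ring.
  by rewrite -{1}(subnK (ltnW lt)) freqD; ring.
rewrite (int1D (C _ _ _) (C _ _ _)) !int1_cosZ ?addr0// ?subn_gt0//.
by rewrite addn_gt0 (leq_ltn_trans _ lt).
Qed.

(** The denominator is the symbol of [1 + d^4/dx^4]. Four derivatives leave
   coefficients that are summable with the weight of [fcoef_sum]. *)
Definition fcoef k : R := (if k == 0%N then 1 else 2) / (1 + freq k ^+ 4).

Lemma freq_ge k : 4 * k%:R <= freq k :> R.
Proof.
rewrite /freq ler_wpM2r//; have := @pi_ge2 R; lra.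
Qed.

Lemma freq_ge0 k : 0 <= freq k :> R.
Proof. by apply: le_trans (freq_ge k); rewrite mulr_ge0. Qed.

Lemma freq4_gt0 k : 0 < 1 + freq k ^+ 4 :> R.
Proof. by rewrite ltr_wpDr// exprn_ge0// freq_ge0. Qed.

Lemma fcoef_ge0 k : 0 <= fcoef k.
Proof. by rewrite divr_ge0 ?(ltW (freq4_gt0 k))//; case: ifP. Qed.

Lemma fcoef_sum : bounded_sum (fun k => fcoef k * (1 + freq k) ^+ 2) 2.
Proof.
split=> [k|n]; first by rewrite mulr_ge0 ?fcoef_ge0 ?exprn_ge0// addr_ge0// freq_ge0.
have H k : fcoef k.+1 * (1 + freq k.+1) ^+ 2 <= (k.+1%:R)^-1 - (k.+2%:R)^-1.
  have k1 : 1 <= k.+1%:R :> R by rewrite ler1n.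
  rewrite /fcoef/= -[k.+2%:R]natr1; have := freq_ge k.+1.
  have := freq4_gt0 k.+1.
  set y := freq _; set z := k.+1%:R in k1 * => y4 yz.
  have -> : z^-1 - (z + 1)^-1 = 1 / (z * (z + 1)) by field; rewrite !gt_eqF//; lra.
  rewrite mulrAC ler_pdivrMr// mulrAC ler_pdivlMr; last by rewrite mulr_gt0//; lra.
  rewrite mul1r.
  have : (1 + y) ^+ 2 <= 4 * y ^+ 2 by rewrite !expr2; nra.
  have : z * (z + 1) <= y ^+ 2 / 8.
    have H1 : 0 <= (y - 4 * z) * (y + 4 * z) by apply: mulr_ge0; lra.
    have H2 : 0 <= z * (z - 1) by apply: mulr_ge0; lra.
    by rewrite expr2; lra.
  have -> : y ^+ 4 = y ^+ 2 * y ^+ 2 by ring.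
  have : 0 <= z * (z + 1) by nra.
  have : 0 <= (1 + y) ^+ 2 by exact: sqr_ge0.
  set a := (1 + y) ^+ 2; set b := z * (z + 1); set c := y ^+ 2 => a0 b0 bc ac.
  have : a * b <= 4 * c * (c / 8) by apply: ler_pM.
  by lra.
case: n => [|n]; first by rewrite big_geq.
rewrite big_nat_recl//= {1}/fcoef/= freq0 expr0n/= !addr0 divr1 expr1n mulr1.
have : \sum_(0 <= i < n) fcoef i.+1 * (1 + freq i.+1) ^+ 2 <= 1 - (n.+1%:R)^-1.
  elim: n => [|n IH]; first by rewrite big_geq// invr1 subrr.
  by rewrite big_nat_recr//; apply: le_trans (lerD IH (H n)) _; rewrite addrA subrK.
have : 0 <= (n.+1%:R)^-1 :> R by rewrite invr_ge0.
set a := _^-1 => a0 H1; rewrite -[2]/(1 + 1) lerD2l; apply: le_trans H1 _.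
by rewrite gerBl.
Qed.

Lemma fcoef_sum0 : bounded_sum fcoef 2.
Proof.
apply: bounded_sum_le fcoef_sum => k; rewrite fcoef_ge0/= ler_peMr ?fcoef_ge0//.
by rewrite exprn_ege1// lerDl freq_ge0.
Qed.

Section Inversion.
Variable f : nat -> R -> R.
Hypothesis fd : forall i x, (i < 4)%N -> is_derive x (1 : R) (f i) (f i.+1 x).
Hypothesis f4c : continuous (f 4%N).
Hypothesis f_flat : forall i, (i < 4)%N -> f i (1 / 2) = 0 /\ f i (- (1 / 2)) = 0.

Let fc i : (i <= 4)%N -> continuous (f i).
Proof.
rewrite leq_eqVlt => /orP[/eqP -> //|i4]; apply: derive1_continuous => x.
by exists (f i.+1 x); exact: fd.
Qed.

Let g x := f 0%N x + f 4%N x.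

Let gc : continuous g.
Proof. exact: (classC_add (k := 0) (fc (leq0n 4)) f4c). Qed.

Let Phi k th := int1 (fun s => g s * cos (freq k * s + th)).

Let coef_derive i k th : (i < 4)%N ->
  int1 (fun x => f i.+1 x * cos (freq k * x + th)) =
  freq k * int1 (fun x => f i x * cos (freq k * x + (th - pi / 2))).
Proof.
move=> i4; have [f1 f2] := f_flat i4.
have C th' := @continuous_coslin R (freq k) th'.
have C1 := classC_scale (k := 0) (freq k) (C (th + pi / 2)).
have Cd : continuous (fun x => freq k * cos (freq k * x + th + pi / 2)).
  by rewrite (_ : (fun x => _) = fun x => freq k * cos (freq k * x + (th + pi / 2)))//; apply/funext => x; rewrite addrA.
rewrite (int1_parts (fun x => @fd i x i4) (is_derive_coslin (freq k) th) (fc i4) Cd f1 f2).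
rewrite -mulN1r -int1Z; last exact: (classC_mul (k := 0) (fc (ltnW i4)) (C _)).
rewrite -int1Z; last exact: (classC_mul (k := 0) (fc (ltnW i4)) Cd).
congr int1; apply/funext => x.
by rewrite cosDpihalf addrA cosBpihalf; ring.
Qed.

Let PhiE k th : Phi k th =
  (1 + freq k ^+ 4) * int1 (fun x => f 0%N x * cos (freq k * x + th)).
Proof.
have C i (i4 : (i <= 4)%N) := classC_mul (k := 0) (fc i4) (@continuous_coslin R (freq k) th).
have -> : Phi k th = int1 (fun x => f 0%N x * cos (freq k * x + th)) +
    int1 (fun x => f 4%N x * cos (freq k * x + th)).
  rewrite -(int1D (C 0%N isT) (C 4%N isT)); congr int1.
  by apply/funext => x; rewrite mulrDl.
rewrite !coef_derive// !mulrA [RHS]mulrDl mul1r; congr (_ + _ * int1 _); first by rewrite /freq; ring.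
by apply/funext => x; congr (_ * _); rewrite -cosD2pi; congr cos; field.
Qed.

Let A k x := int1 (fun s => g s * cos (freq k * (s - x))).

Let PhiD k th : Phi k th = cos th * Phi k 0 - sin th * Phi k (- (pi / 2)).
Proof.
have C th' := classC_mul (k := 0) gc (@continuous_coslin R (freq k) th').
rewrite /Phi -mulNr -(int1Z _ (C _)) -(int1Z _ (C _)).
rewrite -(int1D (classC_scale (k := 0) _ (C _)) (classC_scale (k := 0) _ (C _))).
congr int1; apply/funext => s.
by rewrite cosBpihalf addr0 cosD; ring.
Qed.

Let AE k x : A k x = cos (freq k * x + 0) * Phi k 0
  + cos (freq k * x + - (pi / 2)) * Phi k (- (pi / 2)).
Proof.
rewrite addr0 cosBpihalf; have -> : A k x = Phi k (- (freq k * x)).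
  by congr int1; apply/funext => s; congr (_ * cos _); ring.
by rewrite PhiD cosN sinN mulNr opprK.
Qed.

Let A_orth j k th : int1 (fun x => A j x * cos (freq k * x + th)) =
  if j == k then (if k == 0%N then 1 else 1 / 2) * Phi k th else 0.
Proof.
have C phi := classC_mul (k := 0) (@continuous_coslin R (freq j) phi)
  (@continuous_coslin R (freq k) th).
have -> : (fun x => A j x * cos (freq k * x + th)) = fun x =>
  Phi j 0 * (cos (freq j * x + 0) * cos (freq k * x + th)) +
  Phi j (- (pi / 2)) * (cos (freq j * x + - (pi / 2)) * cos (freq k * x + th)).
  by apply/funext => x; rewrite AE; ring.
rewrite (int1D (classC_scale (k := 0) _ (C _)) (classC_scale (k := 0) _ (C _))).
rewrite !(int1Z _ (C _)) !trig_orthogonality.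
have [->|_] := eqVneq j k; last by rewrite !mulr0 addr0.
rewrite (PhiD k th) cosN cos_pihalf cos0; case: eqP => [->|_].
  rewrite (_ : Phi 0 (- (pi / 2)) = 0); first by ring.
  rewrite /Phi -[RHS](int1_cst 0); congr int1; apply/funext => x.
  by rewrite freq0 mul0r add0r cosN cos_pihalf mulr0.
rewrite sub0r cosN -opprD cosN [pi / 2 + th]addrC cosDpihalf; ring.
Qed.

(** Integration by parts has no boundary terms, so that the coefficients of
   [f 0 + f 4] are those of [f 0] times [1 + freq k ^+ 4]. The difference of the
   two sides is then continuous and orthogonal to all trigonometric functions. *)
Lemma fourier_inversion x : `|x| < 1 / 2 ->
  f 0%N x = sumN (fun k => fcoef k * int1 (fun s => g s * cos (freq k * (s - x)))).
Proof.
move=> xI.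
have hB : - (1 / 2) <= 1 / 2 :> R by lra.
have gnc : continuous (fun y => `|g y|) by move=> y; apply: cvg_norm; exact: gc.
have [c0 _ HM] := EVT_max hB (continuous_subspaceT gnc).
have gB s : `|s| <= 1 / 2 -> `|g s| <= `|g c0|.
  by move=> sI; apply: HM; rewrite in_itv/= -ler_norml.
set B := `|g c0| in gB.
have AB k y : `|A k y| <= B.
  apply: int1_le => [|s sI].
    apply: (classC_mul (k := 0) gc).
    rewrite (_ : (fun s => _) = fun s => cos (freq k * s + - (freq k * y))).
      exact: continuous_coslin.
    by apply/funext => s; rewrite mulrBr.
  rewrite normrM; apply: le_trans (gB s sI).
  by rewrite ler_piMr// cos_max.
have Ac k : continuous (A k).
  have -> : A k = fun y => cos (freq k * y + 0) * Phi k 0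
      + cos (freq k * y + - (pi / 2)) * Phi k (- (pi / 2)).
    by apply/funext => y; exact: AE.
  exact: (classC_add (k := 0)
    (classC_mul (k := 0) (@continuous_coslin R _ _) (@classC_cst R R 0 _))
    (classC_mul (k := 0) (@continuous_coslin R _ _) (@classC_cst R R 0 _))).
pose u k y := fcoef k * A k y.
have uc k : continuous (u k) by exact: (classC_scale (k := 0) _ (Ac k)).
pose m k := B * fcoef k.
have mK : bounded_sum m (B * 2) by apply: bounded_sum_scale fcoef_sum0; exact: normr_ge0.
have um k y : `|u k y| <= m k.
  by rewrite normrM ger0_norm ?fcoef_ge0// mulrC ler_wpM2r ?fcoef_ge0.
have ld := globally_dominated mK um.
have Sc : continuous (sumF u) by exact: sumF_continuous.
have f0c := fc (leq0n 4).
apply/eqP; rewrite -subr_eq0 -/(sumF u x); apply/eqP.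
have dc := classC_sub (k := 0) f0c Sc.
apply: (@orthogonal_eq0 _ (fun x => f 0%N x - sumF u x) x dc) => // k th.
have cc := @continuous_coslin R (freq k) th.
have C0 := classC_mul (k := 0) f0c cc.
have C1 := classC_mul (k := 0) Sc cc.
have -> : (fun x => (f 0%N x - sumF u x) * cos (freq k * x + th)) =
   fun x => f 0%N x * cos (freq k * x + th) + -1 * (sumF u x * cos (freq k * x + th)).
  by apply/funext => y; ring.
rewrite (int1D C0 (classC_scale (k := 0) _ C1)) (int1Z _ C1).
have -> : int1 (fun x => sumF u x * cos (freq k * x + th)) =
    sumN (fun j => int1 (fun x => u j x * cos (freq k * x + th))).
  rewrite -(@int1_sumF (fun j x => u j x * cos (freq k * x + th)) m (B * 2)) //.
  - congr int1; apply/funext => y; rewrite /sumF mulrC -(sumNZ _ mK (um^~ y)).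
    by congr sumN; apply/funext => j; rewrite mulrC.
  - by move=> j; exact: (classC_mul (k := 0) (uc j) cc).
  - move=> j y; rewrite normrM; apply: le_trans (um j y).
    by rewrite ler_piMr// cos_max.
have -> : (fun j => int1 (fun x => u j x * cos (freq k * x + th))) =
   fun j => if j == k then int1 (fun x => f 0%N x * cos (freq k * x + th)) else 0.
  apply/funext => j.
  have -> : (fun x => u j x * cos (freq k * x + th)) =
      fun x => fcoef j * (A j x * cos (freq k * x + th)).
    by apply/funext => y; rewrite mulrA.
  rewrite int1Z; last exact: (classC_mul (k := 0) (Ac j) cc).
  rewrite A_orth; case: eqP => [->|_]; last by rewrite mulr0.
  rewrite PhiE /fcoef; have := freq4_gt0 k => /gt_eqF /negbT n0.
  by case: ifP => _; field.
by rewrite sumN_delta mulN1r subrr.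
Qed.

End Inversion.

End FourierSeries.

(** * Double series *)

Section DoubleSeries.
Context {R : realType}.

Lemma nat2_bijection : exists f : nat -> nat * nat, injective f /\ forall p, exists m, f m = p.
Proof.
have : card_eq [set: nat] [set: nat * nat] by rewrite card_eq_sym card_nat2.
move=> /card_set_bijP[f [_ fi fs]]; exists f; split=> [x y|p].
  by apply: fi; rewrite inE.
by have [m _ <-] := fs p Logic.I; exists m.
Qed.

Definition unpair : nat -> nat * nat := projT1 (cid nat2_bijection).

Lemma unpair_inj : injective unpair.
Proof. by rewrite /unpair; case: cid => f []. Qed.

Lemma unpair_surj p : exists m, unpair m = p.
Proof. by rewrite /unpair; case: cid => f []. Qed.

Lemma sum_sub_seq (I : eqType) (s t : seq I) (b : I -> R) : (forall i, 0 <= b i) ->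
  uniq s -> uniq t -> {subset s <= t} -> \sum_(i <- s) b i <= \sum_(i <- t) b i.
Proof.
move=> b0 us ut st; rewrite [X in _ <= X](bigID (mem s))/=.
have -> : \sum_(i <- t | i \in s) b i = \sum_(i <- s) b i.
  rewrite -big_filter; apply: perm_big; apply: uniq_perm => //.
    exact: filter_uniq.
  by move=> i; rewrite mem_filter; apply: andb_idr; exact: st.
by rewrite lerDl sumr_ge0.
Qed.

Lemma sum_rectangle (b : nat * nat -> R) A B :
  \sum_(i <- [seq (k, j) | k <- iota 0 A, j <- iota 0 B]) b i =
  \sum_(0 <= k < A) \sum_(0 <= j < B) b (k, j).
Proof. by rewrite big_allpairs_dep /index_iota !subn0. Qed.

Lemma rectangle_uniq A B : uniq [seq (k, j) | k <- iota 0 A, j <- iota 0 B].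
Proof. by apply: allpairs_uniq; rewrite ?iota_uniq// => -[? ?] [? ?]. Qed.

Lemma sum_unpair_le (b : nat * nat -> R) M : (forall i, 0 <= b i) ->
  exists A B, \sum_(0 <= m < M) b (unpair m) <=
    \sum_(0 <= k < A) \sum_(0 <= j < B) b (k, j).
Proof.
move=> b0; pose A := \max_(m < M) (unpair m).1.+1; pose B := \max_(m < M) (unpair m).2.+1.
exists A, B; rewrite -sum_rectangle.
have -> : \sum_(0 <= m < M) b (unpair m) = \sum_(i <- map unpair (iota 0 M)) b i.
  by rewrite big_map /index_iota subn0.
apply: sum_sub_seq => //; first by rewrite map_inj_uniq ?iota_uniq//; exact: unpair_inj.
  exact: rectangle_uniq.
move=> _ /mapP[m + ->]; rewrite mem_iota/= add0n => mM.
apply/allpairsP; exists (unpair m); rewrite !mem_iota/= !add0n -surjective_pairing; split=> //.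
  exact: (leq_bigmax (F := fun m : 'I_M => (unpair m).1.+1) (Ordinal mM)).
exact: (leq_bigmax (F := fun m : 'I_M => (unpair m).2.+1) (Ordinal mM)).
Qed.

Lemma sum_rectangle_le (b : nat * nat -> R) A B : (forall i, 0 <= b i) ->
  exists M, \sum_(0 <= k < A) \sum_(0 <= j < B) b (k, j) <=
    \sum_(0 <= m < M) b (unpair m).
Proof.
move=> b0; have [inv invE] := choice unpair_surj.
pose M := \max_(p : 'I_A * 'I_B) (inv (p.1 : nat, p.2 : nat)).+1.
exists M; rewrite -sum_rectangle.
have -> : \sum_(0 <= m < M) b (unpair m) = \sum_(i <- map unpair (iota 0 M)) b i.
  by rewrite big_map /index_iota subn0.
apply: sum_sub_seq => //; first exact: rectangle_uniq.
  by rewrite map_inj_uniq ?iota_uniq//; exact: unpair_inj.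
move=> _ /allpairsP[[k j]/= [+ + ->]]; rewrite !mem_iota/= !add0n => kA jB.
apply/mapP; exists (inv (k, j)); last by rewrite invE.
rewrite mem_iota/= add0n.
exact: (leq_bigmax (F := fun p : 'I_A * 'I_B => (inv (p.1 : nat, p.2 : nat)).+1)
  (Ordinal kA, Ordinal jB)).
Qed.

Lemma bounded_sum_unpair (b : nat -> nat -> R) K K' :
  (forall k, bounded_sum (b k) (K k)) -> bounded_sum K K' ->
  bounded_sum (fun m => b (unpair m).1 (unpair m).2) K'.
Proof.
move=> bK KK'; split=> [m|M]; first exact: (bK _).1.
have [A [B H]] := @sum_unpair_le (fun p => b p.1 p.2) M (fun p => (bK _).1 _).
apply: le_trans H _; apply: le_trans (KK'.2 A).
by apply: ler_sum => k _; exact: (bK k).2.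
Qed.

Lemma bounded_sum_sumN (b : nat -> R) K : bounded_sum b K -> bounded_sum b (sumN b).
Proof.
move=> bK; split; first exact: bK.1.
move=> n; have := @nondecreasing_cvgn_le _ (series b).
by apply; [apply: nondecreasing_series => j _ _; exact: bK.1|exact: bounded_sum_cvg bK].
Qed.

Lemma sumN_le_bound (b : nat -> R) K : bounded_sum b K -> sumN b <= K.
Proof.
move=> bK; apply: le_trans (ler_norm _) _; apply: (sumN_le bK) => j.
by rewrite ger0_norm// bK.1.
Qed.

Lemma sumN_ge0 (b : nat -> R) K : bounded_sum b K -> 0 <= sumN b.
Proof. by move=> /bounded_sum_sumN bK; exact: (bounded_sum_ge0 bK). Qed.

Lemma bounded_sum_sumN2 (b : nat -> nat -> R) K K' :
  (forall k, bounded_sum (b k) (K k)) -> bounded_sum K K' ->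
  bounded_sum (fun k => sumN (b k)) K'.
Proof.
move=> bK; apply: bounded_sum_le => k.
by rewrite (sumN_ge0 (bK k)) (sumN_le_bound (bK k)).
Qed.

Lemma sumN_unpair_ge0 (b : nat -> nat -> R) K K' :
  (forall k, bounded_sum (b k) (K k)) -> bounded_sum K K' ->
  sumN (fun m => b (unpair m).1 (unpair m).2) = sumN (fun k => sumN (b k)).
Proof.
move=> bK KK'; have sK := bounded_sum_sumN2 bK KK'.
have uK := bounded_sum_unpair bK KK'.
apply/eqP; rewrite eq_le; apply/andP; split.
  apply: sumN_le_bound; apply: bounded_sum_unpair (bounded_sum_sumN sK) => k.
  exact: bounded_sum_sumN (bK k).
apply: sumN_le_bound; split=> [k|A]; first exact: sumN_ge0 (bK k).
have H : (fun B => \sum_(0 <= k < A) series (b k) B) @ \oo -->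
    \sum_(0 <= k < A) sumN (b k).
  elim: A => [|A IH].
    rewrite big_geq// (_ : (fun B => _) = fun=> 0); first exact: cvg_cst.
    by apply/funext => B; rewrite big_geq.
  rewrite big_nat_recr//= (_ : (fun B => _) =
    (fun B => \sum_(0 <= k < A) series (b k) B + series (b A) B)); last first.
    by apply/funext => B; rewrite big_nat_recr.
  by apply: cvgD => //; exact: bounded_sum_cvg (bK A).
apply: (ler_cvg_to H (cvg_cst _)); apply: filterE => B.
have [M HM] := @sum_rectangle_le (fun p => b p.1 p.2) A B (fun p => (bK _).1 _).
by apply: le_trans HM _; exact: (bounded_sum_sumN uK).2.
Qed.

(** Adding a multiple of the majorant reduces this to nonnegative terms. *)
Lemma sumN_unpair (x b : nat -> nat -> R) c K K' : 0 <= c ->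
  (forall k, bounded_sum (b k) (K k)) -> bounded_sum K K' ->
  (forall k j, `|x k j| <= c * b k j) ->
  sumN (fun m => x (unpair m).1 (unpair m).2) = sumN (fun k => sumN (x k)).
Proof.
move=> c0 bK KK' xb.
pose y k j := x k j + c * b k j.
have y0 k j : 0 <= y k j <= 2 * (c * b k j).
  have := xb k j; rewrite ler_norml => /andP[H1 H2]; rewrite /y.
  by apply/andP; split; lra.
have cbK k := bounded_sum_scale c0 (bK k).
have yK k : bounded_sum (y k) (2 * (c * K k)).
  by apply: bounded_sum_le (y0 k) (bounded_sum_scale _ (cbK k)).
have cKK' := bounded_sum_scale c0 KK'.
have yKK' : bounded_sum (fun k => 2 * (c * K k)) (2 * (c * K')) := bounded_sum_scale (ler0n _ 2) cKK'.
have E1 := sumN_unpair_ge0 yK yKK'.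
have E2 := sumN_unpair_ge0 cbK cKK'.
have uK := bounded_sum_unpair cbK cKK'.
have P1 : sumN (fun m => y (unpair m).1 (unpair m).2) =
   sumN (fun m => x (unpair m).1 (unpair m).2) +
   sumN (fun m => c * b (unpair m).1 (unpair m).2).
  rewrite -(sumND uK uK)// => m; rewrite ger0_norm//.
  by rewrite mulr_ge0// (bK _).1.
have P2 : sumN (fun k => sumN (y k)) =
    sumN (fun k => sumN (x k)) + sumN (fun k => sumN (fun j => c * b k j)).
  have sK := bounded_sum_sumN2 cbK cKK'.
  rewrite -(sumND sK sK).
  - congr sumN; apply/funext => k; rewrite -(sumND (cbK k) (cbK k))// => j.
    by rewrite ger0_norm// mulr_ge0// (bK _).1.
  - by move=> k; apply: sumN_le (bounded_sum_sumN (cbK k)) (xb k).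
  - by move=> k; rewrite ger0_norm// (sumN_ge0 (cbK k)).
by move: E1; rewrite P1 P2 E2 => /addIr.
Qed.

End DoubleSeries.

(** * A weighted Wiener algebra in the space variables *)

Section WaveClass.
Context {R : realType} {n : nat}.
Local Notation V := (R * 'rV[R]_n)%type.
Implicit Types (p : V) (x xi eta : 'rV[R]_n) (th phi t K c : R) (E : R -> R)
  (F G : V -> R) (D : set V).

Definition l1 xi : R := \sum_(i < n) `|xi 0 i|.
(** The square controls two derivatives of a cosine of frequency [xi]; it is
   submultiplicative by [weightD], hence the stability under products below. *)
Definition weight xi : R := (1 + l1 xi) ^+ 2.

Lemma l1_ge0 xi : 0 <= l1 xi.
Proof. by rewrite sumr_ge0. Qed.

Lemma weight_ge1 xi : 1 <= weight xi.
Proof. by rewrite exprn_ege1// lerDl l1_ge0. Qed.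

Lemma weight_ge0 xi : 0 <= weight xi.
Proof. exact: le_trans ler01 (weight_ge1 xi). Qed.

Lemma l1D xi eta : l1 (xi + eta) <= l1 xi + l1 eta.
Proof.
rewrite /l1 -big_split/=; apply: ler_sum => i _.
by rewrite mxE ler_normD.
Qed.

Lemma l1N xi : l1 (- xi) = l1 xi.
Proof. by apply: eq_bigr => i _; rewrite mxE normrN. Qed.

Lemma weightN xi : weight (- xi) = weight xi.
Proof. by rewrite /weight l1N. Qed.

Lemma weightD xi eta : weight (xi + eta) <= weight xi * weight eta.
Proof.
rewrite /weight -exprMn; apply: lerXn2r; rewrite ?nnegrE ?mulr_ge0 ?addr_ge0 ?l1_ge0//.
have := l1D xi eta; have := l1_ge0 xi; have := l1_ge0 eta; nra.
Qed.

Lemma dotvDl x y z : dotv (x + y) z = dotv x z + dotv y z :> R.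
Proof. by rewrite /dotv -big_split/=; apply: eq_bigr => i _; rewrite !mxE mulrDl. Qed.

Lemma dotvC x y : dotv x y = dotv y x.
Proof. by apply: eq_bigr => i _; rewrite mulrC. Qed.

Lemma dotvDr x y z : dotv z (x + y) = dotv z x + dotv z y.
Proof. by rewrite dotvC dotvDl !(dotvC z). Qed.

Lemma dotvZl c x y : dotv (c *: x) y = c * dotv x y.
Proof. by rewrite /dotv mulr_sumr; apply: eq_bigr => i _; rewrite !mxE mulrA. Qed.

Lemma dotvZr c x y : dotv x (c *: y) = c * dotv x y.
Proof. by rewrite dotvC dotvZl dotvC. Qed.

Lemma dotvNl x y : dotv (- x) y = - dotv x y.
Proof. by rewrite -scaleN1r dotvZl mulN1r. Qed.

Lemma dotv0l x : dotv 0 x = 0.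
Proof. by rewrite -(scale0r 0) dotvZl mul0r. Qed.

(** The number [maj] bounds the weighted amplitude relatively to a function of
   time, see [atom_ok]. *)
Record atom := Atom { amp : R -> R; wavev : 'rV[R]_n; phase : R; maj : R }.

Implicit Types (A : atom) (d : nat -> atom).

Definition atom_ok E A := continuous (amp A) /\
  forall t, `|amp A t| * weight (wavev A) <= maj A * E t.

Definition atom_val A p : R := amp A p.1 * cos (dotv (wavev A) p.2 + phase A).

Definition family_ok E d K :=
  (forall j, atom_ok E (d j)) /\ bounded_sum (fun j => maj (d j)) K.

Definition family_sum (phi : atom -> V -> R) d p : R := sumN (fun j => phi (d j) p).

(** A ball of radius [K] in a weighted Wiener algebra. The series represents [F]
   on [D] only, so that [F] can be cut off outside [D] before it is expanded. *)
Definition wiener D E F K := exists d, family_ok E d K /\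
  forall p, D p -> F p = family_sum atom_val d p.

Lemma atom_amp_le E A t : atom_ok E A -> `|amp A t| <= maj A * E t.
Proof.
move=> [_ H]; apply: le_trans (H t).
by rewrite ler_peMr// weight_ge1.
Qed.

Lemma atom_val_le E A p : atom_ok E A -> `|atom_val A p| <= maj A * E p.1.
Proof.
move=> H; rewrite normrM; apply: le_trans (atom_amp_le p.1 H).
by rewrite ler_piMr// cos_max.
Qed.

Definition interleave (d : nat -> nat -> atom) m := d (unpair m).1 (unpair m).2.

Lemma interleave_ok E (d : nat -> nat -> atom) (K : nat -> R) K' :
  (forall k, family_ok E (d k) (K k)) -> bounded_sum K K' ->
  family_ok E (interleave d) K'.
Proof.
move=> dK KK'; split=> [m|]; first exact: (dK _).1.
exact: (bounded_sum_unpair (fun k => (dK k).2) KK').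
Qed.

Lemma interleave_sum E (phi : atom -> V -> R) (d : nat -> nat -> atom) (K : nat -> R) K' p c :
  0 <= c -> (forall A, atom_ok E A -> `|phi A p| <= c * maj A) ->
  (forall k, family_ok E (d k) (K k)) -> bounded_sum K K' ->
  family_sum phi (interleave d) p = sumN (fun k => family_sum phi (d k) p).
Proof.
move=> c0 phiB dK KK'.
apply: (@sumN_unpair _ (fun k j => phi (d k j) p) (fun k j => maj (d k j)) c K K') => //.
  by move=> k; exact: (dK k).2.
by move=> k j; apply/phiB/(dK k).1.
Qed.

Lemma wiener_sum D E (F : nat -> V -> R) G (K : nat -> R) K' : (forall t, 0 <= E t) ->
  (forall k, wiener D E (F k) (K k)) -> bounded_sum K K' ->
  (forall p, D p -> G p = sumN (fun k => F k p)) -> wiener D E G K'.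
Proof.
move=> E0 /choice[d dF] KK' GE; exists (interleave d); split.
  exact: interleave_ok (fun k => (dF k).1) KK'.
move=> p Dp; rewrite GE//.
rewrite (@interleave_sum E atom_val d K K' p (E p.1) (E0 _) _ (fun k => (dF k).1) KK').
  by congr sumN; apply/funext => k; exact: (dF k).2.
by move=> A /(atom_val_le p); rewrite mulrC.
Qed.

Lemma wiener_le D E F K K' : K <= K' -> wiener D E F K -> wiener D E F K'.
Proof.
move=> KK' [d [[d1 [d2 d3]] dF]]; exists d; split=> //; split=> //; split=> // m.
exact: le_trans (d3 m) KK'.
Qed.

Lemma wiener_ext D E F G K : (forall p, D p -> F p = G p) ->
  wiener D E F K -> wiener D E G K.
Proof.
move=> FG [d [dK dF]]; exists d; split=> // p Dp.
by rewrite -FG// dF.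
Qed.

Definition atom0 : atom := Atom (fun=> 0) 0 0 0.

Lemma wiener0 D E : wiener D E (fun=> 0) 0.
Proof.
exists (fun=> atom0); split.
  split; last by split=> [//|m]; rewrite big1.
  move=> _; split=> [t|t /=]; first exact: cvg_cst.
  by rewrite normr0 !mul0r.
move=> p _; rewrite /family_sum -[LHS](@sumN0 R); congr sumN.
by apply/funext => j; rewrite /atom_val/= mul0r.
Qed.

Lemma wiener_ge0 D E F K : wiener D E F K -> 0 <= K.
Proof. by move=> [d [[_ dK] _]]; exact: bounded_sum_ge0 dK. Qed.

Lemma wiener_add D E F G K K' : (forall t, 0 <= E t) ->
  wiener D E F K -> wiener D E G K' -> wiener D E (fun p => F p + G p) (K + K').
Proof.
move=> E0 FK GK'.
have K0 := wiener_ge0 FK; have K'0 := wiener_ge0 GK'.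
pose H k := if k is 0%N then F else if k is 1%N then G else fun=> 0.
pose L k := if k is 0%N then K else if k is 1%N then K' else 0.
have S2 (u : nat -> R) m : (forall k, u k.+2 = 0) -> (2 <= m)%N ->
    \sum_(0 <= k < m) u k = u 0%N + u 1%N.
  move=> u0; case: m => [|[|m]]// _; rewrite !big_nat_recl//= big1 ?addr0//.
have LS : bounded_sum L (K + K').
  split=> [[|[|k]]//|m].
  case: m => [|[|m]]; first by rewrite big_geq// addr_ge0.
    by rewrite big_nat1 lerDl.
  by rewrite S2.
apply: (@wiener_sum D E H _ L) => // [[|[|k]]//|p Dp]; first exact: wiener0.
apply/esym/cvg_lim => //; apply: cvg_near_cst; exists 2%N => // m /= m2.
by rewrite /series/= (S2 (fun k => H k p)).
Qed.

Lemma wiener_mul_time D E E' F K (g : R -> R) c : continuous g -> 0 <= c ->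
  (forall t, `|g t| * E t <= c * E' t) ->
  wiener D E F K -> wiener D E' (fun p => g p.1 * F p) (c * K).
Proof.
move=> gc c0 gE [d [dK dF]].
exists (fun j => Atom (fun t => g t * amp (d j) t) (wavev (d j)) (phase (d j)) (c * maj (d j))).
split.
  split; last exact: bounded_sum_scale c0 dK.2.
  move=> j; have [ac aE] := dK.1 j; split=> [|t /=].
    exact: (classC_mul (k := 0) gc ac).
  rewrite normrM -[leLHS]mulrA.
  have H1 : `|g t| * (`|amp (d j) t| * weight (wavev (d j))) <= `|g t| * (maj (d j) * E t).
    by rewrite ler_wpM2l.
  apply: (le_trans H1); rewrite mulrCA [c * _]mulrC -[leRHS]mulrA.
  by rewrite ler_wpM2l// dK.2.1.
move=> p Dp; rewrite dF// /family_sum.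
have B j : `|atom_val (d j) p| <= E p.1 * maj (d j).
  by rewrite mulrC; exact: atom_val_le (dK.1 j).
have [Ep|Ep] := leP 0 (E p.1).
  rewrite -(sumNZ _ (bounded_sum_scale Ep dK.2) B); congr sumN.
  by apply/funext => j; rewrite /atom_val/= mulrA.
have a0 j : atom_val (d j) p = 0.
  apply/eqP; rewrite -normr_le0; apply: le_trans (B j) _.
  by apply: mulr_le0_ge0; [exact: ltW|exact: dK.2.1].
rewrite (_ : (fun j => atom_val (d j) p) = fun=> 0); last by apply/funext => j.
rewrite sumN0 mulr0 -[LHS](@sumN0 R); congr sumN; apply/funext => j.
by rewrite /atom_val/= -mulrA -/(atom_val (d j) p) a0 mulr0.
Qed.

Lemma wiener_scale D E F K c : (forall t, 0 <= E t) ->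
  wiener D E F K -> wiener D E (fun p => c * F p) (`|c| * K).
Proof. by move=> E0; apply: (@wiener_mul_time _ _ _ _ _ (fun=> c)) => // t; exact: cvg_cst. Qed.

Definition shift_atom eta phi A : atom :=
  Atom (amp A) (wavev A + eta) (phase A + phi) (maj A * weight eta).

(** By the product formula for cosines, all frequencies move by [eta] or by
   [- eta]. *)
Lemma wiener_mul_cos D E F K eta phi : (forall t, 0 <= E t) ->
  wiener D E F K ->
  wiener D E (fun p => cos (dotv eta p.2 + phi) * F p) (K * weight eta).
Proof.
move=> E0 [d [dK dF]].
have sh eta' phi' : weight eta' = weight eta ->
    family_ok E (fun j => shift_atom eta' phi' (d j)) (K * weight eta).
  move=> ww; split; last first.
    have := bounded_sum_scale (weight_ge0 eta) dK.2.
    rewrite [_ * K]mulrC; apply: bounded_sum_le => j /=.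
    by rewrite ww mulrC lexx mulr_ge0 ?weight_ge0// dK.2.1.
  move=> j; have [ac aE] := dK.1 j; split=> [//|t /=].
  apply: le_trans (ler_wpM2l (normr_ge0 _) (weightD _ _)) _.
  by rewrite mulrA [leRHS]mulrAC ler_wpM2r ?weight_ge0.
have half eta' phi' : weight eta' = weight eta ->
   wiener D E (fun p => 1 / 2 * family_sum atom_val (fun j => shift_atom eta' phi' (d j)) p)
     (1 / 2 * (K * weight eta)).
  move=> /(sh _ phi') ok; rewrite -[1 / 2 in X in wiener _ _ _ X]ger0_norm//.
  by apply: wiener_scale => //; exists (fun j => shift_atom eta' phi' (d j)).
have := wiener_add E0 (half eta phi erefl) (half (- eta) (- phi) (weightN eta)).
rewrite (_ : 1 / 2 * (K * weight eta) + _ = K * weight eta); last by field.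
apply: wiener_ext => p Dp.
rewrite dF// /family_sum.
have B eta' phi' (ww : weight eta' = weight eta) j :
    `|atom_val (shift_atom eta' phi' (d j)) p| <= E p.1 * maj (shift_atom eta' phi' (d j)).
  by rewrite mulrC; apply: atom_val_le; exact: (sh _ _ ww).1.
have bs eta' phi' (ww : weight eta' = weight eta) := bounded_sum_scale (E0 p.1) (sh eta' phi' ww).2.
have wN := weightN eta.
have B1 := B eta phi erefl; have B2 := B (- eta) (- phi) wN.
have bs1 := bs eta phi erefl; have bs2 := bs (- eta) (- phi) wN.
have B0 j : `|atom_val (d j) p| <= E p.1 * maj (d j).
  by rewrite mulrC; exact: atom_val_le (dK.1 j).
rewrite -mulrDr -(sumND bs1 bs2 B1 B2).
have mm : bounded_sum (fun j => E p.1 * maj (shift_atom eta phi (d j)) +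
    E p.1 * maj (shift_atom (- eta) (- phi) (d j))) (E p.1 * (K * weight eta) + E p.1 * (K * weight eta)).
  split=> [j|m]; first by rewrite addr_ge0 ?bs1.1 ?bs2.1.
  by rewrite big_split/= lerD ?bs1.2 ?bs2.2.
rewrite -(sumNZ _ mm); last first.
  by move=> j; apply: le_trans (ler_normD _ _) _; rewrite lerD.
rewrite -(sumNZ _ (bounded_sum_scale (E0 p.1) dK.2) B0); congr sumN; apply/funext => j.
rewrite /atom_val/= !dotvDl dotvNl.
have := cos_mul (dotv (wavev (d j)) p.2 + phase (d j)) (dotv eta p.2 + phi).
rewrite (_ : dotv (wavev (d j)) p.2 + phase (d j) + (dotv eta p.2 + phi) =
  dotv (wavev (d j)) p.2 + dotv eta p.2 + (phase (d j) + phi)); last by ring.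
rewrite (_ : dotv (wavev (d j)) p.2 + phase (d j) - (dotv eta p.2 + phi) =
  dotv (wavev (d j)) p.2 - dotv eta p.2 + (phase (d j) - phi)); last by ring.
set c0 := cos (_ + phase _); set c1 := cos (_ + phi) => H.
by rewrite [RHS](_ : _ = amp (d j) p.1 * (c0 * c1)); [rewrite H; ring|ring].
Qed.

(** Each term of the first factor is a function of time times a cosine. *)
Lemma wiener_mul D E F G K K' : (forall t, 0 <= E t) ->
  wiener D (fun=> 1) F K -> wiener D E G K' ->
  wiener D E (fun p => F p * G p) (K * K').
Proof.
move=> E0 [d [dK dF]] GK'; have K'0 := wiener_ge0 GK'.
pose L j := maj (d j) * K'.
have LS : bounded_sum L (K * K').
  rewrite [K * _]mulrC; have := bounded_sum_scale K'0 dK.2.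
  by apply: bounded_sum_le => j; rewrite /L mulrC lexx mulr_ge0// dK.2.1.
apply: (@wiener_sum D E (fun j p => atom_val (d j) p * G p) _ L) => // [j|p Dp].
  have [ac aE] := dK.1 j.
  have w0 : 0 < weight (wavev (d j)) := lt_le_trans ltr01 (weight_ge1 _).
  have c0 : 0 <= maj (d j) / weight (wavev (d j)) by rewrite divr_ge0 ?dK.2.1// ltW.
  have H := wiener_mul_time (E' := E) ac c0 _ (wiener_mul_cos (wavev (d j)) (phase (d j)) E0 GK').
  have {}H := H _.
  apply: wiener_le (wiener_ext _ (H _)).
  - rewrite (_ : _ * (_ * _) = L j)// /L; field; exact: lt0r_neq0.
  - by move=> p _; rewrite /atom_val mulrA.
  - by move=> t; rewrite ler_wpM2r// ler_pdivlMr//; have := aE t; rewrite mulr1.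
rewrite dF// mulrC /family_sum.
have B j : `|atom_val (d j) p| <= maj (d j) by have := atom_val_le p (dK.1 j); rewrite mulr1.
by rewrite -(sumNZ _ dK.2 B); congr sumN; apply/funext => j; rewrite mulrC.
Qed.

Lemma wiener_norm_le D E F K p : (forall t, 0 <= E t) -> wiener D E F K -> D p ->
  `|F p| <= K * E p.1.
Proof.
move=> E0 [d [dK dF]] Dp; rewrite dF// mulrC.
apply: sumN_le (bounded_sum_scale (E0 p.1) dK.2) _ => j.
by rewrite mulrC; exact: atom_val_le (dK.1 j).
Qed.

End WaveClass.

(** * Fourier expansion in the space variables *)

Section CoordinateFourier.
Context {R : realType} {n : nat}.
Local Notation V := (R * 'rV[R]_n)%type.
Implicit Types (p q v : V) (i j : 'I_n) (s t M : R) (f g : V -> R) (kap : R -> R).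

Definition dir i : V := (0, delta_mx 0 i).

Lemma pair_add p q : p + q = (p.1 + q.1, p.2 + q.2). Proof. by []. Qed.
Lemma pair_scale s p : s *: p = (s * p.1, s *: p.2). Proof. by []. Qed.

Lemma dir_coord i j s p :
  (s *: dir i + p).2 0 j = (if j == i then s else 0) + p.2 0 j.
Proof.
rewrite pair_add pair_scale /= !mxE eqxx/=; congr (_ + _).
by case: eqP => _; rewrite ?mulr1 ?mulr0.
Qed.

Lemma dir_time i s p : (s *: dir i + p).1 = p.1.
Proof. by rewrite pair_add pair_scale /= mulr0 add0r. Qed.

Lemma coord_norm_le i (x : 'rV[R]_n) : `|x 0 i| <= `|x|.
Proof.
rewrite [leRHS]/Num.norm/= mx_normE -[leLHS]nngE num_le.
exact: (le_bigmax _ (fun k : 'I_1 * 'I_n => `|x k.1 k.2|%:nng) (0, i)).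
Qed.

(** The projection onto the hyperplane where the i-th coordinate vanishes. *)
Definition coord_proj i p : V := (- p.2 0 i) *: dir i + p.

Lemma coord_proj_affine i s p q : coord_proj i (s *: q + p) = s *: coord_proj i q + coord_proj i p.
Proof.
rewrite /coord_proj.
have -> : (s *: q + p).2 0 i = s * q.2 0 i + p.2 0 i.
  by rewrite pair_add pair_scale/= !mxE.
by rewrite opprD scalerDl scalerDr scalerA mulrN addrACA.
Qed.

Lemma dir_norm i : `|dir i| <= 1.
Proof.
rewrite prod_normE/= ge_max normr0 ler01/= [leLHS]/Num.norm/=.
have [->//|/mx_norm_neq0[[k l] ->/=]] := eqVneq (mx_norm (delta_mx 0 i : 'rV[R]_n)) 0.
by rewrite mxE; case: (_ && _); rewrite ?normr1 ?normr0.
Qed.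

Lemma coord_proj_lip i p q : `|coord_proj i p - coord_proj i q| <= 2 * `|p - q|.
Proof.
have -> : coord_proj i p - coord_proj i q = coord_proj i (p - q).
  by rewrite -[p - q]addrC -[- q]scaleN1r coord_proj_affine scaleN1r addrC.
rewrite /coord_proj; apply: le_trans (ler_normD _ _) _.
rewrite mulr_natl mulr2n lerD2r normrZ normrN.
apply: le_trans (_ : `|(p - q).2| * 1 <= _).
  by apply: ler_pM => //; [exact: coord_norm_le|exact: dir_norm].
by rewrite mulr1 [X in _ <= X]prod_normE le_max lexx orbT.
Qed.

Lemma coord_proj_coord i j p : (coord_proj i p).2 0 j = if j == i then 0 else p.2 0 j.
Proof.
by rewrite dir_coord; case: eqP => [->|_]; rewrite ?add0r// addNr.
Qed.

Lemma coord_proj_dir_neq i j : j != i -> coord_proj i (dir j) = dir j.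
Proof.
by move=> ji; rewrite /coord_proj /dir/= mxE eqxx/= eq_sym (negPf ji) oppr0 scale0r add0r.
Qed.

Lemma coord_proj_dir i : coord_proj i (dir i) = 0.
Proof. by rewrite /coord_proj {1}/dir/= mxE !eqxx/= scaleN1r addNr. Qed.

Lemma coord_proj_add_dir i s p : coord_proj i (s *: dir i + p) = coord_proj i p.
Proof. by rewrite coord_proj_affine coord_proj_dir scaler0 add0r. Qed.

Lemma coord_projK i p : p.2 0 i *: dir i + coord_proj i p = p.
Proof. by rewrite /coord_proj addrA -scalerDl subrr scale0r add0r. Qed.

Definition slab i kap f (P : V * R) : R := kap P.2 * f (P.2 *: dir i + coord_proj i P.1).

(** When [kap] is a trigonometric function, this is a Fourier coefficient of [f]
   in the i-th coordinate, as a function of the other ones. *)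
Definition avg i kap f p : R := int1 (fun s => slab i kap f (p, s)).

Lemma slab_classC k i kap f : classC k kap -> classC k f -> classC k (slab i kap f).
Proof.
move=> kk fk; apply: classC_mul.
  apply: (@classC_comp_affine _ (V * R)%type R _ snd snd kap) => //.
  by apply: (@lipschitz_continuous _ (V * R)%type R snd 1) => x y; rewrite mul1r [X in _ <= X]prod_normE le_max lexx orbT.
apply: (@classC_comp_affine _ (V * R)%type V _
  (fun P => P.2 *: dir i + coord_proj i P.1) (fun P => P.2 *: dir i + coord_proj i P.1)) => //.
  apply: (@lipschitz_continuous _ (V * R)%type V _ 3) => x y.
  have -> : x.2 *: dir i + coord_proj i x.1 - (y.2 *: dir i + coord_proj i y.1)
     = (x.2 - y.2) *: dir i + (coord_proj i x.1 - coord_proj i y.1).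
    by rewrite opprD addrACA scalerBl.
  apply: le_trans (ler_normD _ _) _; rewrite normrZ.
  have H1 : `|x.2 - y.2| * `|dir i| <= `|x - y|.
    apply: (@le_trans _ _ (`|x.2 - y.2| * 1)); first by rewrite ler_wpM2l ?dir_norm.
    by rewrite mulr1 [X in _ <= X]prod_normE le_max lexx orbT.
  have H2 : `|x.1 - y.1| <= `|x - y| by rewrite [X in _ <= X]prod_normE le_max lexx.
  by have := coord_proj_lip i x.1 y.1; lra.
move=> h q u /=; rewrite coord_proj_affine scalerDl -scalerA [in RHS]scalerDr.
by rewrite addrACA.
Qed.

Lemma slab_is_derive i kap f v P : (forall q, derivable f q (coord_proj i v)) ->
  is_derive P ((v, 0) : V * R) (slab i kap f) (slab i kap ('D_(coord_proj i v) f) P).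
Proof.
move=> fd; apply: is_derive_increment => e e0.
have e1 : 0 < e / (`|kap P.2| + 1) by rewrite divr_gt0// ltr_wpDl.
have [d d0 H] := increment_is_derive (derivableP (fd (P.2 *: dir i + coord_proj i P.1))) e1.
exists d => // h _ hd; rewrite /slab/= scaler0 add0r coord_proj_affine addrCA.
rewrite mulrCA -mulrBr -mulrBr normrM.
apply: le_trans (ler_wpM2l (normr_ge0 _) (H h hd)) _.
by rewrite mulrA ler_wpM2r// mul_div_add1_le// ltW.
Qed.

Lemma avg_classC k i kap f : classC k kap -> classC k f -> classC k (avg i kap f).
Proof.
move=> kk fk; have H := prim_param_classC (slab_classC i kk fk).
have C s : classC k (fun p => prim_param (slab i kap f) (p, s)).
  apply: (@classC_comp_affine _ V (V * R)%type _ (fun p => (p, s)) (fun p => (p, 0))) => //.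
    apply: (@lipschitz_continuous _ V (V * R)%type _ 1) => x y.
    by rewrite prod_norm_sub subrr normr0 mul1r ge_max lexx normr_ge0.
  by move=> h q u; congr pair; rewrite /= scaler0 add0r.
exact: (classC_sub (C (1 / 2)) (C (- (1 / 2)))).
Qed.

Lemma avg_is_derive i kap f v p k : continuous kap -> classC k.+1 f ->
  is_derive p v (avg i kap f) (avg i kap ('D_(coord_proj i v) f) p).
Proof.
move=> kc fk.
have fd q : derivable f q (coord_proj i v) by exact: classC_derivable fk.
have Gc := slab_classC (k := 0) i kc (classC_continuous fk).
have dG : 'D_((v, 0) : V * R) (slab i kap f) = slab i kap ('D_(coord_proj i v) f).
  by apply/funext => P; have [] := slab_is_derive kap P fd.
have Gd Q : derivable (slab i kap f) Q ((v, 0) : V * R).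
  by have [] := slab_is_derive kap Q fd.
have dGc : continuous ('D_((v, 0) : V * R) (slab i kap f)).
  rewrite dG; apply: (slab_classC (k := 0) i kc).
  by apply: classC_continuous; exact: (classC_derive (coord_proj i v) fk).
have H s : is_derive p v (fun q => prim_param (slab i kap f) (q, s))
     (prim_param (slab i kap ('D_(coord_proj i v) f)) (p, s)).
  rewrite -dG.
  apply: (@is_derive_comp_affine _ V (V * R)%type (fun q => (q, s)) (fun q => (q, 0))).
    by move=> h q u; congr pair; rewrite /= scaler0 add0r.
  exact: prim_param_is_derive_param.
exact: is_deriveDf (H _) (is_deriveNf (H _)).
Qed.

Lemma avg_le i kap f p M : continuous kap -> continuous f ->
  (forall s, `|kap s| <= 1) -> (forall q, `|f q| <= M) -> `|avg i kap f p| <= M.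
Proof.
move=> kc fc k1 fM; apply: int1_le => [|s _].
  exact/slice_continuous/(slab_classC (k := 0) i kc fc).
rewrite /slab normrM; apply: (le_trans _ (fM (s *: dir i + coord_proj i p))).
by rewrite ler_piMl.
Qed.

(** The time derivative is left out, as functions are expanded in the space
   variables only. *)
Fixpoint bounded_derivatives k M f : Prop :=
  (forall p, `|f p| <= M) /\
  if k is k'.+1 then forall j, bounded_derivatives k' M ('D_(dir j) f) else True.

Lemma bounded_derivatives_bound k M f p : bounded_derivatives k M f -> `|f p| <= M.
Proof. by case: k => [|k] []. Qed.

Lemma bounded_derivatives_ge0 k M f : bounded_derivatives k M f -> 0 <= M.
Proof. by move=> H; apply: le_trans (bounded_derivatives_bound 0 H). Qed.

Lemma bounded_derivatives_le k m M M' f : (k <= m)%N -> M <= M' ->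
  bounded_derivatives m M f -> bounded_derivatives k M' f.
Proof.
elim: k m f => [|k IH] m f km MM' H.
  by split=> // p; apply: le_trans MM'; exact: bounded_derivatives_bound H.
case: m km H => // m km [H1 H2]; split=> [p|j]; first exact: le_trans (H1 p) MM'.
exact: (IH m _ km MM' (H2 j)).
Qed.

Lemma bounded_derivatives_derive k M f j :
  bounded_derivatives k.+1 M f -> bounded_derivatives k M ('D_(dir j) f).
Proof. by move=> [_ H]; exact: H. Qed.

Lemma bounded_derivatives_add k M M' f g : classC k f -> classC k g ->
  bounded_derivatives k M f -> bounded_derivatives k M' g ->
  bounded_derivatives k (M + M') (fun p => f p + g p).
Proof.
elim: k f g => [|k IH] f g fk gk bf bg.
  by split=> // p; apply: le_trans (ler_normD _ _) _; rewrite lerD ?bf.1 ?bg.1.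
split=> [p|j]; first by apply: le_trans (ler_normD _ _) _; rewrite lerD ?bf.1 ?bg.1.
have -> : 'D_(dir j) (fun p => f p + g p) = fun p => 'D_(dir j) f p + 'D_(dir j) g p.
  apply/funext => p.
  by have [] := is_deriveDf (classC_is_derive p (dir j) fk) (classC_is_derive p (dir j) gk).
by apply: IH; [exact: classC_derive|exact: classC_derive|exact: bf.2|exact: bg.2].
Qed.

Lemma bounded_derivatives0 k M : 0 <= M -> bounded_derivatives k M (fun=> 0).
Proof.
move=> M0; elim: k => [|k IH]; first by split=> // p; rewrite normr0.
split=> [p|j]; first by rewrite normr0.
by rewrite (_ : 'D_(dir j) _ = fun=> 0)//; apply/funext => p; exact: derive_cst.
Qed.

Lemma avg_bounded_derivatives k M i kap f : classC k kap -> classC k f ->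
  (forall s, `|kap s| <= 1) -> bounded_derivatives k M f ->
  bounded_derivatives k M (avg i kap f).
Proof.
elim: k f => [|k IH] f kk fk k1 bf.
  by split=> // p; apply: avg_le => // q; exact: bf.1.
split=> [p|j].
  apply: avg_le => // [||q]; [exact: classC_continuous kk|exact: classC_continuous fk|exact: bf.1].
have -> : 'D_(dir j) (avg i kap f) = avg i kap ('D_(coord_proj i (dir j)) f).
  apply/funext => p.
  by have [] := avg_is_derive i (dir j) p (classC_continuous kk) fk.
have [->|ji] := eqVneq j i; last first.
  rewrite coord_proj_dir_neq//; apply: IH => //; [exact: classC_le kk|exact: classC_derive|exact: bf.2].
rewrite coord_proj_dir (_ : avg _ _ _ = fun=> 0).
  exact/bounded_derivatives0/(bounded_derivatives_ge0 bf).
apply/funext => p; rewrite -[RHS](int1_cst 0); congr int1; apply/funext => s.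
by rewrite /slab derive0 mulr0.
Qed.

Definition invariant_along i f := forall p s, f (s *: dir i + p) = f p.
Definition vanishing_off i f := forall p, 1 / 2 <= `|p.2 0 i| -> f p = 0.

Lemma invariant_derive i f v : invariant_along i f -> invariant_along i ('D_v f).
Proof.
move=> fi p s; rewrite /derive.
rewrite (_ : (fun h => _ *: _) = (fun h => h^-1 *: ((f \o shift p) (h *: v) - f p)))//.
by apply/funext => h /=; rewrite addrCA !fi.
Qed.

(** A derivative that exists is determined by one side of the point. *)
Lemma derive_half_line f p v (c : R) : derivable f p v -> c != 0 ->
  (forall h, 0 <= h * c -> f (h *: v + p) = 0) -> 'D_v f p = 0.
Proof.
move=> fd c0 f0; apply/eqP; rewrite -normr_le0; apply/ler_addgt0Pl => e e0.
have [d d0 H] := increment_is_derive (derivableP fd) e0.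
pose h := d / 2 * Num.sg c.
have hc : 0 <= h * c by rewrite -mulrA -normrEsg mulr_ge0// ltW// divr_gt0.
have hN : `|h| = d / 2 by rewrite normrM normr_sg c0 mulr1 ger0_norm// ltW// divr_gt0.
have := H h; rewrite hN f0// (_ : f p = 0); last first.
  by rewrite -[p]add0r -(scale0r v) f0// mul0r.
rewrite subrr sub0r normrN normrM hN => /(_ _).
rewrite [e * _]mulrC ler_pM2l ?divr_gt0// addr0; apply.
by rewrite ltr_pdivrMr// ltr_pMr// ltr1n.
Qed.

Lemma vanishing_derive i j f : (forall p, derivable f p (dir j)) ->
  vanishing_off i f -> vanishing_off i ('D_(dir j) f).
Proof.
move=> fd f0 p pi; have [pi0|pi0] := leP 0 (p.2 0 i).
  apply: (derive_half_line (fd p) (oner_neq0 R)).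
  move=> h; rewrite mulr1 => h0; apply: f0; rewrite dir_coord.
  move: pi; rewrite ger0_norm// => pi; case: ifP => _; last by rewrite add0r ger0_norm.
  by rewrite ger0_norm ?addr_ge0//; lra.
have n1 : -1 != 0 :> R by rewrite oppr_eq0 oner_neq0.
apply: (derive_half_line (fd p) n1).
move=> h; rewrite mulrN1 oppr_ge0 => h0; apply: f0; rewrite dir_coord.
move: pi; rewrite ltr0_norm// => pi; case: ifP => _; last by rewrite add0r ltr0_norm.
by rewrite ler0_norm; lra.
Qed.

Lemma avg_invariant i kap f : invariant_along i (avg i kap f).
Proof.
move=> p s; congr int1; apply/funext => r.
by rewrite /slab/= coord_proj_add_dir.
Qed.

Lemma avg_invariant_other i j kap f : invariant_along j f ->
  invariant_along j (avg i kap f).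
Proof.
have [->|ij] := eqVneq i j; first by move=> _; exact: avg_invariant.
move=> fj p s; congr int1; apply/funext => r.
by rewrite /slab/= coord_proj_affine coord_proj_dir_neq 1?eq_sym// addrCA fj.
Qed.

Lemma avg_vanishing i j kap f : i != j -> vanishing_off j f ->
  vanishing_off j (avg i kap f).
Proof.
move=> ij f0 p pj; rewrite -[RHS](int1_cst 0); congr int1; apply/funext => s.
rewrite /slab/= f0 ?mulr0// dir_coord coord_proj_coord eq_sym (negPf ij) add0r.
exact: pj.
Qed.

Definition unit_tube : set V := [set p : V | forall i, `|p.2 0 i| < 1 / 2].

Definition iterD i k f := iter k (fun g => 'D_(dir i) g) f.

Lemma iterD_classC i k m f : classC (k + m) f -> classC m (iterD i k f).
Proof.
elim: k m => [//|k IH] m; rewrite addSnnS => /IH; exact: classC_derive.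
Qed.

Lemma iterD_bounded i k m M f : bounded_derivatives (k + m) M f ->
  bounded_derivatives m M (iterD i k f).
Proof.
elim: k m => [//|k IH] m; rewrite addSnnS => /IH; exact: bounded_derivatives_derive.
Qed.

Lemma iterD_vanishing i j k f : classC k f -> vanishing_off j f ->
  vanishing_off j (iterD i k f).
Proof.
elim: k => [//|k IH] fk f0; apply: vanishing_derive.
  move=> p; have : classC 1 (iterD i k f) by apply: iterD_classC; rewrite addn1.
  by move=> H; exact: classC_derivable H.
by apply: IH => //; exact: classC_le fk.
Qed.

Lemma iterD_invariant i j k f : invariant_along j f -> invariant_along j (iterD i k f).
Proof. by elim: k => [//|k IH] /IH; exact: invariant_derive. Qed.

Definition plus_D4 i f p := f p + iterD i 4 f p.

(** One-dimensional Fourier inversion in the i-th coordinate. *)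
Lemma coordinate_inversion i f p : classC 4 f -> vanishing_off i f -> unit_tube p ->
  f p = sumN (fun k => fcoef k *
    (cos (freq k * p.2 0 i + 0) * avg i (fun s => cos (freq k * s + 0)) (plus_D4 i f) p
   + cos (freq k * p.2 0 i + - (pi / 2)) *
     avg i (fun s => cos (freq k * s + - (pi / 2))) (plus_D4 i f) p)).
Proof.
move=> fk f0 /(_ i) pb.
pose phi k s := iterD i k f (s *: dir i + coord_proj i p).
have dk k : (k <= 4)%N -> classC (4 - k) (iterD i k f).
  by move=> k4; apply: iterD_classC; rewrite subnKC.
have phid k s : (k < 4)%N -> is_derive s (1 : R) (phi k) (phi k.+1 s).
  move=> k4; have k1 : classC 1 (iterD i k f).
    by apply: classC_le (dk k (ltnW k4)); rewrite subn_gt0.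
  have H := classC_is_derive (s *: dir i + coord_proj i p) (dir i) k1.
  exact: (iffLR (is_derive_line _ (coord_proj i p) (dir i) s _) H).
have line_cont g : continuous g -> continuous (fun s : R => g (s *: dir i + coord_proj i p)).
  move=> gc; apply: (@classC_comp_affine _ R V 0 (fun s : R => s *: dir i + coord_proj i p)
     (fun s : R => s *: dir i)) => //.
    apply: (@lipschitz_continuous _ R V _ 1) => x y.
    rewrite opprD addrACA subrr addr0 -scalerBl normrZ mulrC.
    by rewrite ler_wpM2r// dir_norm.
  move=> h q u; rewrite scalerDl -addrA; congr (_ + _).
  exact: (esym (scalerA _ _ _)).
have phi4 : continuous (phi 4%N).
  exact: (line_cont _ (classC_continuous (dk 4%N (leqnn 4)))).
have flat k : (k < 4)%N -> phi k (1 / 2) = 0 /\ phi k (- (1 / 2)) = 0.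
  move=> k4; have v : vanishing_off i (iterD i k f).
    by apply: iterD_vanishing => //; exact: classC_le (ltnW k4) fk.
  split; apply: v; rewrite dir_coord coord_proj_coord eqxx addr0 ?normrN ger0_norm//.
have := fourier_inversion phid phi4 flat pb.
rewrite {1}/phi/= coord_projK => ->; congr sumN; apply/funext => k; congr (_ * _).
have gc : continuous (fun s => phi 0%N s + phi 4%N s).
  apply: (classC_add (k := 0)) phi4.
  by apply: line_cont; exact: classC_continuous fk.
have C th := classC_mul (k := 0) (@continuous_coslin R (freq k) th) gc.
rewrite /avg -(int1Z _ (C _)) -(int1Z _ (C _)).
rewrite -(int1D (classC_scale (k := 0) _ (C _)) (classC_scale (k := 0) _ (C _))).
congr int1; apply/funext => s; rewrite /phi/=.
rewrite !addr0 !cosBpihalf mulrBr cosB; ring.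
Qed.

Lemma wiener_single D E A : atom_ok E A -> 0 <= maj A -> wiener D E (@atom_val R n A) (maj A).
Proof.
move=> AE A0; exists (fun k : nat => if k == 0%N then A else atom0); split.
  split=> [j|].
    case: ifP => // _; split=> [t|t /=]; first exact: cvg_cst.
    by rewrite normr0 !mul0r.
  split=> [j|m]; first by case: ifP.
  case: m => [|m]; first by rewrite big_geq.
  by rewrite big_nat_recl//= big1 ?addr0.
move=> p _; rewrite /family_sum -(sumN_delta 0 (atom_val A p)); congr sumN.
by apply/funext => j; case: ifP => // _; rewrite /atom_val/= mul0r.
Qed.

Lemma invariant_all f : (forall i, invariant_along i f) -> forall p, f p = f (p.1, 0).
Proof.
move=> fi [t x] /=; rewrite [x in LHS]row_sum_delta.
suff H (r : seq 'I_n) : f (t, \sum_(i <- r) x 0 i *: delta_mx 0 i) = f (t, 0) by exact: H.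
elim: r => [|i r IH]; first by rewrite big_nil.
rewrite big_cons -{}IH -[RHS](fi i _ (x 0 i)); congr f.
by rewrite pair_add pair_scale/= mulr0 add0r.
Qed.

(** Induction on the number of coordinates on which [f] depends: the Fourier
   coefficients of [f] in a coordinate are constant in that coordinate. *)
Lemma fourier_induction r : (r <= n)%N -> exists2 C : R, 0 <= C & forall f M,
  classC (4 * r) f -> bounded_derivatives (4 * r) M f ->
  (forall i, (r <= i)%N -> invariant_along i f) ->
  (forall i, (i < r)%N -> vanishing_off i f) ->
  wiener unit_tube (fun=> 1) f (C * M).
Proof.
elim: r => [_|r IH rn].
  exists 1 => // f M fk fM fi _; rewrite mul1r.
  have M0 := bounded_derivatives_ge0 fM.
  pose A : atom := @Atom R n (fun t => f (t, 0)) 0 0 M.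
  apply: (@wiener_ext _ _ _ _ (atom_val A)); last first.
    apply: wiener_single => //; split=> [|t /=].
      apply: (@classC_comp_affine _ R V 0 (fun t : R => (t, 0)) (fun t : R => (t, 0)) f) => //.
      - apply: (@lipschitz_continuous _ R V _ 1) => x y.
        by rewrite prod_norm_sub subrr normr0 mul1r ge_max lexx normr_ge0.
      - by move=> h q u; rewrite pair_add pair_scale/= scaler0 addr0.
    rewrite mulr1 /weight /l1 big1 ?addr0 ?expr1n ?mulr1; last by move=> i _; rewrite mxE normr0.
    exact: bounded_derivatives_bound fM.
  move=> p _; rewrite /atom_val/= dotv0l add0r cos0 mulr1.
  by rewrite -invariant_all// => i; exact: fi.
have [C C0 {}IH] := IH (ltnW rn); exists (8 * C) => [|f M fk fM fi f0]; first exact: mulr_ge0.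
have M0 := bounded_derivatives_ge0 fM.
pose i := Ordinal rn; rewrite mulnS in fk fM.
have f4 : classC 4 f by apply: classC_le fk; exact: leq_addr.
have fr : classC (4 * r) f by apply: classC_le fk; exact: leq_addl.
have hk : classC (4 * r) (plus_D4 i f).
  by apply: classC_add => //; exact: iterD_classC.
have hM : bounded_derivatives (4 * r) (M + M) (plus_D4 i f).
  apply: bounded_derivatives_add => //.
  - exact: iterD_classC.
  - by apply: bounded_derivatives_le fM => //; exact: leq_addl.
  - exact: iterD_bounded.
have avgW k th : wiener unit_tube (fun=> 1) (avg i (fun s => cos (freq k * s + th)) (plus_D4 i f)) (C * (M + M)).
  have kk m : classC m (fun s => cos (freq k * s + th)).
    apply: (@classC_comp_affine _ R R _ (fun s : R => freq k * s) (fun s : R => freq k * s) (fun s => cos (s + th))).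
    - by move=> s; apply: cvgMr; exact: cvg_id.
    - by move=> h q u; rewrite /GRing.scale/=; ring.
    - exact: classC_cosD.
  apply: IH.
  - exact: avg_classC.
  - by apply: avg_bounded_derivatives => // s; exact: cos_max.
  - move=> j; rewrite leq_eqVlt => /orP[/eqP rj|rj].
      have -> : j = i by apply: val_inj; rewrite /= rj.
      exact: avg_invariant.
    apply: avg_invariant_other => p s; rewrite /plus_D4 (fi j rj).
    by rewrite iterD_invariant//; exact: fi.
  - move=> j jr; apply: avg_vanishing.
      by apply/eqP => ij; move: jr; rewrite -ij /= ltnn.
    have jr1 : (j < r.+1)%N by exact: ltnW.
    move=> p pj; rewrite /plus_D4 (f0 j jr1)// add0r.
    by apply: (@iterD_vanishing i j 4 f f4 (f0 j jr1)).
pose coef k : R := 4 * C * M * (fcoef k * (1 + freq k) ^+ 2).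
have cS : bounded_sum coef (8 * C * M).
  have := bounded_sum_scale _ (fcoef_sum (R := R)) => /(_ (4 * C * M)).
  rewrite (_ : 4 * C * M * 2 = 8 * C * M); last by ring.
  by apply; rewrite !mulr_ge0.
have E1 : forall t : R, 0 <= (1 : R) by [].
apply: (wiener_sum (E := fun=> 1) (K := coef) E1 _ cS (fun p => coordinate_inversion f4 (f0 i (ltnSn r)))).
move=> k.
have wk : weight (freq k *: delta_mx 0 i : 'rV[R]_n) = (1 + freq k) ^+ 2.
  rewrite /weight; congr ((1 + _) ^+ 2); rewrite /l1 (bigD1 i)//= big1 ?addr0.
    by rewrite !mxE !eqxx/= mulr1 ger0_norm ?freq_ge0.
  by move=> j /negPf ji; rewrite !mxE eqxx/= ji mulr0 normr0.
have dk p : dotv (freq k *: delta_mx 0 i) p.2 = freq k * p.2 0 i.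
  rewrite dotvZl; congr (_ * _); rewrite /dotv (bigD1 i)//= big1 ?addr0.
    by rewrite !mxE !eqxx/= mul1r.
  by move=> j /negPf ji; rewrite !mxE eqxx/= ji mul0r.
have H th : wiener unit_tube (fun=> 1) (fun p => cos (freq k * p.2 0 i + th) *
     avg i (fun s => cos (freq k * s + th)) (plus_D4 i f) p)
     (C * (M + M) * (1 + freq k) ^+ 2).
  rewrite -wk; have := wiener_mul_cos (freq k *: delta_mx 0 i) th E1 (avgW k th).
  by apply: wiener_ext => p _; rewrite dk.
have := wiener_scale (fcoef k) E1 (wiener_add E1 (H 0) (H (- (pi / 2)))).
rewrite ger0_norm ?fcoef_ge0//; apply: wiener_le.
by rewrite /coef le_eqVlt; apply/orP; left; apply/eqP; ring.
Qed.

End CoordinateFourier.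

(** * Smooth functions in the Wiener algebra *)

Section Cutoff.
Context {R : realType}.
Implicit Types (x y : R) (m : nat).

(** A finite order of smoothness suffices for cutoffs: the expansion of a function
   takes four derivatives in each coordinate. *)
Definition ramp m x : R := Num.max x 0 ^+ m.+1.

Lemma ramp_le0 m x : x <= 0 -> ramp m x = 0.
Proof. by move=> x0; rewrite /ramp max_r// expr0n. Qed.

Lemma ramp_ge0 m x : 0 <= x -> ramp m x = x ^+ m.+1.
Proof. by move=> x0; rewrite /ramp max_l. Qed.

Lemma ramp_is_derive m x :
  is_derive x (1 : R) (ramp m.+1) (m.+2%:R * ramp m x).
Proof.
have [x0|x0|->] := ltgtP x 0.
- rewrite (ramp_le0 _ (ltW x0)) mulr0.
  apply: (near_eq_is_derive _ (is_derive_cst (0 : R) x 1)).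
  apply/nbhs_ballP; exists (- x); first by rewrite /= oppr_gt0.
  move=> y; rewrite -ball_normE /= ltr_norml => /andP[H1 H2].
  by rewrite ramp_le0//; lra.
- rewrite (ramp_ge0 _ (ltW x0)).
  have D : is_derive x (1 : R) (fun y : R => y ^+ m.+2) (m.+2%:R * x ^+ m.+1).
    split; first exact: exprn_derivable.
    by rewrite exp_derive [_%:A]mulr1.
  apply: (near_eq_is_derive _ D).
  apply/nbhs_ballP; exists x => //.
  move=> y; rewrite -ball_normE /= ltr_norml => /andP[H1 H2].
  by rewrite ramp_ge0//; lra.
- rewrite ramp_le0// mulr0; apply: is_derive_increment => e e0.
  exists (Num.min e 1) => [|h _]; first by rewrite lt_min e0 ltr01.
  rewrite lt_min => /andP[he h1].
  rewrite addr0 [h%:A]mulr1 (ramp_le0 _ (lexx 0)) mulr0 !subr0.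
  have [h0|/ltW h0] := leP h 0; first by rewrite ramp_le0// normr0 mulr_ge0// ltW.
  rewrite ramp_ge0// normrX exprSr ler_wpM2r//.
  apply: le_trans (ltW he); rewrite exprS ler_piMr//.
  by rewrite exprn_ile1// ltW.
Qed.

Lemma ramp_classC m : classC m (ramp m).
Proof.
elim: m => [|m IH].
  apply: (@lipschitz_continuous _ R R (ramp 0) 1) => x y; rewrite /ramp !expr1 mul1r.
  by case: (leP x 0) => x0; case: (leP y 0) => y0; rewrite ler_norml; apply/andP; split;
    have := ler_norm (x - y); have := ler_norm (- (x - y)); rewrite normrN; lra.
apply: (classC1S (dphi := fun x => m.+2%:R * ramp m x)).
  by move=> x; exact: ramp_is_derive.
exact: classC_scale.
Qed.

Definition step m y := ramp m (1 - ramp m y).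

Lemma step_classC m : classC m (step m).
Proof.
apply: (@classC_comp1 _ _ m (ramp m) (fun y => 1 - ramp m y)); first exact: ramp_classC.
by apply: classC_sub; [exact: classC_cst|exact: ramp_classC].
Qed.

Lemma step_le0 m y : y <= 0 -> step m y = 1.
Proof. by move=> y0; rewrite /step (ramp_le0 _ y0) subr0 ramp_ge0// expr1n. Qed.

Lemma step_ge1 m y : 1 <= y -> step m y = 0.
Proof.
move=> y1; rewrite /step ramp_le0// subr_le0 ramp_ge0 ?exprn_ege1//.
exact: le_trans y1.
Qed.

Definition cutoff m x := step m (3 * x - 1 / 2) * step m (- 3 * x - 1 / 2).

Lemma cutoff_classC m : classC m (cutoff m).
Proof.
have A (c : R) : classC m (fun x => step m (c * x - 1 / 2)).
  apply: (@classC_comp_affine _ R R m (fun x : R => c * x - 1 / 2) (fun x : R => c * x)).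
  - move=> x; apply: cvgB; last exact: cvg_cst.
    by apply: cvgMr; exact: cvg_id.
  - by move=> h q u; rewrite /GRing.scale/=; ring.
  - exact: step_classC.
exact: classC_mul.
Qed.

Lemma cutoff1 m x : `|x| <= 1 / 6 -> cutoff m x = 1.
Proof.
by rewrite ler_norml => /andP[H1 H2]; rewrite /cutoff !step_le0 ?mulr1//; lra.
Qed.

Lemma cutoff0 m x : 1 / 2 <= `|x| -> cutoff m x = 0.
Proof.
rewrite /cutoff; case: (leP 0 x) => x0.
  by rewrite ger0_norm// => H; rewrite step_ge1 ?mul0r//; lra.
by rewrite ltr0_norm// => H; rewrite [X in _ * X]step_ge1 ?mulr0//; lra.
Qed.

End Cutoff.

Section SmoothWiener.
Context {R : realType} {n : nat}.
Local Notation V := (R * 'rV[R]_n)%type.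
Implicit Types (p q v : V) (i j : 'I_n) (s t M B : R) (f g : V -> R).

Definition vanishing_time f := forall p, 1 / 2 <= `|p.1| -> f p = 0.

Lemma vanishing_time_derive j f : (forall p, derivable f p (dir j)) ->
  vanishing_time f -> vanishing_time ('D_(dir j) f).
Proof.
move=> fd f0 p pt; apply: (derive_half_line (fd p) (oner_neq0 R)) => h _.
by apply: f0; rewrite dir_time.
Qed.

Lemma compact_cube B : compact [set p : V | `|p.1| <= B /\ forall i, `|p.2 0 i| <= B].
Proof.
have H1 : compact `[- B, B] by exact: segment_compact.
have H2 : compact [set x : 'rV[R]_n | forall i, x ord0 i \in `[- B, B]].
  by apply: (@rV_compact _ _ (fun=> `[- B, B]%classic)) => _; exact: segment_compact.
have := compact_setX H1 H2; congr compact; apply/seteqP; split=> -[t x]/=.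
  rewrite in_itv/= -ler_norml => -[? H]; split=> // i.
  by have := H i; rewrite in_itv/= -ler_norml.
move=> [? H]; rewrite in_itv/= -ler_norml; split=> // i.
by rewrite in_itv/= -ler_norml; exact: H.
Qed.

Lemma continuous_bounded_on_cube g B : 0 <= B -> continuous g ->
  exists2 M, 0 <= M & forall p, `|p.1| <= B -> (forall i, `|p.2 0 i| <= B) ->
    `|g p| <= M.
Proof.
move=> B0 gc.
have c : {within [set p : V | `|p.1| <= B /\ forall i, `|p.2 0 i| <= B],
    continuous (fun p => `|g p|)}.
  by apply: continuous_subspaceT => p; apply: cvg_norm; exact: gc.
have [|c0 _ H] := compact_EVT_max _ (@compact_cube B) c.
  by exists 0; split=> [|i]; rewrite ?mxE normr0.
by exists `|g c0| => // p p1 p2; apply: H; rewrite inE.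
Qed.

Lemma continuous_bounded g : continuous g -> vanishing_time g ->
  (forall i, vanishing_off i g) -> exists2 M, 0 <= M & forall p, `|g p| <= M.
Proof.
move=> gc gt gx.
have [|M M0 H] := @continuous_bounded_on_cube g (1 / 2) _ gc; first by rewrite divr_ge0.
exists M => // p.
have [pt|/ltW pt] := leP `|p.1| (1 / 2); last by rewrite gt// normr0.
have [px|] := pselect (forall i, `|p.2 0 i| <= 1 / 2); first exact: H.
move=> /existsNP[i /negP]; rewrite -ltNge => /ltW pi.
by rewrite (gx i)// normr0.
Qed.

Lemma exists_bounded_derivatives k f : classC k f -> vanishing_time f ->
  (forall i, vanishing_off i f) -> exists M, bounded_derivatives k M f.
Proof.
elim: k f => [|k IH] f fk ft fx.
  by have [M _ HM] := continuous_bounded fk ft fx; exists M; split.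
have [M0 M00 HM0] := continuous_bounded (classC_continuous fk) ft fx.
have fd j p : derivable f p (dir j) by exact: classC_derivable fk.
have /choice[M HM] : forall j, exists M, bounded_derivatives k M ('D_(dir j) f).
  move=> j; apply: IH; first exact: classC_derive.
    exact: vanishing_time_derive.
  by move=> i; exact: vanishing_derive.
have HM' j := bounded_derivatives_ge0 (HM j).
exists (M0 + \sum_j M j); split=> [p|j].
  by apply: le_trans (HM0 p) _; rewrite lerDl sumr_ge0.
apply: bounded_derivatives_le (HM j) => //.
by rewrite (bigD1 j)//= addrCA lerDl addr_ge0// sumr_ge0.
Qed.

Lemma fst_lip p q : `|p.1 - q.1| <= 1 * `|p - q|.
Proof. by rewrite mul1r [leRHS]prod_normE le_max lexx. Qed.

Lemma coord_lip i p q : `|p.2 0 i - q.2 0 i| <= 1 * `|p - q|.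
Proof.
rewrite mul1r [leRHS]prod_normE le_max; apply/orP; right.
by have := coord_norm_le i (p - q).2; rewrite !mxE.
Qed.

Lemma classC_time k (phi : R -> R) : classC k phi -> classC k (fun p => phi p.1).
Proof.
move=> phik; apply: (@classC_comp_affine _ V R k fst fst phi) => //.
exact: (@lipschitz_continuous _ V R fst 1 fst_lip).
Qed.

Lemma classC_coord k i (phi : R -> R) : classC k phi -> classC k (fun p => phi (p.2 0 i)).
Proof.
move=> phik.
apply: (@classC_comp_affine _ V R k (fun p => p.2 0 i) (fun p => p.2 0 i) phi) => //.
  exact: (@lipschitz_continuous _ V R _ 1 (coord_lip i)).
by move=> h q u; rewrite pair_add pair_scale/= !mxE.
Qed.

(** A dilation by [P >= 1] lowers the frequencies, hence the weights. *)
Lemma wiener_dilate (D : set V) f K P : 1 <= P -> wiener D (fun=> 1) f K ->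
  wiener [set p | D (P^-1 *: p)] (fun=> 1) (fun p => f (P^-1 *: p)) K.
Proof.
move=> P1 [d [dK dF]]; have P0 : 0 < P := lt_le_trans ltr01 P1.
have Pi1 : `|P^-1| <= 1 by rewrite ger0_norm ?invf_le1// invr_ge0 ltW.
exists (fun j : nat => @Atom R n (fun t => amp (d j) (P^-1 * t)) (P^-1 *: wavev (d j)) (phase (d j)) (maj (d j))).
split.
  split; last exact: dK.2.
  move=> j; have [ac aE] := dK.1 j; split=> [|t /=].
    apply: (@classC_comp_affine _ R R 0 (fun t : R => P^-1 * t) (fun t : R => P^-1 * t)) ac.
    - by move=> x; apply: cvgMr; exact: cvg_id.
    - by move=> h q u; rewrite /GRing.scale/=; ring.
  apply: le_trans (aE (P^-1 * t)); rewrite ler_wpM2l// /weight lerXn2r ?nnegrE ?addr_ge0 ?l1_ge0//.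
  rewrite lerD2l; apply: ler_sum => i _; rewrite mxE normrM.
  by rewrite ler_piMl.
move=> p /= Dp; rewrite dF// /family_sum; congr sumN; apply/funext => j.
by rewrite /atom_val/= dotvZl dotvZr.
Qed.

Definition cube B : set V := [set p : V | `|p.1| <= B /\ forall i, `|p.2 0 i| <= B].

(** Smooth functions belong to the class on every bounded region: cut off, then
   expand in a Fourier series in the space variables. *)
Lemma smooth_wiener f B : smooth f -> 0 <= B ->
  exists K, wiener (cube B) (fun=> 1) f K.
Proof.
move=> fs B0; pose P := 6 * B + 1.
have P1 : 1 <= P by rewrite lerDr mulr_ge0.
have P0 : 0 < P := lt_le_trans ltr01 P1.
pose chi (p : V) := cutoff (4 * n) p.1 * \prod_(i < n) cutoff (4 * n) (p.2 0 i).
pose F p := chi p * f (P *: p).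
have Fk : classC (4 * n) F.
  apply: classC_mul; last first.
    apply: (@classC_comp_affine _ V V _ (fun p => P *: p) (fun p => P *: p)) => //.
      apply: (@lipschitz_continuous _ V V _ `|P|) => x y.
      by rewrite -scalerBr normrZ.
    by move=> h q u; rewrite scalerDr !scalerA mulrC.
  apply: classC_mul; first by apply: classC_time; exact: cutoff_classC.
  by apply: classC_prod => i; apply: classC_coord; exact: cutoff_classC.
have Ft : vanishing_time F.
  by move=> p pt; rewrite /F /chi (cutoff0 _ pt) !mul0r.
have Fx i : vanishing_off i F.
  move=> p px; rewrite /F /chi (bigD1 i isT) (cutoff0 _ px)/= mul0r mulr0.
  exact: mul0r.
have [M HM] := exists_bounded_derivatives Fk Ft Fx.
have [C C0 HC] := @fourier_induction R n n (leqnn n).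
have := HC F M Fk HM _ (fun i _ => Fx i) => HF.
have {}HF : wiener unit_tube (fun=> 1) F (C * M).
  by apply: HF => i; rewrite leqNgt ltn_ord.
exists (C * M); have [d [dK dF]] := wiener_dilate P1 HF.
have small t : `|t| <= B -> `|P^-1 * t| <= 1 / 6.
  move=> tB; rewrite normrM ger0_norm ?invr_ge0 ?(ltW P0)// mulrC ler_pdivrMr//.
  by apply: le_trans tB _; rewrite /P; lra.
exists d; split=> // p [pt px]; rewrite -dF/=; last first.
  move=> i; rewrite mxE; apply: le_lt_trans (small _ (px i)) _; lra.
rewrite /F /chi /= cutoff1; last exact: small.
rewrite big1 => [|i _]; last by rewrite mxE cutoff1//; exact: small.
by rewrite !mul1r scalerA divff ?gt_eqF// scale1r.
Qed.

End SmoothWiener.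

(** * Duhamel's formula *)

Section Duhamel.
Context {R : realType}.
Variables (T mu : R).
Hypothesis mu1 : 1 <= mu.
Implicit Types (g : R -> R) (s t lam m : R).

Let mu0 : 0 < mu. Proof. exact: lt_le_trans ltr01 mu1. Qed.

(** An even exponential weight in [t - T]: integrating it from [T] gains the
   factor [1 / mu]. *)
Definition growth t : R := expR (mu * (t - T)) + expR (mu * (T - t)).

Definition growth_prim t : R := (expR (mu * (t - T)) - expR (mu * (T - t))) / mu.

Lemma growth_ge1 t : 1 <= growth t.
Proof.
rewrite /growth; have [tT|/ltW tT] := leP T t.
  rewrite ler_wpDr ?expR_ge0// -expR0 ler_expR mulr_ge0 ?subr_ge0//.
  exact: ltW.
by rewrite ler_wpDl ?expR_ge0// -expR0 ler_expR mulr_ge0 ?subr_ge0// ltW.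
Qed.

Lemma growth_ge0 t : 0 <= growth t.
Proof. exact: le_trans ler01 (growth_ge1 t). Qed.

Lemma is_derive_exp_affine (c d t : R) :
  is_derive t (1 : R) (fun s => expR (c * s + d)) (c * expR (c * t + d)).
Proof.
have H : is_derive t (1 : R) (fun y => c * y + d) c.
  by rewrite -[c in X in is_derive _ _ _ X]addr0; exact: is_deriveDf (is_derive_scaleid c t) (is_derive_cst d t 1).
have := @is_derive_comp1 _ _ expR (fun y => c * y + d) _ _ _ _ (is_derive_expR (c * t + d)) H.
by rewrite mulrC.
Qed.

Lemma growth_prim_is_derive t : is_derive t (1 : R) growth_prim (growth t).
Proof.
have H1 := is_derive_exp_affine mu (- (mu * T)) t.
have H2 := is_derive_exp_affine (- mu) (mu * T) t.
have := is_deriveZf mu^-1 (is_deriveDf H1 (is_deriveNf H2)).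
rewrite (_ : (fun q => _) = growth_prim); last first.
  by apply/funext => s; rewrite /growth_prim mulrC; congr ((expR _ - expR _) / _); ring.
rewrite (_ : mu^-1 * _ = growth t)//.
rewrite mulNr opprK -mulrDr mulrA mulVf ?gt_eqF// mul1r.
by congr (expR _ + expR _); ring.
Qed.

Lemma growth_continuous : continuous growth.
Proof.
have C c d : continuous (fun t : R => expR (c * t + d)).
  by apply: derive1_continuous => t; eexists; exact: is_derive_exp_affine.
rewrite (_ : growth = fun t => expR (mu * t + - (mu * T)) + expR (- mu * t + mu * T)).
  exact: (classC_add (k := 0) (C _ _) (C _ _)).
by apply/funext => t; congr (expR _ + expR _); ring.
Qed.

Lemma increment_from_T (H h : R -> R) m t : 0 <= m ->
  (forall s, is_derive s (1 : R) H (h s)) -> (forall s, `|h s| <= m * growth s) ->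
  `|H t - H T| <= m / mu * growth t.
Proof.
move=> m0 Hd hm.
have B : `|growth_prim t| <= growth t / mu.
  have mi : `|mu^-1| = mu^-1 by rewrite ger0_norm// invr_ge0 ltW.
  rewrite /growth_prim normrM mi ler_pM2r ?invr_gt0//.
  apply: le_trans (ler_normB _ _) _.
  by rewrite !ger0_norm ?expR_ge0.
have G0 : growth_prim T = 0 by rewrite /growth_prim !subrr mul0r.
have mGd s := is_deriveZf m (growth_prim_is_derive s).
have gp := ler_norm (growth_prim t); have gn := ler_norm (- growth_prim t).
rewrite normrN in gn.
have mB : m * `|growth_prim t| <= m / mu * growth t.
  by apply: le_trans (ler_wpM2l m0 B) _; rewrite mulrA mulrAC.
have [Tt|/ltW tT] := leP T t.
  have := derivative_norm_increment Tt Hd mGd (fun s _ => hm s).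
  rewrite G0 mulr0 subr0 => /le_trans; apply; apply: le_trans mB.
  by rewrite ler_wpM2l.
have := derivative_norm_increment tT Hd mGd (fun s _ => hm s).
rewrite G0 mulr0 sub0r distrC => /le_trans; apply; apply: le_trans mB.
by rewrite -mulrN ler_wpM2l.
Qed.

Definition primT (f : R -> R) t := prim f t - prim f T.

(** Duhamel's formula for [y'' + lam^2 y = g] with zero data at [T]. *)
Definition duhamel lam g t :=
  (sin (lam * t) * primT (fun s => cos (lam * s) * g s) t
   - cos (lam * t) * primT (fun s => sin (lam * s) * g s) t) / lam.

Definition duhamel' lam g t :=
  cos (lam * t) * primT (fun s => cos (lam * s) * g s) t
   + sin (lam * t) * primT (fun s => sin (lam * s) * g s) t.

Let is_derive_cosl lam t : is_derive t (1 : R) (fun s => cos (lam * s)) (- (lam * sin (lam * t))).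
Proof.
have := @is_derive_comp1 _ _ cos (fun y => lam * y) _ _ _ _ (is_derive_cos (lam * t)) (is_derive_scaleid lam t).
by rewrite mulNr mulrC.
Qed.

Let is_derive_sinl lam t : is_derive t (1 : R) (fun s => sin (lam * s)) (lam * cos (lam * t)).
Proof.
have := @is_derive_comp1 _ _ sin (fun y => lam * y) _ _ _ _ (is_derive_sin (lam * t)) (is_derive_scaleid lam t).
by rewrite mulrC.
Qed.

Let cosl_cont lam : continuous (fun s => cos (lam * s)).
Proof. by apply: derive1_continuous => t; eexists; exact: is_derive_cosl. Qed.

Let sinl_cont lam : continuous (fun s => sin (lam * s)).
Proof. by apply: derive1_continuous => t; eexists; exact: is_derive_sinl. Qed.

Let primT_is_derive (f : R -> R) t : continuous f -> is_derive t (1 : R) (primT f) (f t).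
Proof.
move=> fc; have := is_deriveDf (prim_is_derive t fc) (is_derive_cst (- prim f T) t (1 : R)).
by rewrite addr0.
Qed.

Section Source.
Variables (lam : R) (g : R -> R).
Hypothesis lam1 : 1 <= lam.
Hypothesis gc : continuous g.

Let lam0 : lam != 0. Proof. by rewrite gt_eqF// (lt_le_trans ltr01). Qed.
Let Cc : continuous (fun s => cos (lam * s) * g s).
Proof. exact: (classC_mul (k := 0) (@cosl_cont lam) gc). Qed.
Let Sc : continuous (fun s => sin (lam * s) * g s).
Proof. exact: (classC_mul (k := 0) (@sinl_cont lam) gc). Qed.

Lemma duhamel_is_derive t : is_derive t (1 : R) (duhamel lam g) (duhamel' lam g t).
Proof.
have H1 := is_deriveMf (is_derive_sinl lam t) (primT_is_derive t Cc).
have H2 := is_deriveMf (is_derive_cosl lam t) (primT_is_derive t Sc).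
have := is_deriveZf lam^-1 (is_deriveDf H1 (is_deriveNf H2)).
rewrite (_ : (fun q => lam^-1 * _) = duhamel lam g); last by apply/funext => s; rewrite /duhamel [LHS]mulrC.
rewrite (_ : lam^-1 * _ = duhamel' lam g t)// /duhamel'; field.
exact: lam0.
Qed.

Lemma duhamel'_is_derive t :
  is_derive t (1 : R) (duhamel' lam g) (g t - lam ^+ 2 * duhamel lam g t).
Proof.
have H1 := is_deriveMf (is_derive_cosl lam t) (primT_is_derive t Cc).
have H2 := is_deriveMf (is_derive_sinl lam t) (primT_is_derive t Sc).
have := is_deriveDf H1 H2.
rewrite (_ : - _ * _ + _ + _ = g t - lam ^+ 2 * duhamel lam g t)// /duhamel.
set c := primT _ t; set s := primT _ t.
have := cos2Dsin2 (lam * t) => E.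
rewrite -[in RHS](mulr1 (g t)) -E.
by field; exact: lam0.
Qed.

Lemma duhamelT : duhamel lam g T = 0.
Proof. by rewrite /duhamel /primT !subrr !mulr0 subrr mul0r. Qed.

Lemma duhamel'T : duhamel' lam g T = 0.
Proof. by rewrite /duhamel' /primT !subrr !mulr0 addr0. Qed.

Lemma duhamel_continuous : continuous (duhamel lam g).
Proof. by apply: derive1_continuous => t; eexists; exact: duhamel_is_derive. Qed.

Lemma duhamel'_continuous : continuous (duhamel' lam g).
Proof. by apply: derive1_continuous => t; eexists; exact: duhamel'_is_derive. Qed.

Let combination_le a b m t : 0 <= m -> (forall s, `|g s| <= m * growth s) ->
  (forall s, `|a * cos (lam * s) + b * sin (lam * s)| <= 1) ->
  `|a * primT (fun s => cos (lam * s) * g s) t +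
    b * primT (fun s => sin (lam * s) * g s) t| <= m / mu * growth t.
Proof.
move=> m0 gm ab.
have Hd s := is_deriveDf (is_deriveZf a (primT_is_derive s Cc)) (is_deriveZf b (primT_is_derive s Sc)).
have z f : primT f T = 0 by rewrite /primT subrr.
have := increment_from_T t m0 Hd; rewrite /= !z !mulr0 addr0 subr0; apply.
move=> s; rewrite !mulrA -mulrDl normrM; apply: le_trans (gm s).
by rewrite ler_piMl.
Qed.

Lemma duhamel_le m t : 0 <= m -> (forall s, `|g s| <= m * growth s) ->
  `|duhamel lam g t| <= m / mu * growth t.
Proof.
move=> m0 gm; rewrite /duhamel normrM normfV.
apply: le_trans (ler_piMr (normr_ge0 _) _) _.
  rewrite invf_le1 ?normr_gt0//; exact: le_trans lam1 (ler_norm _).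
have := @combination_le (sin (lam * t)) (- cos (lam * t)) m t m0 gm.
rewrite mulNr; apply=> s; rewrite mulNr -sinB; exact: sin_max.
Qed.

Lemma duhamel'_le m t : 0 <= m -> (forall s, `|g s| <= m * growth s) ->
  `|duhamel' lam g t| <= m / mu * growth t.
Proof.
move=> m0 gm; apply: combination_le => // s.
by rewrite -cosB; exact: cos_max.
Qed.

End Source.

End Duhamel.

(** * The wave equation with a superposition of cosines as source *)

Lemma is_derive_affine (R : realType) (V : normedModType R) (L L0 : V -> R) p v :
  (forall h q u, L (h *: u + q) = h * L0 u + L q) -> is_derive p v L (L0 v).
Proof.
move=> LE; apply: is_derive_increment => e e0; exists 1 => // h _ _.
by rewrite LE addrK subrr normr0 mulr_ge0// ltW.
Qed.

Section SumN.
Context {R : realType}.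

Lemma sumND_cvg (x y : nat -> R) : cvgn (series x) -> cvgn (series y) ->
  cvgn (series (fun j => x j + y j)) /\ sumN (fun j => x j + y j) = sumN x + sumN y.
Proof.
move=> xc yc; have E : series (fun j => x j + y j) = series x \+ series y.
  by apply/funext => n; rewrite /series/= big_split.
have H : series (fun j => x j + y j) @ \oo --> sumN x + sumN y.
  by rewrite E; exact: cvgD.
by split; [apply/cvg_ex; exists (sumN x + sumN y)|exact/cvg_lim].
Qed.

Lemma sumN_sum_cvg (I : Type) (r : seq I) (x : I -> nat -> R) :
  (forall i, cvgn (series (x i))) ->
  cvgn (series (fun j => \sum_(i <- r) x i j)) /\
  sumN (fun j => \sum_(i <- r) x i j) = \sum_(i <- r) sumN (x i).
Proof.
move=> xc; elim: r => [|i r [IHc IH]].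
  have -> : (fun j => \sum_(i <- [::]) x i j) = fun=> 0.
    by apply/funext => j; rewrite big_nil.
  rewrite big_nil sumN0; split=> //.
  rewrite (_ : series _ = fun=> 0); first exact: is_cvg_cst.
  by apply/funext => n; rewrite /series/= big1.
have -> : (fun j => \sum_(k <- i :: r) x k j) = fun j => x i j + \sum_(k <- r) x k j.
  by apply/funext => j; rewrite big_cons.
by rewrite big_cons -IH; apply: sumND_cvg.
Qed.

End SumN.

Section Modes.
Context {R : realType} {n : nat}.
Local Notation V := (R * 'rV[R]_n)%type.
Implicit Types (p u w : V) (xi : 'rV[R]_n) (th : R) (z : R -> R) (A : @atom R n).

Definition mode z xi th p : R := z p.1 * cos (dotv xi p.2 + th).

Lemma dotv_le xi p : `|dotv xi p.2| <= l1 xi * `|p|.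
Proof.
rewrite /dotv; apply: le_trans (ler_norm_sum _ _ _) _.
rewrite /l1 mulr_suml; apply: ler_sum => i _.
rewrite normrM ler_wpM2l//; apply: le_trans (coord_norm_le i p.2) _.
by rewrite [leRHS]prod_normE le_max lexx orbT.
Qed.

Lemma fst_norm_le p : `|p.1| <= `|p|.
Proof. by rewrite [leRHS]prod_normE le_max lexx. Qed.

Lemma dotv_affine xi (h : R) (q u : V) :
  dotv xi (h *: u + q).2 = h * dotv xi u.2 + dotv xi q.2.
Proof. by rewrite pair_add pair_scale/= dotvDr dotvZr. Qed.

Lemma dotv_continuous xi : continuous (fun p : V => dotv xi p.2).
Proof.
apply: (@lipschitz_continuous _ V R _ (l1 xi)) => p q.
have -> : dotv xi p.2 - dotv xi q.2 = dotv xi (p - q).2.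
  by rewrite /= dotvDr -[- q.2]scaleN1r dotvZr mulN1r.
exact: dotv_le.
Qed.

Lemma dotv_classC k xi : classC k (fun p : V => dotv xi p.2).
Proof.
apply: (@classC_affine _ V k (fun u => dotv xi u.2) (fun u => dotv xi u.2)).
  exact: dotv_continuous.
by move=> h q u; rewrite dotv_affine.
Qed.

Lemma mode_classC k z xi th : classC k z -> classC k (mode z xi th).
Proof.
move=> zk; apply: classC_mul; first exact: classC_time.
apply: (@classC_comp1 _ V k cos (fun p => dotv xi p.2 + th)); first exact: classC_cos.
by apply: classC_add; [exact: dotv_classC|exact: classC_cst].
Qed.

Lemma mode_is_derive z z' xi th p w : (forall t, is_derive t (1 : R) z (z' t)) ->
  is_derive p w (mode z xi th)
   (w.1 * mode z' xi th p + dotv xi w.2 * mode z xi (th + pi / 2) p).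
Proof.
move=> zd.
have F : is_derive p w (fun q : V => q.1) w.1.
  by apply: (@is_derive_affine _ V (fun q => q.1) (fun q => q.1)).
have D : is_derive p w (fun q : V => dotv xi q.2 + th) (dotv xi w.2).
  apply: (@is_derive_affine _ V (fun q => dotv xi q.2 + th) (fun q => dotv xi q.2)).
  by move=> h q u; rewrite dotv_affine addrA.
have H1 := @is_derive_comp1 _ _ z (fun q => q.1) _ _ _ _ (zd p.1) F.
have H2 := @is_derive_comp1 _ V cos (fun q => dotv xi q.2 + th) _ _ _ _ (is_derive_cos (dotv xi p.2 + th)) D.
have := is_deriveMf H1 H2; rewrite -/(mode z xi th).
rewrite (_ : _ * _ * _ + _ * _ = w.1 * mode z' xi th p + dotv xi w.2 * mode z xi (th + pi / 2) p)//.
by rewrite /mode addrA cosDpihalf; ring.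
Qed.

Lemma mode_le z xi th p : `|mode z xi th p| <= `|z p.1|.
Proof. by rewrite normrM ler_piMr// cos_max. Qed.

Lemma mode_pi z xi th p : mode z xi (th + pi / 2 + pi / 2) p = - mode z xi th p.
Proof. by rewrite /mode !addrA !cosDpihalf sinDpihalf mulrN. Qed.

Section Growth.
Variables (T mu : R).
Hypothesis mu1 : 1 <= mu.
Local Notation E := (growth T mu).

Let mu0 : 0 < mu. Proof. exact: lt_le_trans ltr01 mu1. Qed.

(** The 1 is a mass term, which keeps [lam] away from 0. It is compensated by the
   source [1 - b] in [wave_solvable]. *)
Definition lam xi : R := Num.sqrt (1 + dotv xi xi).

Lemma dotv_ge0 xi : 0 <= dotv xi xi.
Proof. by rewrite sumr_ge0// => i _; rewrite -expr2 sqr_ge0. Qed.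

Lemma lam_sqr xi : lam xi ^+ 2 = 1 + dotv xi xi.
Proof. by rewrite sqr_sqrtr// addr_ge0// dotv_ge0. Qed.

Lemma lam_ge1 xi : 1 <= lam xi.
Proof. by rewrite -sqrtr1 ler_wsqrtr// lerDl dotv_ge0. Qed.

Lemma l1_le_weight xi : l1 xi <= weight xi.
Proof. rewrite /weight expr2; have := l1_ge0 xi; nra. Qed.

Lemma l1_sqr_le_weight xi : l1 xi * l1 xi <= weight xi.
Proof. rewrite /weight expr2; have := l1_ge0 xi; nra. Qed.

Lemma lam_sqr_le xi : lam xi ^+ 2 <= weight xi.
Proof.
rewrite lam_sqr; have := @dotv_le xi (0, xi); move=> H.
have {}H : dotv xi xi <= l1 xi * l1 xi.
  rewrite /dotv /l1 mulr_suml; apply: ler_sum => i _; apply: le_trans (ler_norm _) _.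
  by rewrite normrM ler_wpM2l// (bigD1 i)//= lerDl sumr_ge0.
by rewrite /weight expr2; have := l1_ge0 xi; nra.
Qed.

Definition sol A := duhamel T (lam (wavev A)) (amp A).
Definition vel A := duhamel' T (lam (wavev A)) (amp A).
Definition acc A t := amp A t - lam (wavev A) ^+ 2 * sol A t.

Definition sol_mode A := mode (sol A) (wavev A) (phase A).
Definition vel_mode A := mode (vel A) (wavev A) (phase A).

Section OneAtom.
Variable A : @atom R n.
Hypothesis AE : atom_ok E A.

Let w0 : 0 < weight (wavev A) := lt_le_trans ltr01 (weight_ge1 _).
Let m0 : 0 <= maj A.
Proof.
have := AE.2 T; have : 0 <= `|amp A T| * weight (wavev A) by rewrite mulr_ge0// ltW.
move=> /le_trans /[apply]; rewrite pmulr_lge0//.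
exact: lt_le_trans ltr01 (growth_ge1 T mu1 T).
Qed.

Let amp_le t : `|amp A t| <= maj A / weight (wavev A) * E t.
Proof. by rewrite mulrAC ler_pdivlMr//; exact: AE.2. Qed.

Let mw0 : 0 <= maj A / weight (wavev A). Proof. by rewrite divr_ge0// ltW. Qed.

Lemma sol_weight_le t : `|sol A t| * weight (wavev A) <= maj A / mu * E t.
Proof.
rewrite -ler_pdivlMr//; apply: le_trans (duhamel_le mu1 (lam_ge1 _) AE.1 t mw0 amp_le) _.
by rewrite -!mulrA [X in maj A * X <= _]mulrC -mulrA.
Qed.

Lemma vel_weight_le t : `|vel A t| * weight (wavev A) <= maj A / mu * E t.
Proof.
rewrite -ler_pdivlMr//; apply: le_trans (@duhamel'_le R T mu mu1 (lam (wavev A)) (amp A) AE.1 _ t mw0 amp_le) _.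
by rewrite -!mulrA [X in maj A * X <= _]mulrC -mulrA.
Qed.

Let div_mu_le t : maj A / mu * E t <= maj A * E t.
Proof.
rewrite ler_wpM2r ?growth_ge0//.
by rewrite ler_piMr// invf_le1.
Qed.

Let sol_le t : `|sol A t| * weight (wavev A) <= maj A * E t.
Proof. exact: le_trans (sol_weight_le t) (div_mu_le t). Qed.
Let vel_le t : `|vel A t| * weight (wavev A) <= maj A * E t.
Proof. exact: le_trans (vel_weight_le t) (div_mu_le t). Qed.

Let acc_le t : `|acc A t| <= 2 * (maj A * E t).
Proof.
apply: le_trans (ler_normB _ _) _; rewrite mulr_natl mulr2n; apply: lerD.
  exact: atom_amp_le AE.
rewrite normrM ger0_norm ?sqr_ge0// mulrC; apply: le_trans (sol_le t).
by rewrite ler_wpM2l// lam_sqr_le.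
Qed.

Lemma sol_is_derive t : is_derive t (1 : R) (sol A) (vel A t).
Proof. exact: (duhamel_is_derive T (lam_ge1 _) AE.1 t). Qed.

Lemma vel_is_derive t : is_derive t (1 : R) (vel A) (acc A t).
Proof. exact: (duhamel'_is_derive T (lam_ge1 _) AE.1 t). Qed.

Lemma sol_continuous : continuous (sol A).
Proof. exact: (duhamel_continuous (lam_ge1 _) AE.1). Qed.

Lemma vel_continuous : continuous (vel A).
Proof. exact: (duhamel'_continuous (lam_ge1 _) AE.1). Qed.

Lemma acc_continuous : continuous (acc A).
Proof.
exact: (classC_sub (k := 0) AE.1 (classC_scale (k := 0) _ sol_continuous)).
Qed.

Definition d1_mode u p := u.1 * mode (vel A) (wavev A) (phase A) p +
  dotv (wavev A) u.2 * mode (sol A) (wavev A) (phase A + pi / 2) p.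

Definition d2_mode u w p :=
  u.1 * (w.1 * mode (acc A) (wavev A) (phase A) p +
    dotv (wavev A) w.2 * mode (vel A) (wavev A) (phase A + pi / 2) p) +
  dotv (wavev A) u.2 * (w.1 * mode (vel A) (wavev A) (phase A + pi / 2) p +
    dotv (wavev A) w.2 * mode (sol A) (wavev A) (phase A + pi / 2 + pi / 2) p).

Lemma sol_mode_is_derive u p : is_derive p u (sol_mode A) (d1_mode u p).
Proof. exact: mode_is_derive sol_is_derive. Qed.

Lemma d1_mode_is_derive u w p : is_derive p w (d1_mode u) (d2_mode u w p).
Proof.
apply: is_deriveDf; apply: is_deriveZf; apply: mode_is_derive.
- exact: vel_is_derive.
- exact: sol_is_derive.
Qed.

Lemma d1_mode_continuous u : continuous (d1_mode u).
Proof.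
apply: (classC_add (k := 0)); apply: (classC_scale (k := 0)); apply: (mode_classC (k := 0)).
- exact: vel_continuous.
- exact: sol_continuous.
Qed.

Lemma d2_mode_continuous u w : continuous (d2_mode u w).
Proof.
apply: (classC_add (k := 0)); apply: (classC_scale (k := 0));
  apply: (classC_add (k := 0)); apply: (classC_scale (k := 0)); apply: (mode_classC (k := 0)).
- exact: acc_continuous.
- exact: vel_continuous.
- exact: vel_continuous.
- exact: sol_continuous.
Qed.

Lemma sol_mode_le p : `|sol_mode A p| <= 1 * (maj A * E p.1).
Proof.
rewrite mul1r; apply: le_trans (mode_le _ _ _ _) _; apply: le_trans (sol_le p.1).
by rewrite ler_peMr// weight_ge1.
Qed.

Lemma vel_mode_le p : `|vel_mode A p| <= 1 * (maj A * E p.1).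
Proof.
rewrite mul1r; apply: le_trans (mode_le _ _ _ _) _; apply: le_trans (vel_le p.1).
by rewrite ler_peMr// weight_ge1.
Qed.

Let l1_mode_le z (th : R) p : `|z p.1| * weight (wavev A) <= maj A * E p.1 ->
  l1 (wavev A) * `|mode z (wavev A) th p| <= maj A * E p.1.
Proof.
apply: le_trans; rewrite mulrC; apply: ler_pM; rewrite ?l1_ge0//.
  exact: mode_le.
exact: l1_le_weight.
Qed.

Lemma d1_mode_le u p : `|d1_mode u p| <= (2 * `|u|) * (maj A * E p.1).
Proof.
apply: le_trans (ler_normD _ _) _; rewrite -mulrA mulr_natl mulr2n.
have mE0 : 0 <= maj A * E p.1 by rewrite mulr_ge0// growth_ge0.
apply: lerD; rewrite normrM.
  apply: ler_pM => //; first exact: fst_norm_le.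
  by rewrite -[leRHS]mul1r; exact: vel_mode_le.
apply: le_trans (ler_wpM2r (normr_ge0 _) (dotv_le _ _)) _.
rewrite mulrAC mulrC ler_wpM2l//; apply: l1_mode_le; exact: sol_le.
Qed.

Lemma d2_mode_le u w p :
  `|d2_mode u w p| <= (5 * (`|u| * `|w|)) * (maj A * E p.1).
Proof.
have mE0 : 0 <= maj A * E p.1 by rewrite mulr_ge0// growth_ge0.
set B := maj A * E p.1 in mE0 *.
have u1 := fst_norm_le u; have w1 := fst_norm_le w.
have du := dotv_le (wavev A) u; have dw := dotv_le (wavev A) w.
set l := l1 (wavev A) in du dw.
have l0 : 0 <= l := l1_ge0 _.
have P1 : `|u.1 * (w.1 * mode (acc A) (wavev A) (phase A) p)| <= `|u| * `|w| * (2 * B).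
  rewrite normrM (normrM w.1) mulrA; apply: ler_pM; rewrite ?mulr_ge0//; first exact: ler_pM.
  exact: (le_trans (mode_le (acc A) (wavev A) (phase A) p) (acc_le p.1)).
have V1 : l * `|mode (vel A) (wavev A) (phase A + pi / 2) p| <= B.
  by apply: l1_mode_le; exact: vel_le.
have P2 : `|u.1 * (dotv (wavev A) w.2 * mode (vel A) (wavev A) (phase A + pi / 2) p)|
    <= `|u| * `|w| * B.
  rewrite normrM (normrM (dotv (wavev A) w.2)) -mulrA; apply: ler_pM; rewrite ?mulr_ge0//.
  apply: le_trans (ler_wpM2r (normr_ge0 _) dw) _.
  by rewrite mulrAC mulrC ler_wpM2l.
have P3 : `|dotv (wavev A) u.2 * (w.1 * mode (vel A) (wavev A) (phase A + pi / 2) p)|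
    <= `|u| * `|w| * B.
  rewrite normrM (normrM w.1) mulrCA [`|u| * _]mulrC -mulrA; apply: ler_pM; rewrite ?mulr_ge0//.
  apply: le_trans (ler_wpM2r (normr_ge0 _) du) _.
  by rewrite mulrAC mulrC ler_wpM2l.
have P4 : `|dotv (wavev A) u.2 * (dotv (wavev A) w.2 *
    mode (sol A) (wavev A) (phase A + pi / 2 + pi / 2) p)| <= `|u| * `|w| * B.
  rewrite normrM (normrM (dotv (wavev A) w.2)) mulrA.
  apply: (@le_trans _ _ ((l * `|u|) * (l * `|w|) * `|sol A p.1|)).
    apply: ler_pM; rewrite ?mulr_ge0//; first exact: ler_pM.
    exact: mode_le.
  rewrite [leLHS](_ : _ = `|u| * `|w| * (`|sol A p.1| * (l * l))); last by ring.
  rewrite ler_wpM2l ?mulr_ge0//; apply: le_trans (sol_le p.1).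
  by rewrite ler_wpM2l// l1_sqr_le_weight.
rewrite /d2_mode !mulrDr.
apply: le_trans (ler_normD _ _) _.
have H1 := ler_normD (u.1 * (w.1 * mode (acc A) (wavev A) (phase A) p))
  (u.1 * (dotv (wavev A) w.2 * mode (vel A) (wavev A) (phase A + pi / 2) p)).
have H2 := ler_normD (dotv (wavev A) u.2 * (w.1 * mode (vel A) (wavev A) (phase A + pi / 2) p))
  (dotv (wavev A) u.2 * (dotv (wavev A) w.2 *
    mode (sol A) (wavev A) (phase A + pi / 2 + pi / 2) p)).
apply: le_trans (lerD H1 H2) _.
apply: le_trans (lerD (lerD P1 P2) (lerD P3 P4)) _.
by rewrite le_eqVlt; apply/orP; left; apply/eqP; ring.
Qed.

Lemma mode_equation p :
  d2_mode (1, 0) (1, 0) p - \sum_(i < n) d2_mode (dir i) (dir i) p + sol_mode A p =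
  atom_val A p.
Proof.
have d0 : dotv (wavev A) 0 = 0 by rewrite dotvC dotv0l.
have di i : dotv (wavev A) (delta_mx 0 i) = wavev A 0 i.
  rewrite /dotv (bigD1 i)//= big1 ?addr0.
    by rewrite !mxE !eqxx/= mulr1.
  by move=> j /negPf ji; rewrite !mxE eqxx/= ji mulr0.
have -> : \sum_(i < n) d2_mode (dir i) (dir i) p =
    - (dotv (wavev A) (wavev A) * sol_mode A p).
  rewrite /dotv mulr_suml -sumrN; apply: eq_bigr => i _.
  by rewrite /d2_mode /= di mode_pi; rewrite /sol_mode; ring.
rewrite /d2_mode /= d0 /acc lam_sqr /sol_mode /atom_val /mode; ring.
Qed.

End OneAtom.

Section Family.
Variables (d : nat -> @atom R n) (K : R).
Hypothesis dK : family_ok E d K.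

Let dominated (u : nat -> V -> R) c : 0 <= c -> (forall j, continuous (u j)) ->
  (forall j p, `|u j p| <= c * (maj (d j) * E p.1)) ->
  (forall j, continuous (u j)) /\ locally_dominated u.
Proof.
move=> c0 uc ub; split=> // p.
have B0 : 0 <= c * (E p.1 + 1) by rewrite mulr_ge0// addr_ge0// growth_ge0.
exists (fun j => c * (E p.1 + 1) * maj (d j)), (c * (E p.1 + 1) * K).
split; first exact: bounded_sum_scale B0 dK.2.
have Ec : {for p, continuous (fun q : V => E q.1)}.
  by apply: (classC_time (k := 0)); exact: growth_continuous.
have [r r0 H] := continuous_ball Ec ltr01.
apply/nbhs_ballP; exists r => // q; rewrite -ball_normE /= distrC => /H qE j.
apply: le_trans (ub j q) _; rewrite -mulrA ler_wpM2l// mulrC ler_wpM2r//.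
  exact: dK.2.1.
by have := ler_norm (E q.1 - E p.1); lra.
Qed.

Let dominated_sol : dominatedC 2 (fun j => sol_mode (d j)).
Proof.
have D1 u j : 'D_u (sol_mode (d j)) = d1_mode (d j) u.
  by apply/funext => p; have [] := sol_mode_is_derive (dK.1 j) u p.
have D2 u w j : 'D_w (d1_mode (d j) u) = d2_mode (d j) u w.
  by apply/funext => p; have [] := d1_mode_is_derive (dK.1 j) u w p.
have [c0 l0] := @dominated (fun j => sol_mode (d j)) 1 ler01
  (fun j => mode_classC (k := 0) _ _ (sol_continuous (dK.1 j)))
  (fun j p => sol_mode_le (dK.1 j) p).
split=> //; split=> // u; split=> [j p|].
  by have [] := sol_mode_is_derive (dK.1 j) u p.
rewrite (_ : (fun j => _) = fun j => d1_mode (d j) u); last by apply/funext => j; exact: D1.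
have u0 : 0 <= 2 * `|u| by rewrite mulr_ge0.
have [c1 k1] := @dominated (fun j => d1_mode (d j) u) _ u0
  (fun j => d1_mode_continuous (dK.1 j) (u := u)) (fun j p => d1_mode_le (dK.1 j) u p).
split=> //; split=> // w; split=> [j p|].
  by have [] := d1_mode_is_derive (dK.1 j) u w p.
rewrite (_ : (fun j => _) = fun j => d2_mode (d j) u w); last by apply/funext => j; exact: D2.
have w0 : 0 <= 5 * (`|u| * `|w|) by rewrite !mulr_ge0.
have [c2 k2] := @dominated (fun j => d2_mode (d j) u w) _ w0
  (fun j => d2_mode_continuous (dK.1 j) (u := u) (w := w)) (fun j p => d2_mode_le (dK.1 j) u w p).
by split.
Qed.

Lemma family_sol_classC : classC 2 (family_sum sol_mode d).
Proof. exact: dominatedC_classC dominated_sol. Qed.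

Lemma family_sol_derive u : 'D_u (family_sum sol_mode d) =
  family_sum (fun A => d1_mode A u) d.
Proof.
apply/funext => p; have [_ ->] := dominatedC_is_derive u p dominated_sol.
congr sumN; apply/funext => j.
by have [] := sol_mode_is_derive (dK.1 j) u p.
Qed.

Lemma family_sol_derive2 u w p : 'D_w ('D_u (family_sum sol_mode d)) p =
  family_sum (fun A => d2_mode A u w) d p.
Proof.
rewrite family_sol_derive.
have D1 : (fun j => 'D_u (sol_mode (d j))) = fun j => d1_mode (d j) u.
  by apply/funext => j; apply/funext => q; have [] := sol_mode_is_derive (dK.1 j) u q.
have H : dominatedC 1 (fun j => d1_mode (d j) u).
  by rewrite -D1; have [_ [_ /(_ u)[_]]] := dominated_sol.
have [_ ->] := dominatedC_is_derive w p H.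
congr sumN; apply/funext => j.
by have [] := d1_mode_is_derive (dK.1 j) u w p.
Qed.

Lemma family_sol_dt : 'D_((1, 0) : V) (family_sum sol_mode d) = family_sum vel_mode d.
Proof.
rewrite family_sol_derive; apply/funext => p; congr sumN; apply/funext => j.
by rewrite /d1_mode /= dotvC dotv0l mul0r addr0 mul1r.
Qed.

Lemma family_equation p :
  'D_((1, 0) : V) ('D_((1, 0) : V) (family_sum sol_mode d)) p
  - \sum_(i < n) 'D_(dir i) ('D_(dir i) (family_sum sol_mode d)) p
  + family_sum sol_mode d p = family_sum atom_val d p.
Proof.
have Ep := growth_ge0 T mu1 p.1.
have cv (x : nat -> R) c : 0 <= c -> (forall j, `|x j| <= c * (maj (d j) * E p.1)) ->
    cvgn (series x).
  move=> c0 xB; have cE : 0 <= c * E p.1 by rewrite mulr_ge0.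
  apply: (sumN_cvg (bounded_sum_scale cE dK.2)) => j.
  by apply: le_trans (xB j) _; rewrite mulrA mulrAC.
have cv2 u w : cvgn (series (fun j => d2_mode (d j) u w p)).
  by apply: (cv _ (5 * (`|u| * `|w|))) => [|j]; [rewrite !mulr_ge0|exact: d2_mode_le (dK.1 j) u w p].
have cv0 : cvgn (series (fun j => sol_mode (d j) p)).
  by apply: (cv _ 1) => // j; exact: sol_mode_le (dK.1 j) p.
have E1 := family_sol_derive2 (1, 0) (1, 0) p.
have E2 : \sum_(i < n) 'D_(dir i) ('D_(dir i) (family_sum sol_mode d)) p =
    \sum_(i < n) family_sum (fun A => d2_mode A (dir i) (dir i)) d p.
  by apply: eq_bigr => i _; exact: family_sol_derive2.
have sub_add (a b c a' b' f : R) : a = a' -> b = b' -> a' - b' + c = f -> a - b + c = f.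
  by move=> -> ->.
apply: (sub_add _ _ _ _ _ _ E1 E2).
have [sc sE] := sumN_sum_cvg (index_enum 'I_n) (fun i => cv2 (dir i) (dir i)).
rewrite /family_sum -sE.
have sN : cvgn (series (fun j => -1 * \sum_(i <- index_enum 'I_n) d2_mode (d j) (dir i) (dir i) p)).
  by rewrite (_ : series _ = (fun N => -1 * series (fun j => \sum_(i <- index_enum 'I_n) d2_mode (d j) (dir i) (dir i) p) N)); [exact: is_cvgMr|apply/funext => N; rewrite /series/= mulr_sumr].
have sNE : sumN (fun j => -1 * \sum_(i <- index_enum 'I_n) d2_mode (d j) (dir i) (dir i) p) =
   - sumN (fun j => \sum_(i <- index_enum 'I_n) d2_mode (d j) (dir i) (dir i) p).
  apply/cvg_lim => //.
  rewrite (_ : series _ = (fun N => -1 * series (fun j => \sum_(i <- index_enum 'I_n) d2_mode (d j) (dir i) (dir i) p) N)); last first.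
    by apply/funext => N; rewrite /series/= mulr_sumr.
  by rewrite -[- sumN _]mulN1r; apply: cvgMr.
rewrite -sNE.
have [c1 <-] := sumND_cvg (cv2 (1, 0) (1, 0)) sN.
have [c2 <-] := sumND_cvg c1 cv0.
congr sumN; apply/funext => j.
by rewrite mulN1r; exact: (mode_equation (d j) p).
Qed.

Lemma family_final_data x : family_sum sol_mode d (T, x) = 0 /\
  family_sum vel_mode d (T, x) = 0.
Proof.
split; rewrite -[RHS](@sumN0 R); congr sumN; apply/funext => j.
  by rewrite /sol_mode /mode /sol duhamelT mul0r.
by rewrite /vel_mode /mode /vel duhamel'T mul0r.
Qed.

Let wiener_of (z : @atom R n -> R -> R) (D : set V) :
  (forall A, atom_ok E A -> continuous (z A)) ->
  (forall A t, atom_ok E A -> `|z A t| * weight (wavev A) <= maj A / mu * E t) ->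
  wiener D E (family_sum (fun A => mode (z A) (wavev A) (phase A)) d) (K / mu).
Proof.
move=> zc zb.
exists (fun j => Atom (z (d j)) (wavev (d j)) (phase (d j)) (maj (d j) / mu)); split=> //.
split=> [j|]; first by split=> [|t] /=; [exact: zc (dK.1 j)|exact: zb (dK.1 j)].
have mu'0 : 0 <= mu^-1 by rewrite invr_ge0 ltW.
have := bounded_sum_scale mu'0 dK.2; rewrite [_ * K]mulrC.
by apply: bounded_sum_le => j /=; rewrite mulrC lexx mulr_ge0// dK.2.1.
Qed.

Lemma wiener_sol D : wiener D E (family_sum sol_mode d) (K / mu).
Proof.
apply: wiener_of => [A|A t] AE; [exact: sol_continuous|exact: sol_weight_le].
Qed.

Lemma wiener_vel D : wiener D E (family_sum vel_mode d) (K / mu).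
Proof.
apply: wiener_of => [A|A t] AE; [exact: vel_continuous|exact: vel_weight_le].
Qed.

End Family.
End Growth.
End Modes.

(** * The wave equation with lower order terms *)

Section WaveSolver.
Context {R : realType} {n : nat}.
Local Notation V := (R * 'rV[R]_n)%type.
Implicit Types (p : V) (F r : V -> R) (K : R) (d : nat -> @atom R n).

Definition real_box r p : R :=
  'D_((1, 0) : V) ('D_((1, 0) : V) r) p - \sum_(i < n) 'D_(dir i) ('D_(dir i) r) p.

Lemma bounded_sum_half K : 0 <= K -> bounded_sum (fun k => K / 2 ^+ k) (2 * K).
Proof.
move=> K0; split=> [k|m]; first by rewrite divr_ge0// exprn_ge0.
have H : \sum_(0 <= k < m) K / 2 ^+ k = 2 * K - 2 * K / 2 ^+ m.
  elim: m => [|m IH]; first by rewrite big_geq// expr0 divr1 subrr.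
  rewrite big_nat_recr//= IH exprS; field.
  by rewrite expf_neq0.
by rewrite H gerBl divr_ge0 ?mulr_ge0 ?exprn_ge0.
Qed.

(** Picard iteration: the equation with mass and without lower order terms is
   solved with the source [F], then with the source [a * dt r + (1 - b) * r] made
   of the solution [r] just found, and so on. Each step divides the norm by 2,
   by the choice of [mu], and the sum of all solutions is the one sought. *)
Lemma wave_solvable (D : set V) T (a b : 'rV[R]_n -> R) Ga Gb :
  wiener D (fun=> 1) (fun p => a p.2) Ga ->
  wiener D (fun=> 1) (fun p => 1 - b p.2) Gb ->
  exists2 mu, 1 <= mu & forall F K, wiener D (growth T mu) F K ->
  exists r : V -> R, [/\ classC 2 r,
    forall p, D p ->
      real_box r p - a p.2 * 'D_((1, 0) : V) r p + b p.2 * r p = F p,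
    forall x, r (T, x) = 0 /\ 'D_((1, 0) : V) r (T, x) = 0 &
    forall p, `|r p| <= 2 * K * growth T mu p.1].
Proof.
move=> aG bG; have Ga0 := wiener_ge0 aG; have Gb0 := wiener_ge0 bG.
pose mu := 1 + 2 * (Ga + Gb).
have mu1 : 1 <= mu by rewrite lerDl mulr_ge0// addr_ge0.
have mu0 : 0 < mu := lt_le_trans ltr01 mu1.
exists mu => // F K [d0 [d0K d0F]].
have K0 : 0 <= K := bounded_sum_ge0 d0K.2.
pose E := growth T mu.
have E0 t : 0 <= E t := growth_ge0 T mu1 t.
pose sol := family_sum (@sol_mode R n T); pose vel := family_sum (@vel_mode R n T).
have step (x : (nat -> @atom R n) * R) : exists y : (nat -> @atom R n) * R,
    family_ok E x.1 x.2 -> [/\ y.2 = x.2 / 2, family_ok E y.1 y.2 &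
      forall p, D p -> a p.2 * vel x.1 p + (1 - b p.2) * sol x.1 p =
        family_sum atom_val y.1 p].
  have [ok|nok] := pselect (family_ok E x.1 x.2); last by exists x.
  have x0 : 0 <= x.2 := bounded_sum_ge0 ok.2.
  have := wiener_add E0 (wiener_mul E0 aG (wiener_vel mu1 ok D))
                        (wiener_mul E0 bG (wiener_sol mu1 ok D)).
  move=> /(@wiener_le _ _ _ _ _ _ (x.2 / 2)) [|y [yok yE]].
    rewrite -mulrDl mulrA ler_pdivrMr// /mu.
    have : 0 <= x.2 * (Ga + Gb) by rewrite mulr_ge0// addr_ge0.
    by nra.
  by exists (y, x.2 / 2).
have [nxt nxtE] := choice step.
pose x k := iter k nxt (d0, K).
have xok k : family_ok E (x k).1 (x k).2 /\ (x k).2 = K / 2 ^+ k.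
  elim: k => [|k [ok IH]]; first by split=> //; rewrite expr0 divr1.
  have [H1 H2 _] := nxtE _ ok; split=> //=.
  by rewrite H1 IH exprS invfM mulrCA mulrC.
have ok k := (xok k).1.
have KS : bounded_sum (fun k => (x k).2) (2 * K).
  rewrite (_ : (fun k => _) = fun k => K / 2 ^+ k); first exact: bounded_sum_half.
  by apply/funext => k; exact: (xok k).2.
pose dd := interleave (fun k => (x k).1).
have ddok : family_ok E dd (2 * K) := interleave_ok ok KS.
have cl (phi : @atom R n -> V -> R) p : (forall A, atom_ok E A -> `|phi A p| <= E p.1 * maj A) ->
  family_sum phi dd p = sumN (fun k => family_sum phi (x k).1 p) /\
  cvgn (series (fun k => family_sum phi (x k).1 p)).
  move=> B; split; first exact: (interleave_sum (E0 p.1) B ok KS).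
  have EK := bounded_sum_scale (E0 p.1) KS.
  apply: (sumN_cvg EK) => k.
  apply: sumN_le (bounded_sum_scale (E0 p.1) (ok k).2) _ => j.
  by apply: B; exact: (ok k).1.
have clv p : family_sum atom_val dd p = sumN (fun k => family_sum atom_val (x k).1 p) /\
  cvgn (series (fun k => family_sum atom_val (x k).1 p)).
  by apply: cl => A AE; rewrite mulrC; exact: atom_val_le.
have cls p : sol dd p = sumN (fun k => sol (x k).1 p) /\ cvgn (series (fun k => sol (x k).1 p)).
  by apply: cl => A AE; rewrite mulrC -[leRHS]mul1r; exact: sol_mode_le.
have clq p : vel dd p = sumN (fun k => vel (x k).1 p) /\ cvgn (series (fun k => vel (x k).1 p)).
  by apply: cl => A AE; rewrite mulrC -[leRHS]mul1r; exact: vel_mode_le.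
have dtE q : 'D_((1, 0) : V) (sol dd) q = vel dd q :=
  congr1 (fun f => f q) (family_sol_dt mu1 ddok).
exists (sol dd); split.
- exact: (family_sol_classC mu1 ddok).
- move=> p Dp; rewrite dtE.
  have box_eq : real_box (sol dd) p + sol dd p = family_sum atom_val dd p.
    exact: (family_equation mu1 ddok p).
  suff total : family_sum atom_val dd p = F p + (a p.2 * vel dd p + (1 - b p.2) * sol dd p).
    by move: box_eq; rewrite total; lra.
  have [vE vc] := clv p; have [sE sc] := cls p; have [qE qc] := clq p.
  rewrite vE sE qE d0F//.
  have split0 (u : nat -> R) : cvgn (series u) -> sumN u = u 0%N + sumN (fun k => u k.+1).
    move=> uc; apply/cvg_lim => //; rewrite -cvg_shiftS.
    have H : (fun k => series u k.+1 - u 0%N) @ \oo --> sumN u - u 0%N.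
      by apply: cvgB; [rewrite cvg_shiftS|exact: cvg_cst].
    have -> : sumN (fun k => u k.+1) = sumN u - u 0%N.
      apply/cvg_lim => //; apply: cvg_trans H; apply: near_eq_cvg; apply: filterE => k.
      by rewrite /series/= big_nat_recl// addrC addKr.
    by rewrite addrC subrK; rewrite cvg_shiftS.
  rewrite (split0 _ vc) /=; congr (_ + _).
  have lin c (u : nat -> R) : cvgn (series u) ->
      cvgn (series (fun k => c * u k)) /\ sumN (fun k => c * u k) = c * sumN u.
    move=> uc; have H : series (fun k => c * u k) @ \oo --> c * sumN u.
      rewrite (_ : series _ = fun N => c * series u N); first exact: cvgMr.
      by apply/funext => N; rewrite /series/= mulr_sumr.
    by split; [apply/cvg_ex; exists (c * sumN u)|exact/cvg_lim].
  have [qc' <-] := lin (a p.2) _ qc; have [sc' <-] := lin (1 - b p.2) _ sc.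
  have [_ <-] := sumND_cvg qc' sc'.
  congr sumN; apply/funext => k.
  by have [_ _ H] := nxtE _ (ok k); rewrite H.
- by move=> t; rewrite dtE; exact: family_final_data.
- move=> p; have := wiener_norm_le (p := p) E0 (wiener_sol mu1 ddok setT) Logic.I.
  move=> /le_trans; apply; rewrite ler_wpM2r ?E0//.
  by rewrite ler_piMr ?mulr_ge0// invf_le1.
Qed.

Lemma wiener_growth (D : set V) T mu F K : 1 <= mu ->
  wiener D (fun=> 1) F K -> wiener D (growth T mu) F K.
Proof.
move=> mu1 H.
have c1 : continuous (fun _ : R => 1 : R) by move=> x; exact: cvg_cst.
have := wiener_mul_time (E' := growth T mu) c1 ler01 _ H.
rewrite mul1r => G; apply: wiener_ext (G _) => [p _|t]; first by rewrite mul1r.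
by rewrite normr1 !mul1r growth_ge1.
Qed.

End WaveSolver.

(** * The transport equation *)

Section Transport.
Context {R : realType} {n : nat}.
Local Notation V := (R * 'rV[R]_n)%type.
Implicit Types (p q v : V) (f g u : V -> R) (s t : R).
Variables (T : R) (w : 'rV[R]_n).

(** The characteristic direction of the transport operator. *)
Definition char : V := (1, - w).

Lemma derive_char u p : classC 1 u ->
  'D_char u p = 'D_((1, 0) : V) u p - \sum_(i < n) w 0 i * 'D_(dir i) u p.
Proof.
move=> u1; have H (r : seq 'I_n) :
    'D_((1, 0) + \sum_(i <- r) (- w 0 i) *: dir i : V) u p =
    'D_((1, 0) : V) u p - \sum_(i <- r) w 0 i * 'D_(dir i) u p.
  elim: r => [|i r IH]; first by rewrite !big_nil addr0 subr0.
  rewrite !big_cons addrCA addrC (classC_derive_add _ _ _ u1).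
  rewrite (classC_derive_scale _ _ _ u1) IH; ring.
rewrite -H; congr ('D_ _ u p).
have -> : \sum_(i < n) (- w 0 i) *: dir i = (0, - w) :> V.
  have G (r : seq 'I_n) : \sum_(i <- r) (- w 0 i) *: dir i =
      (0, \sum_(i <- r) (- w 0 i) *: delta_mx 0 i) :> V.
    elim: r => [|i r IH]; first by rewrite !big_nil.
    by rewrite !big_cons IH pair_add pair_scale/= mulr0 add0r.
  rewrite G; congr pair; rewrite [in RHS](row_sum_delta w) -sumrN.
  by apply: eq_bigr => i _; rewrite scaleNr.
by rewrite pair_add/= addr0 add0r.
Qed.

Lemma char_point s p : s *: char + p = (s + p.1, p.2 - s *: w).
Proof. by rewrite pair_add pair_scale/= mulr1 scalerN addrC [X in (_, X)]addrC addrC. Qed.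

(** The primitive of [g] along the characteristics that vanishes at time [T]. *)
Definition char_prim g p : R :=
  - prim_param (fun P : V * R => g (P.2 *: char + P.1)) (p, T - p.1).

Lemma shift_lip (x y : V * R) :
  `|x.2 *: char + x.1 - (y.2 *: char + y.1)| <= (`|char| + 1) * `|x - y|.
Proof.
have -> : x.2 *: char + x.1 - (y.2 *: char + y.1) = (x - y).2 *: char + (x - y).1.
  by rewrite opprD addrACA -scalerBl.
apply: le_trans (ler_normD _ _) _; rewrite mulrDl mul1r normrZ mulrC.
apply: lerD; first by rewrite ler_wpM2l// [leRHS]prod_normE le_max lexx orbT.
by rewrite [leRHS]prod_normE le_max lexx.
Qed.

Lemma shift_affine (h : R) (q u : V * R) :
  (h *: u + q).2 *: char + (h *: u + q).1 =
  h *: (u.2 *: char + u.1) + (q.2 *: char + q.1).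
Proof. by rewrite /= scalerDl -scalerA scalerDr addrACA. Qed.

Lemma shift_classC k g : classC k g ->
  classC k (fun P : V * R => g (P.2 *: char + P.1)).
Proof.
apply: (@classC_comp_affine _ (V * R)%type V k (fun P => P.2 *: char + P.1)
  (fun P => P.2 *: char + P.1)).
  exact: (@lipschitz_continuous _ (V * R)%type V _ _ shift_lip).
by move=> h q u; exact: shift_affine.
Qed.

Lemma time_affine (h : R) (q u : V) :
  (h *: u + q, T - (h *: u + q).1) = h *: (u, - u.1) + (q, T - q.1) :> V * R.
Proof. by congr pair; rewrite /= /GRing.scale/=; ring. Qed.

Lemma char_prim_classC k g : classC k g -> classC k (char_prim g).
Proof.
move=> gk; apply: classC_opp.
apply: (@classC_comp_affine _ V (V * R)%type k (fun p => (p, T - p.1)) (fun p => (p, - p.1))).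
- apply: (@lipschitz_continuous _ V (V * R)%type _ 1) => x y.
  rewrite prod_norm_sub mul1r ge_max lexx/=.
  rewrite opprB addrCA addrAC subrr add0r -opprB normrN; exact: (fst_norm_le (x - y)).
- by move=> h q u; exact: time_affine.
- exact/prim_param_classC/shift_classC.
Qed.

Lemma char_prim_is_derive g p : classC 1 g -> is_derive p char (char_prim g) (g p).
Proof.
move=> g1; set G := fun P : V * R => g (P.2 *: char + P.1).
have G1 : classC 1 G := shift_classC g1.
have DG P : is_derive P ((char, 0) : V * R) G ('D_char g (P.2 *: char + P.1)).
  apply: (@is_derive_comp_affine _ (V * R)%type V (fun P => P.2 *: char + P.1)
    (fun P => P.2 *: char + P.1) g).
    by move=> h q u; exact: shift_affine.
  by rewrite /= scale0r add0r; exact: (classC_is_derive _ char g1).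
have DGE : 'D_((char, 0) : V * R) G = fun P => 'D_char g (P.2 *: char + P.1).
  by apply/funext => P; have [] := DG P.
have H := prim_param_is_derive (-1) (p, T - p.1) (classC_continuous G1)
  (fun Q => classC_derivable G1) (classC_continuous (classC_derive ((char, 0) : V * R) G1)).
have H2 : is_derive p char (fun q => prim_param G (q, T - q.1))
    (prim_param ('D_((char, 0) : V * R) G) (p, T - p.1) + -1 * G (p, T - p.1)).
  apply: (@is_derive_comp_affine _ V (V * R)%type (fun q => (q, T - q.1)) (fun q => (q, - q.1))).
  by move=> h q u; exact: time_affine.
have := is_deriveNf H2; rewrite -/(char_prim g) DGE.
rewrite (_ : - (_ + _) = g p)//.
have line s : is_derive s (1 : R) (fun s => g (s *: char + p)) ('D_char g (s *: char + p)).
  exact: (iffLR (is_derive_line g p char s _) (classC_is_derive _ _ g1)).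
have lc : continuous (fun s : R => 'D_char g (s *: char + p)).
  apply: (@slice_continuous _ _ (fun P : V * R => 'D_char g (P.2 *: char + P.1)) p).
  by rewrite -DGE; exact: (classC_continuous (classC_derive _ G1)).
rewrite /prim_param /= (primE _ lc line) /G /= scale0r add0r; ring.
Qed.

Lemma char_primT g x : char_prim g (T, x) = 0.
Proof. by rewrite /char_prim subrr /prim_param/= prim0 oppr0. Qed.

Variable a : V -> R.
Hypothesis a_smooth : smooth a.

Let A := char_prim (fun p => a p / 2).

Let a2_smooth : smooth (fun p => a p / 2).
Proof.
move=> k; rewrite (_ : (fun p => _) = fun p => 2^-1 * a p); first exact: classC_scale.
by apply/funext => p; rewrite mulrC.
Qed.

Let A_smooth k : classC k A. Proof. exact: char_prim_classC. Qed.

Let A_derive p : is_derive p char A (a p / 2).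
Proof. exact: char_prim_is_derive (a2_smooth 1). Qed.

Let expA_derive p : is_derive p char (fun q => expR (A q)) (expR (A p) * (a p / 2)).
Proof. exact: (@is_derive_comp1 _ V expR A _ _ _ _ (is_derive_expR (A p)) (A_derive p)). Qed.

Let expNA_derive p : is_derive p char (fun q => expR (- A q)) (- (expR (- A p) * (a p / 2))).
Proof.
have := @is_derive_comp1 _ V expR (fun q => - A q) _ _ _ _ (is_derive_expR (- A p)) (is_deriveNf (A_derive p)).
by rewrite mulrN.
Qed.

(** Integrating factor: [expR (- A)] turns the transport equation into a
   derivation along the characteristics. *)
Definition transport_sol f p : R :=
  expR (A p) * char_prim (fun q => expR (- A q) * f q) p.

Let expNAf_classC k f : classC k f -> classC k (fun q => expR (- A q) * f q).
Proof.
move=> fk; apply: classC_mul => //.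
by apply: (@classC_comp1 _ V k expR (fun q => - A q)); [exact: classC_expR|exact: classC_opp].
Qed.

Lemma transport_sol_classC k f : classC k f -> classC k (transport_sol f).
Proof.
move=> fk; apply: classC_mul; last exact/char_prim_classC/expNAf_classC.
by apply: (@classC_comp1 _ V k expR A); [exact: classC_expR|exact: A_smooth].
Qed.

Lemma transport_sol_is_derive f p : classC 1 f ->
  is_derive p char (transport_sol f) (a p / 2 * transport_sol f p + f p).
Proof.
move=> f1; have H := is_deriveMf (expA_derive p) (char_prim_is_derive p (expNAf_classC f1)).
suff -> : a p / 2 * transport_sol f p + f p = expR (A p) * (a p / 2) * char_prim (fun q => expR (- A q) * f q) p + expR (A p) * (expR (- A p) * f p) by exact: H.
by rewrite [expR _ * (expR _ * f p)]mulrA -expRD subrr expR0 mul1r /transport_sol; ring.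
Qed.

Lemma transport_solT f x : transport_sol f (T, x) = 0.
Proof. by rewrite /transport_sol char_primT mulr0. Qed.

(** Uniqueness along one characteristic. *)
Lemma transport_vanish u p : continuous u -> p.1 < T ->
  (forall s, 0 < s < T - p.1 ->
    is_derive (s *: char + p) char u (a (s *: char + p) / 2 * u (s *: char + p))) ->
  u ((T - p.1) *: char + p) = 0 -> u p = 0.
Proof.
move=> uc pT ud uT.
pose h s := expR (- A (s *: char + p)) * u (s *: char + p).
have hd s : s \in `]0, (T - p.1)[ -> is_derive s (1 : R) h 0.
  rewrite in_itv/= => sI.
  have H := is_deriveMf (expNA_derive (s *: char + p)) (ud s sI).
  apply: (iffLR (is_derive_line (fun q => expR (- A q) * u q) p char s 0)).
  suff <- : - (expR (- A (s *: char + p)) * (a (s *: char + p) / 2)) * u (s *: char + p) +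
     expR (- A (s *: char + p)) * (a (s *: char + p) / 2 * u (s *: char + p)) = 0 by exact: H.
  ring.
have hc : continuous h.
  have c0 : classC 0 (fun q => expR (- A q) * u q).
    apply: (classC_mul (k := 0)) => //.
    apply: (@classC_comp1 _ V 0 expR (fun q => - A q)); first exact: classC_expR.
    by apply: (classC_opp (k := 0)); exact: A_smooth.
  exact: (@slice_continuous _ _ (fun P : V * R => (fun q => expR (- A q) * u q) (P.2 *: char + P.1)) p (shift_classC c0)).
have T0 : 0 <= T - p.1 by rewrite subr_ge0 ltW.
have [c _] := MVT_segment T0 hd (continuous_subspaceT hc).
rewrite mul0r /h uT mulr0 sub0r scale0r add0r => /eqP.
by rewrite oppr_eq0 mulf_eq0 gt_eqF ?expR_gt0//= => /eqP.
Qed.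

Section VanishesBefore.
Variable Omega : set 'rV[R]_n.

(** Vanishing near [{T} x Omega] at earlier times; unlike vanishing at time [T]
   alone, this is inherited by all derivatives. *)
Definition vanishes_before (Z : zmodType) (u : V -> Z) := forall x, Omega x ->
  exists2 e : R, 0 < e & forall p, `|p - (T, x)| < e -> p.1 < T -> u p = 0.

Lemma vanishes_before_final u x : continuous u -> vanishes_before u -> Omega x ->
  u (T, x) = 0.
Proof.
move=> uc uZ Ox; have [e e0 H] := uZ x Ox.
apply/eqP; rewrite -normr_le0; apply/ler_addgt0Pl => d d0; rewrite addr0.
have [r r0 Hr] := continuous_ball (uc (T, x)) d0.
pose s := Num.min e r / 2.
have s0 : 0 < s by rewrite divr_gt0// lt_min e0.
have smin : s < Num.min e r by rewrite ltr_pdivrMr// ltr_pMr ?ltr1n// lt_min e0.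
have nE : `|(T - s, x) - (T, x)| = s.
  rewrite prod_norm_sub subrr normr0 addrAC subrr add0r normrN ger0_norm ?ltW//.
  by rewrite max_l// ltW.
move: smin; rewrite lt_min => /andP[se sr].
have := Hr (T - s, x); rewrite nE H ?nE//=; last by rewrite gtrBl.
by rewrite sub0r normrN => /(_ sr)/ltW.
Qed.

Lemma vanishes_before_derive u v : vanishes_before u -> vanishes_before ('D_v u).
Proof.
move=> uZ x Ox; have [e e0 H] := uZ x Ox; exists e => // p pe pT.
have near0 : \forall q \near p, (fun=> 0 : R) q = u q.
  apply/nbhs_ballP; exists (Num.min (e - `|p - (T, x)|) (T - p.1)).
    by rewrite /= lt_min !subr_gt0 pe pT.
  move=> q; rewrite -ball_normE /= lt_min => /andP[q1 q2].
  rewrite H//.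
    rewrite -[q](subrK p) -addrA; apply: le_lt_trans (ler_normD _ _) _.
    by rewrite distrC -ltrBrDr.
  have := le_lt_trans (fst_norm_le (p - q)) q2; rewrite ltr_norml => /andP[H1 _].
  by move: H1; rewrite /=; lra.
have [_ ->] := near_eq_is_derive near0 (is_derive_cst (0 : R) p v).
by [].
Qed.

(** A characteristic that starts close to [(T, x)] before time [T] stays over
   [Omega] until time [T], where [u] vanishes, and does not leave the region
   where [f] vanishes. *)
Lemma transport_vanishes_before u f : open Omega -> 0 < T -> continuous u ->
  (forall p, 0 < p.1 < T -> Omega p.2 -> is_derive p char u (a p / 2 * u p + f p)) ->
  vanishes_before f -> (forall x, Omega x -> u (T, x) = 0) -> vanishes_before u.
Proof.
move=> Oo T0 uc ud fZ uT x Ox.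
have [e e0 He] := fZ x Ox.
have /nbhs_ballP[r /= r0 Hr] : nbhs x Omega by exact: open_nbhs_nbhs.
pose m := Num.min T (Num.min e r).
have m0 : 0 < m by rewrite !lt_min T0 e0.
have w2 : 0 < `|w| + 2 by rewrite ltr_wpDl.
(* During a time [s] the characteristic moves by [s * `|w|] in space. *)
exists (m / (`|w| + 2)) => [|p]; first exact: divr_gt0.
rewrite ltr_pdivlMr// => pm pT.
set N := `|p - (T, x)| in pm.
have N0 : 0 <= N := normr_ge0 _.
have pN : N < m.
  by apply: le_lt_trans pm; rewrite ler_peMr// ler_wpDl// ler1n.
have tN : T - p.1 <= N.
  apply: le_trans (ler_norm _) _; rewrite distrC.
  exact: (fst_norm_le (p - (T, x))).
have xN : `|p.2 - x| <= N by rewrite [leRHS]prod_normE le_max lexx orbT.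
have close s : 0 <= s <= T - p.1 -> `|(s *: char + p).2 - x| < m.
  move=> /andP[s0 sT]; rewrite char_point/=.
  have -> : p.2 - s *: w - x = (p.2 - x) - s *: w by rewrite addrAC.
  apply: le_lt_trans (ler_normB _ _) _; rewrite normrZ ger0_norm//.
  have : s * `|w| <= N * `|w| by rewrite ler_wpM2r// (le_trans sT).
  by move: pm; rewrite mulrDr; lra.
have mr : m <= r by rewrite /m !ge_min lexx !orbT.
have me : m <= e by rewrite /m !ge_min lexx orbT ?orbT.
have mT : m <= T by rewrite /m ge_min lexx.
have inO s : 0 <= s <= T - p.1 -> Omega (s *: char + p).2.
  move=> /close sm; apply: Hr; rewrite -ball_normE /= distrC.
  exact: lt_le_trans sm mr.
have p0 : 0 < p.1 by lra.
apply: transport_vanish => //; last first.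
  rewrite char_point/= subrK; apply: uT.
  have := inO (T - p.1); rewrite char_point/=; apply.
  by rewrite lexx subr_ge0 ltW.
move=> s /andP[s0 sT].
have sI : 0 <= s <= T - p.1 by rewrite !ltW.
have f0 : f (s *: char + p) = 0.
  have s1 : s + p.1 < T by lra.
  apply: He; last by rewrite char_point/=.
  apply: lt_le_trans me; have := close s sI; rewrite char_point/= => H.
  rewrite prod_norm_sub gt_max H andbT ltr_norml; apply/andP; split; lra.
rewrite -[X in is_derive _ _ _ X]addr0 -f0; apply: ud.
  by rewrite char_point/=; apply/andP; split; lra.
exact: inO.
Qed.

End VanishesBefore.
End Transport.

(** * Complex-valued functions and operators *)

Section ComplexCalculus.
Context {R : realType} {V : normedModType R}.
Implicit Types (u g : V -> R[i]) (p v : V) (z x y : R[i]) (c : R).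

Lemma Re_mul x y : complex.Re (x * y) =
  complex.Re x * complex.Re y - complex.Im x * complex.Im y.
Proof. by case: x y => ? ? []. Qed.

Lemma Im_mul x y : complex.Im (x * y) =
  complex.Re x * complex.Im y + complex.Im x * complex.Re y.
Proof. by case: x y => ? ? []. Qed.

Lemma Re_add x y : complex.Re (x + y) = complex.Re x + complex.Re y.
Proof. by case: x y => ? ? []. Qed.

Lemma Im_add x y : complex.Im (x + y) = complex.Im x + complex.Im y.
Proof. by case: x y => ? ? []. Qed.

Lemma Re_opp x : complex.Re (- x) = - complex.Re x.
Proof. by case: x. Qed.

Lemma Im_opp x : complex.Im (- x) = - complex.Im x.
Proof. by case: x. Qed.

Lemma complex_eq x y : complex.Re x = complex.Re y ->
  complex.Im x = complex.Im y -> x = y.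
Proof. by case: x y => ? ? [? ?] /= -> ->. Qed.

Lemma classCC_add k u g : classCC k u -> classCC k g ->
  classCC k (fun p => u p + g p).
Proof.
move=> [ur ui] [gr gi]; split.
  by under eq_fun do rewrite Re_add; exact: classC_add.
by under eq_fun do rewrite Im_add; exact: classC_add.
Qed.

Lemma classCC_mul k u g : classCC k u -> classCC k g ->
  classCC k (fun p => u p * g p).
Proof.
move=> [ur ui] [gr gi]; split.
  by under eq_fun do rewrite Re_mul; apply: classC_sub; exact: classC_mul.
by under eq_fun do rewrite Im_mul; apply: classC_add; exact: classC_mul.
Qed.

Lemma classCC_cst k z : classCC k (fun _ : V => z).
Proof. by split; exact: classC_cst. Qed.

Lemma classCC_scale k z u : classCC k u -> classCC k (fun p => z * u p).
Proof. by apply: classCC_mul; exact: classCC_cst. Qed.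

Lemma classCC_sum k (I : Type) (r : seq I) (F : I -> V -> R[i]) :
  (forall i, classCC k (F i)) -> classCC k (fun p => \sum_(i <- r) F i p).
Proof.
move=> Fk; elim: r => [|i r IH].
  by under eq_fun do rewrite big_nil; exact: classCC_cst.
by under eq_fun do rewrite big_cons; exact: classCC_add.
Qed.

Lemma classCC_le k m u : (k <= m)%N -> classCC m u -> classCC k u.
Proof. by move=> km [ur ui]; split; exact: (classC_le km). Qed.

Lemma classCC_derive k u v : classCC k.+1 u -> classCC k (deriveC v u).
Proof. by move=> [ur ui]; split; exact: classC_derive. Qed.

Lemma deriveC_add u g p v : classCC 1 u -> classCC 1 g ->
  deriveC v (fun q => u q + g q) p = deriveC v u p + deriveC v g p.
Proof.
move=> [ur ui] [gr gi]; rewrite /deriveC.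
have -> : (fun q => complex.Re (u q + g q)) =
    fun q => complex.Re (u q) + complex.Re (g q).
  by apply/funext => q; rewrite Re_add.
have -> : (fun q => complex.Im (u q + g q)) =
    fun q => complex.Im (u q) + complex.Im (g q).
  by apply/funext => q; rewrite Im_add.
have [_ ->] := is_deriveDf (classC_is_derive p v ur) (classC_is_derive p v gr).
by have [_ ->] := is_deriveDf (classC_is_derive p v ui) (classC_is_derive p v gi).
Qed.

Lemma deriveC_mul u g p v : classCC 1 u -> classCC 1 g ->
  deriveC v (fun q => u q * g q) p = deriveC v u p * g p + u p * deriveC v g p.
Proof.
move=> [ur ui] [gr gi]; rewrite /deriveC.
have -> : (fun q => complex.Re (u q * g q)) =
    fun q => complex.Re (u q) * complex.Re (g q) - complex.Im (u q) * complex.Im (g q).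
  by apply/funext => q; rewrite Re_mul.
have -> : (fun q => complex.Im (u q * g q)) =
    fun q => complex.Re (u q) * complex.Im (g q) + complex.Im (u q) * complex.Re (g q).
  by apply/funext => q; rewrite Im_mul.
have Dur := classC_is_derive p v ur; have Dui := classC_is_derive p v ui.
have Dgr := classC_is_derive p v gr; have Dgi := classC_is_derive p v gi.
have [_ ->] := is_deriveDf (is_deriveMf Dur Dgr) (is_deriveNf (is_deriveMf Dui Dgi)).
have [_ ->] := is_deriveDf (is_deriveMf Dur Dgi) (is_deriveMf Dui Dgr).
by apply: complex_eq; rewrite ?(Re_add, Im_add) ?(Re_mul, Im_mul)/=; ring.
Qed.

Lemma deriveC_cst z p v : deriveC v (fun _ : V => z) p = 0.
Proof. by rewrite /deriveC !derive_cst. Qed.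

Lemma deriveC_scale z u p v : classCC 1 u ->
  deriveC v (fun q => z * u q) p = z * deriveC v u p.
Proof.
by move=> u1; rewrite deriveC_mul ?deriveC_cst ?mul0r ?add0r//; exact: classCC_cst.
Qed.

End ComplexCalculus.

Section WaveOperator.
Context {R : realType} {n : nat}.
Local Notation V := (R * 'rV[R]_n)%type.
Implicit Types (u g : V -> R[i]) (p v : V) (z : R[i]) (r : V -> R).
Variables a b : 'rV[R]_n -> R.

Definition real_wave r p : R :=
  real_box r p - a p.2 * 'D_((1, 0) : V) r p + b p.2 * r p.

Lemma Re_sum (I : Type) (s : seq I) (F : I -> R[i]) :
  complex.Re (\sum_(i <- s) F i) = \sum_(i <- s) complex.Re (F i).
Proof. by elim: s => [|i s IH]; rewrite ?big_nil// !big_cons Re_add IH. Qed.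

Lemma Im_sum (I : Type) (s : seq I) (F : I -> R[i]) :
  complex.Im (\sum_(i <- s) F i) = \sum_(i <- s) complex.Im (F i).
Proof. by elim: s => [|i s IH]; rewrite ?big_nil// !big_cons Im_add IH. Qed.

Lemma wave_opE u p : wave_op a b u p =
  real_wave (fun q => complex.Re (u q)) p +i*
  real_wave (fun q => complex.Im (u q)) p.
Proof.
by apply: complex_eq; rewrite /wave_op /box !(Re_add, Im_add) !(Re_opp, Im_opp) !(Re_mul, Im_mul)/=
  ?(Re_sum, Im_sum)/= /real_wave /real_box; ring.
Qed.

Lemma transport_opE w u p : classCC 1 u -> transport_op w a u p =
  ('D_(char w) (fun q => complex.Re (u q)) p - a p.2 / 2 * complex.Re (u p)) +i*
  ('D_(char w) (fun q => complex.Im (u q)) p - a p.2 / 2 * complex.Im (u p)).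
Proof.
move=> [ur ui]; rewrite !derive_char//.
have H (f : 'I_n -> R[i]) (c : 'I_n -> R) : \sum_(i < n) (c i)%:C * f i =
   (\sum_(i < n) c i * complex.Re (f i)) +i* (\sum_(i < n) c i * complex.Im (f i)).
  apply: complex_eq; rewrite ?(Re_sum, Im_sum)/=; apply: eq_bigr => i _; rewrite ?(Re_mul, Im_mul)/=; ring.
by rewrite /transport_op H; apply: complex_eq; rewrite !(Re_add, Im_add) !(Re_opp, Im_opp) ?(Re_mul, Im_mul)/=; ring.
Qed.

Lemma real_wave_smooth r : smooth (fun p : V => a p.2) -> smooth (fun p : V => b p.2) ->
  smooth r -> smooth (real_wave r).
Proof.
move=> as_ bs rs k.
have D (f : V -> R) v : smooth f -> smooth ('D_v f) by move=> H m; exact: (classC_derive v (H m.+1)).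
apply: (@classC_add _ V k (fun p => real_box r p - a p.2 * 'D_((1, 0) : V) r p) (fun p => b p.2 * r p)).
  apply: (@classC_sub _ V k (fun p => real_box r p) (fun p => a p.2 * 'D_((1, 0) : V) r p)).
    apply: (@classC_sub _ V k (fun p => 'D_((1, 0) : V) ('D_((1, 0) : V) r) p)).
      exact: (D _ _ (D _ _ rs)).
    by apply: classC_sum => i _; exact: (D _ _ (D _ _ rs)).
  by apply: classC_mul => //; exact: (D _ _ rs).
exact: classC_mul.
Qed.

Lemma wave_op_smooth u : smooth (fun p : V => a p.2) -> smooth (fun p : V => b p.2) ->
  smoothC u -> smoothC (wave_op a b u).
Proof.
move=> as_ bs us k.
have ur : smooth (fun p => complex.Re (u p)) by move=> m; exact: (us m).1.
have ui : smooth (fun p => complex.Im (u p)) by move=> m; exact: (us m).2.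
split.
  by under eq_fun do rewrite wave_opE; exact: real_wave_smooth.
by under eq_fun do rewrite wave_opE; exact: real_wave_smooth.
Qed.

Lemma deriveC2_add u g p v : classCC 2 u -> classCC 2 g ->
  deriveC v (deriveC v (fun q => u q + g q)) p =
  deriveC v (deriveC v u) p + deriveC v (deriveC v g) p.
Proof.
move=> u2 g2; rewrite -deriveC_add; [|exact: classCC_derive..].
congr (deriveC v _ p); apply/funext => q.
by rewrite deriveC_add//; exact: (@classCC_le _ _ 1 2).
Qed.

Lemma deriveC2_scale z u p v : classCC 2 u ->
  deriveC v (deriveC v (fun q => z * u q)) p = z * deriveC v (deriveC v u) p.
Proof.
move=> u2; rewrite -deriveC_scale; last exact: classCC_derive.
congr (deriveC v _ p); apply/funext => q.
by rewrite deriveC_scale//; exact: (@classCC_le _ _ 1 2).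
Qed.

Lemma wave_op_add u g p : classCC 2 u -> classCC 2 g ->
  wave_op a b (fun q => u q + g q) p = wave_op a b u p + wave_op a b g p.
Proof.
move=> u2 g2; have u1 := @classCC_le _ _ 1 2 _ isT u2; have g1 := @classCC_le _ _ 1 2 _ isT g2.
have E1 : dt (fun q => u q + g q) p = dt u p + dt g p := deriveC_add p _ u1 g1.
have E2 : dt (dt (fun q => u q + g q)) p = dt (dt u) p + dt (dt g) p :=
  deriveC2_add p _ u2 g2.
have E3 : \sum_(i < n) dx i (dx i (fun q => u q + g q)) p =
   \sum_(i < n) dx i (dx i u) p + \sum_(i < n) dx i (dx i g) p.
  by rewrite -big_split/=; apply: eq_bigr => i _; exact: (deriveC2_add p _ u2 g2).
have alg (x1 x2 x3 x4 x5 x6 y1 y2 y3 : R[i]) : y1 = x1 + x2 -> y2 = x3 + x4 ->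
    y3 = x5 + x6 -> y2 - y3 - (a p.2)%:C * y1 + (b p.2)%:C * (u p + g p) =
    x3 - x5 - (a p.2)%:C * x1 + (b p.2)%:C * u p +
    (x4 - x6 - (a p.2)%:C * x2 + (b p.2)%:C * g p).
  by move=> -> -> ->; ring.
exact: (alg _ _ _ _ _ _ _ _ _ E1 E2 E3).
Qed.

Lemma wave_op_scale z u p : classCC 2 u ->
  wave_op a b (fun q => z * u q) p = z * wave_op a b u p.
Proof.
move=> u2; have u1 := @classCC_le _ _ 1 2 _ isT u2.
have E1 : dt (fun q => z * u q) p = z * dt u p := deriveC_scale z p _ u1.
have E2 : dt (dt (fun q => z * u q)) p = z * dt (dt u) p := deriveC2_scale z p _ u2.
have E3 : \sum_(i < n) dx i (dx i (fun q => z * u q)) p =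
   z * \sum_(i < n) dx i (dx i u) p.
  by rewrite mulr_sumr; apply: eq_bigr => i _; exact: (deriveC2_scale z p _ u2).
have alg (x1 x2 x3 y1 y2 y3 : R[i]) : y1 = z * x1 -> y2 = z * x2 -> y3 = z * x3 ->
    y2 - y3 - (a p.2)%:C * y1 + (b p.2)%:C * (z * u p) =
    z * (x2 - x3 - (a p.2)%:C * x1 + (b p.2)%:C * u p).
  by move=> -> -> ->; ring.
exact: (alg _ _ _ _ _ _ E1 E2 E3).
Qed.

End WaveOperator.

(** * Conjugation by a plane wave *)

Section PlaneWave.
Context {R : realType} {n : nat}.
Local Notation V := (R * 'rV[R]_n)%type.
Implicit Types (u g : V -> R[i]) (p v : V) (z : R[i]).
Variables (w : 'rV[R]_n) (s : R).

Definition plane_wave p : R[i] := expi (- (s * (p.1 + dotv p.2 w))).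

(** The phase is linear: it is its own derivative. *)
Definition phase_speed v : R := - (s * (v.1 + dotv v.2 w)).

Lemma phase_affine (h : R) (q u : V) :
  phase_speed (h *: u + q) = h * phase_speed u + phase_speed q.
Proof.
by rewrite /phase_speed/= dotvDl dotvZl /GRing.scale/=; ring.
Qed.

Lemma phase_classC k : classC k phase_speed.
Proof.
apply: classC_opp; apply: classC_scale; apply: (@classC_add _ V k (fun p => p.1)).
  apply: (@classC_affine _ V k (fun p => p.1) (fun p => p.1)) => [p|//].
  exact: cvg_fst.
under eq_fun do rewrite dotvC.
exact: dotv_classC.
Qed.

Lemma plane_wave_classCC k : classCC k plane_wave.
Proof.
split; apply: (@classC_comp1 _ V k _ phase_speed); rewrite ?(classC_cos, classC_sin)//.
- exact: classC_cos.
- exact: phase_classC.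
- exact: classC_sin.
- exact: phase_classC.
Qed.

Lemma plane_wave_derive v p :
  deriveC v plane_wave p = (0 +i* phase_speed v) * plane_wave p.
Proof.
have H : is_derive p v phase_speed (phase_speed v).
  by apply: is_derive_affine; exact: phase_affine.
rewrite /deriveC.
have [_ ->] : is_derive p v (fun q => complex.Re (plane_wave q)) (- sin (phase_speed p) * phase_speed v).
  exact: (@is_derive_comp1 _ V cos phase_speed _ _ _ _ (is_derive_cos _) H).
have [_ ->] : is_derive p v (fun q => complex.Im (plane_wave q)) (cos (phase_speed p) * phase_speed v).
  exact: (@is_derive_comp1 _ V sin phase_speed _ _ _ _ (is_derive_sin _) H).
by apply: complex_eq; rewrite ?(Re_mul, Im_mul)/= -/(phase_speed p); ring.
Qed.

Lemma plane_wave_conj v u : classCC 1 u ->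
  deriveC v (fun p => plane_wave p * u p) =
  fun p => plane_wave p * ((0 +i* phase_speed v) * u p + deriveC v u p).
Proof.
move=> u1; apply/funext => p; rewrite deriveC_mul//; last exact: plane_wave_classCC.
by rewrite plane_wave_derive; move: (deriveC v u p) => x; ring.
Qed.

Lemma plane_wave_conj2 v u p : classCC 2 u ->
  deriveC v (deriveC v (fun p => plane_wave p * u p)) p =
  plane_wave p * ((0 +i* phase_speed v) ^+ 2 * u p +
    2 * (0 +i* phase_speed v) * deriveC v u p + deriveC v (deriveC v u) p).
Proof.
move=> u2; have u1 := @classCC_le _ _ 1 2 _ isT u2.
have d1 : classCC 1 (deriveC v u) by exact: classCC_derive.
rewrite plane_wave_conj// plane_wave_conj; last first.
  by apply: classCC_add => //; exact: classCC_scale.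
rewrite deriveC_add ?deriveC_scale//; last exact: classCC_scale.
move: (deriveC v (deriveC v u) p) (deriveC v u p) => x y; ring.
Qed.

Lemma phase_speed_time : phase_speed (1, 0) = - s.
Proof. by rewrite /phase_speed/= dotv0l addr0 mulr1. Qed.

Lemma phase_speed_dir i : phase_speed (dir i) = - (s * w 0 i).
Proof.
rewrite /phase_speed/= add0r; congr (- (s * _)).
rewrite /dotv (bigD1 i)//= big1 => [|j ji]; rewrite mxE eqxx/= ?eqxx ?mul1r ?addr0//.
by rewrite (negPf ji) mul0r.
Qed.

Variables a b : 'rV[R]_n -> R.
Hypothesis w_unit : unit_vector w.

(** The eikonal equation: as [w] is a unit vector, the squares of the phase speeds
   cancel in [box], and the terms of first order form the transport operator. *)
Lemma wave_op_plane_wave u p : classCC 2 u ->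
  wave_op a b (fun q => plane_wave q * u q) p =
  plane_wave p * (wave_op a b u p - (0 +i* (2 * s)) * transport_op w a u p).
Proof.
move=> u2; have u1 := @classCC_le _ _ 1 2 _ isT u2.
have E1 : dt (fun q => plane_wave q * u q) p = plane_wave p * ((0 +i* - s) * u p + dt u p).
  by rewrite /dt plane_wave_conj// phase_speed_time.
have E2 : dt (dt (fun q => plane_wave q * u q)) p =
    plane_wave p * ((0 +i* - s) ^+ 2 * u p + 2 * (0 +i* - s) * dt u p + dt (dt u) p).
  by rewrite /dt plane_wave_conj2// phase_speed_time.
have E3 : \sum_(i < n) dx i (dx i (fun q => plane_wave q * u q)) p =
    plane_wave p * ((0 +i* - s) ^+ 2 * u p +
      2 * (0 +i* - s) * (\sum_(i < n) (w 0 i)%:C * dx i u p) +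
      \sum_(i < n) dx i (dx i u) p).
  have S : \sum_(i < n) ((w 0 i)%:C ^+ 2 : R[i]) = 1.
    rewrite -[RHS](congr1 (fun x => x%:C) w_unit) /dotv rmorph_sum.
    by apply: eq_bigr => i _; rewrite rmorphM.
  have -> : (0 +i* - s) ^+ 2 * u p = \sum_(i < n) (w 0 i)%:C ^+ 2 * ((0 +i* - s) ^+ 2 * u p).
    by rewrite -mulr_suml S mul1r.
  rewrite !mulr_sumr -!big_split/= mulr_sumr.
  apply: eq_bigr => i _; apply: etrans (plane_wave_conj2 (dir i) p u2) _; rewrite phase_speed_dir.
  have -> : (0 +i* - (s * w 0 i)) = (0 +i* - s) * (w 0 i)%:C.
    by apply: complex_eq; rewrite ?(Re_mul, Im_mul)/=; ring.
  rewrite -/(dx i u) -/(dx i (dx i u) p); move: (dx i (dx i u) p) (dx i u p) => x y; ring.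
have alg (x1 x2 x3 x4 y1 y2 y3 k e c B v A : R[i]) : k = - 2 * c -> A = 2 * B -> y1 = e * (c * v + x1) ->
    y2 = e * (c ^+ 2 * v + 2 * c * x1 + x2) -> y3 = e * (c ^+ 2 * v + 2 * c * x3 + x4) ->
    y2 - y3 - A * y1 + (b p.2)%:C * (e * v) =
    e * (x2 - x4 - A * x1 + (b p.2)%:C * v - k * (x1 - x3 - B * v)).
  by move=> -> -> -> -> ->; ring.
apply: (alg _ _ _ _ _ _ _ _ _ _ _ _ _ _ _ E1 E2 E3).
  by apply: complex_eq; rewrite ?(Re_mul, Im_mul)/=; ring.
by apply: complex_eq; rewrite ?(Re_mul, Im_mul)/=; field.
Qed.
End PlaneWave.

(** * The amplitudes *)

Section VanishingComplex.
Context {R : realType} {n : nat}.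
Local Notation V := (R * 'rV[R]_n)%type.
Variables (T : R) (Omega : set 'rV[R]_n).
Implicit Types (u f g : V -> R[i]) (p v : V) (z : R[i]).

Lemma vanishes_before_split u : vanishes_before T Omega u <->
  vanishes_before T Omega (fun p => complex.Re (u p)) /\
  vanishes_before T Omega (fun p => complex.Im (u p)).
Proof.
split=> [uZ|[rZ iZ] x Ox].
  by split=> x Ox; have [e e0 H] := uZ x Ox; exists e => // p pe pT; rewrite H.
have [d d0 Hd] := rZ x Ox; have [e e0 He] := iZ x Ox.
exists (Num.min d e) => [|p]; first by rewrite lt_min d0.
rewrite lt_min => /andP[pd pe] pT; apply: complex_eq; first exact: Hd.
exact: He.
Qed.

Lemma vanishes_before_deriveC u v : vanishes_before T Omega u ->
  vanishes_before T Omega (deriveC v u).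
Proof.
move=> /vanishes_before_split[uZ iZ]; apply/vanishes_before_split; split.
  exact: (vanishes_before_derive v uZ).
exact: (vanishes_before_derive v iZ).
Qed.

Lemma vanishes_before_add u f : vanishes_before T Omega u ->
  vanishes_before T Omega f -> vanishes_before T Omega (fun p => u p + f p).
Proof.
move=> uZ fZ x Ox; have [d d0 Hd] := uZ x Ox; have [e e0 He] := fZ x Ox.
exists (Num.min d e) => [|p]; first by rewrite lt_min d0.
by rewrite lt_min => /andP[pd pe] pT; rewrite Hd// He// addr0.
Qed.

Lemma vanishes_before_mul g u : vanishes_before T Omega u ->
  vanishes_before T Omega (fun p => g p * u p).
Proof.
move=> uZ x Ox; have [d d0 Hd] := uZ x Ox.
by exists d => // p pd pT; rewrite Hd// mulr0.
Qed.

Lemma vanishes_before_sum (I : Type) (r : seq I) (F : I -> V -> R[i]) :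
  (forall i, vanishes_before T Omega (F i)) ->
  vanishes_before T Omega (fun p => \sum_(i <- r) F i p).
Proof.
move=> FZ; elim: r => [|i r IH].
  by move=> x _; exists 1 => // p _ _; rewrite big_nil.
by under eq_fun do rewrite big_cons; exact: vanishes_before_add.
Qed.

Lemma vanishes_before_wave_op a b u : vanishes_before T Omega u ->
  vanishes_before T Omega (wave_op a b u).
Proof.
move=> uZ; have D v f : vanishes_before T Omega f -> vanishes_before T Omega (deriveC v f).
  exact: vanishes_before_deriveC.
have N f : vanishes_before T Omega f -> vanishes_before T Omega (fun p => - f p).
  move=> fZ; under eq_fun do rewrite -mulN1r; exact: vanishes_before_mul.
apply: (vanishes_before_add (u := fun p => Defs.box u p - (a p.2)%:C * dt u p)
  (f := fun p => (b p.2)%:C * u p)); last exact: vanishes_before_mul.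
apply: (vanishes_before_add (u := Defs.box u)); last first.
  apply: N; apply: vanishes_before_mul; exact: D.
apply: (vanishes_before_add (u := dt (dt u))); first exact/D/D.
apply: N; apply: vanishes_before_sum => i; exact/D/D.
Qed.

Lemma vanishes_before_final_data u : classCC 1 u -> vanishes_before T Omega u ->
  zero_final_data T Omega u.
Proof.
move=> [ur ui] uZ x Ox.
have [rZ iZ] := iffLR (vanishes_before_split u) uZ.
split; apply: complex_eq.
- exact: (vanishes_before_final (classC_continuous ur) rZ Ox).
- exact: (vanishes_before_final (classC_continuous ui) iZ Ox).
- exact: (vanishes_before_final (classC_continuous (classC_derive _ ur)) (vanishes_before_derive _ rZ) Ox).
- exact: (vanishes_before_final (classC_continuous (classC_derive _ ui)) (vanishes_before_derive _ iZ) Ox).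
Qed.

End VanishingComplex.

Section Amplitudes.
Context {R : realType} {n : nat}.
Local Notation V := (R * 'rV[R]_n)%type.
Implicit Types (u f g : V -> R[i]) (p v : V) (z : R[i]).
Variables (T : R) (w : 'rV[R]_n) (a b : 'rV[R]_n -> R) (Omega : set 'rV[R]_n).
Hypotheses (a_smooth : smooth (fun p : V => a p.2)) (b_smooth : smooth (fun p : V => b p.2)).

Definition transport_solC f p : R[i] :=
  transport_sol T w (fun q => a q.2) (fun q => complex.Re (f q)) p +i*
  transport_sol T w (fun q => a q.2) (fun q => complex.Im (f q)) p.

Lemma transport_solC_smooth f : smoothC f -> smoothC (transport_solC f).
Proof. by move=> fs k; split; apply: (transport_sol_classC _ _ a_smooth); have [] := fs k. Qed.

Lemma transport_solC_eq f p : smoothC f -> transport_op w a (transport_solC f) p = f p.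
Proof.
move=> fs; rewrite transport_opE; last exact: transport_solC_smooth.
have [_ Er] := transport_sol_is_derive T w a_smooth p (fs 1).1.
have [_ Ei] := transport_sol_is_derive T w a_smooth p (fs 1).2.
by apply: complex_eq; rewrite /= (Er, Ei) addrAC subrr add0r.
Qed.

Lemma transport_solC_T f x : transport_solC f (T, x) = 0.
Proof. by rewrite /transport_solC !transport_solT. Qed.

Hypotheses (Omega_open : open Omega) (T_gt0 : 0 < T).

(** Only the equation on the cylinder is used, so that this applies to an
   arbitrary principal amplitude. *)
Lemma transport_vanishes_beforeC c f u : c != 0 -> smoothC u ->
  (forall p, cylinder T Omega p -> c * transport_op w a u p = f p) ->
  vanishes_before T Omega f -> (forall x, Omega x -> u (T, x) = 0) ->
  vanishes_before T Omega u.
Proof.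
move=> c0 us uE fZ uT; have [ur ui] := us 1.
have uE' p : 0 < p.1 < T -> Omega p.2 -> transport_op w a u p = c^-1 * f p.
  by move=> pT pO; rewrite -uE// mulKf.
have /vanishes_before_split[grZ giZ] : vanishes_before T Omega (fun p => c^-1 * f p).
  exact: vanishes_before_mul.
apply/vanishes_before_split; split.
- apply: (transport_vanishes_before a_smooth Omega_open T_gt0 (classC_continuous ur) _ grZ).
    move=> p pT pO; rewrite -(uE' _ pT pO) (transport_opE _ _ _ (us 1))/= addrC subrK.
    exact: (classC_is_derive p _ ur).
  by move=> x Ox; rewrite uT.
- apply: (transport_vanishes_before a_smooth Omega_open T_gt0 (classC_continuous ui) _ giZ).
    move=> p pT pO; rewrite -(uE' _ pT pO) (transport_opE _ _ _ (us 1))/= addrC subrK.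
    exact: (classC_is_derive p _ ui).
  by move=> x Ox; rewrite uT.
Qed.

Variables (c : R[i]) (beta0 : V -> R[i]).
Hypothesis c0 : c != 0.
Hypothesis beta0_sol : transport_solution T Omega w a 1 (fun=> 0) beta0.

Fixpoint amplitude (j : nat) : V -> R[i] :=
  if j is j'.+1 then transport_solC (fun p => c^-1 * wave_op a b (amplitude j') p)
  else beta0.

Let source_smooth u : smoothC u -> smoothC (fun p => c^-1 * wave_op a b u p).
Proof. by move=> us k; apply: classCC_scale; exact: wave_op_smooth. Qed.

Lemma amplitude_smooth j : smoothC (amplitude j).
Proof.
elim: j => [|j IH]; first by have [] := beta0_sol.
exact/transport_solC_smooth/source_smooth.
Qed.

Lemma amplitude_transport j p :
  c * transport_op w a (amplitude j.+1) p = wave_op a b (amplitude j) p.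
Proof.
rewrite transport_solC_eq; last exact/source_smooth/amplitude_smooth.
by rewrite mulrA divff// mul1r.
Qed.

Lemma amplitude_vanishes j : vanishes_before T Omega (amplitude j).
Proof.
elim: j => [|j IH].
  have [us uE uT] := beta0_sol.
  apply: (transport_vanishes_beforeC (oner_neq0 _) us uE).
    by move=> x _; exists 1.
  by move=> x Ox; have [] := uT x Ox.
apply: (transport_vanishes_beforeC c0 (amplitude_smooth j.+1)).
- by move=> p _; exact: amplitude_transport.
- exact: vanishes_before_wave_op.
- by move=> x _; exact: transport_solC_T.
Qed.

End Amplitudes.

(** * The correction of an oscillating source *)

Section Modulus.
Context {R : realType}.
Implicit Types (z y : R[i]) (c : R).

Definition modulus z : R := complex.Re `|z|.

Lemma modulusE z : `|z| = (modulus z)%:C.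
Proof. by rewrite /modulus normc_def. Qed.

Lemma modulus_ge0 z : 0 <= modulus z.
Proof. by rewrite -ler0c -modulusE. Qed.

Lemma modulusD z y : modulus (z + y) <= modulus z + modulus y.
Proof. by rewrite -lecR rmorphD/= -!modulusE ler_normD. Qed.

Lemma modulusM z y : modulus (z * y) = modulus z * modulus y.
Proof. by apply: complexI; rewrite rmorphM/= -!modulusE normrM. Qed.

Lemma modulus_real c : modulus c%:C = `|c|.
Proof. by rewrite /modulus normc_def/= expr0n addr0 sqrtr_sqr. Qed.

Lemma modulus_le z : modulus z <= `|complex.Re z| + `|complex.Im z|.
Proof.
rewrite /modulus normc_def/=.
have H : 0 <= `|complex.Re z| + `|complex.Im z| by rewrite addr_ge0.
rewrite -[leRHS]ger0_norm// -sqrtr_sqr ler_sqrt ?sqr_ge0//.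
rewrite sqrrD !real_normK ?num_real// addrAC lerDl.
by rewrite mulrn_wge0// mulr_ge0.
Qed.

Lemma modulus_expi c : modulus (expi c) = 1.
Proof. by rewrite /modulus normc_def/= cos2Dsin2 sqrtr1. Qed.

Lemma modulus_sum (I : Type) (r : seq I) (F : I -> R[i]) :
  modulus (\sum_(i <- r) F i) <= \sum_(i <- r) modulus (F i).
Proof.
elim: r => [|i r IH]; first by rewrite !big_nil /modulus normr0.
by rewrite !big_cons (le_trans (modulusD _ _))// lerD2l.
Qed.

End Modulus.

Section Oscillation.
Context {R : realType} {n : nat}.
Local Notation V := (R * 'rV[R]_n)%type.
Implicit Types (p : V) (F : V -> R) (D : set V).

(** The addition formula separates time from space. *)
Lemma wiener_mul_wave D F (K s phi : R) (eta : 'rV[R]_n) : wiener D (fun=> 1) F K ->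
  wiener D (fun=> 1) (fun p => cos (s * p.1 + dotv eta p.2 + phi) * F p)
    (2 * (K * weight eta)).
Proof.
move=> FK; have p1 (t : R) : 0 <= (fun=> 1 : R) t by [].
have sc : continuous (fun x : R => s * x).
  exact: mulrl_continuous.
have c1 : continuous (fun t : R => cos (s * t)).
  by move=> t; apply: (continuous_comp (sc t)); exact: continuous_cos.
have c2 : continuous (fun t : R => - sin (s * t)).
  move=> t; apply: (@continuousN _ _ _ (fun t => sin (s * t))).
  by apply: (continuous_comp (sc t)); exact: continuous_sin.
have b1 (t : R) : `|cos (s * t)| * 1 <= 1 * 1.
  by rewrite !mulr1 ler_norml cos_geN1 cos_le1.
have b2 (t : R) : `|- sin (s * t)| * 1 <= 1 * 1.
  by rewrite !mulr1 normrN ler_norml sin_geN1 sin_le1.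
have W1 := wiener_mul_time c1 ler01 b1 (wiener_mul_cos eta phi p1 FK).
have W2 := wiener_mul_time c2 ler01 b2 (wiener_mul_cos eta (phi - pi / 2) p1 FK).
have := wiener_add p1 W1 W2; rewrite -mulrDl -[1 + 1]/(2%:R).
apply: wiener_ext => p _; rewrite -!addrA [cos (s * p.1 + _)]cosD.
rewrite [dotv eta p.2 + (phi - _)]addrA -sin_cosD; ring.
Qed.

Lemma weight_scale (s : R) (w : 'rV[R]_n) : 1 <= s ->
  weight (s *: w) <= s ^+ 2 * weight w.
Proof.
move=> s1; have s0 : 0 <= s := le_trans ler01 s1.
have -> : weight (s *: w) = (1 + s * l1 w) ^+ 2.
  rewrite /weight /l1 mulr_sumr; congr ((1 + _) ^+ 2).
  by apply: eq_bigr => i _; rewrite mxE normrM ger0_norm.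
rewrite -exprMn; apply: lerXn2r; rewrite ?nnegrE ?mulr_ge0 ?addr_ge0 ?mulr_ge0 ?l1_ge0//.
by rewrite mulrDr mulr1 lerD2r.
Qed.

Lemma growth_le (T mu t : R) : 0 <= mu -> 0 < t < T -> growth T mu t <= 2 * expR (mu * T).
Proof.
move=> mu0 /andP[t0 tT]; rewrite /growth mulrDl mul1r; apply: lerD; rewrite ler_expR ler_wpM2l//; lra.
Qed.

Variables (T : R) (w : 'rV[R]_n) (a b : 'rV[R]_n -> R) (B : R).
Hypotheses (a_smooth : smooth (fun p : V => a p.2)) (b_smooth : smooth (fun p : V => b p.2)).
Hypothesis B0 : 0 <= B.

(** The constant is uniform in the frequency [s], which enters through the weight
   only: the solution operator does not depend on it. *)
Lemma oscillating_correction (W : V -> R[i]) : smoothC W ->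
  exists2 C : R, 0 <= C & forall s k : R, exists r : V -> R[i], [/\ classCC 2 r,
    forall p, cube B p -> wave_op a b r p = k%:C * (plane_wave w s p * W p),
    forall x, r (T, x) = 0 /\ dt r (T, x) = 0 &
    forall p, 0 < p.1 < T -> modulus (r p) <= C * (`|k| * weight (s *: w))].
Proof.
move=> Ws; have [Ga aG] := smooth_wiener a_smooth B0.
have [Gb bG] : exists G, wiener (cube B) (fun=> 1) (fun p : V => 1 - b p.2) G.
  apply: smooth_wiener => // m; apply: (@classC_sub _ V m (fun=> 1)) => //.
  exact: classC_cst.
have [mu mu1 solve] := wave_solvable T aG bG.
have [K1 W1] := smooth_wiener (fun m => (Ws m).1) B0.
have [K2 W2] := smooth_wiener (fun m => (Ws m).2) B0.
have K10 := wiener_ge0 W1; have K20 := wiener_ge0 W2.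
exists (16 * (K1 + K2) * expR (mu * T)) => [|s k].
  by rewrite !mulr_ge0 ?expR_ge0 ?addr_ge0.
pose eta := s *: w; pose th p : R := s * p.1 + dotv eta p.2.
have p1 (t : R) : 0 <= (fun=> 1 : R) t by [].
have waveE p : plane_wave w s p = cos (th p + 0) +i* - cos (th p - pi / 2).
  rewrite /plane_wave /expi cosN sinN mulrDr dotvC -dotvZl addr0 -sin_cosD.
  by [].
have M (phi : R) F K : wiener (cube B) (fun=> 1) F K ->
    wiener (cube B) (fun=> 1) (fun p => cos (th p + phi) * F p) (2 * (K * weight eta)).
  exact: wiener_mul_wave.
pose Kt := `|k| * (2 * (K1 * weight eta) + 2 * (K2 * weight eta)).
have Fr : wiener (cube B) (growth T mu)
    (fun p => k * (complex.Re (plane_wave w s p * W p))) Kt.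
  apply: (wiener_growth T mu1); have := wiener_scale k p1 (wiener_add p1 (M 0 _ _ W1) (M (- (pi / 2)) _ _ W2)).
  by apply: wiener_ext => p _; rewrite Re_mul waveE/=; ring.
have Fi : wiener (cube B) (growth T mu)
    (fun p => k * (complex.Im (plane_wave w s p * W p))) Kt.
  apply: (wiener_growth T mu1); have := wiener_scale k p1 (wiener_add p1 (wiener_scale (-1) p1 (M (- (pi / 2)) _ _ W1)) (M 0 _ _ W2)).
  rewrite normrN1 mul1r.
  by apply: wiener_ext => p _; rewrite Im_mul waveE/=; ring.
have [r1 [r1c r1E r1T r1B]] := solve _ _ Fr.
have [r2 [r2c r2E r2T r2B]] := solve _ _ Fi.
exists (fun p => r1 p +i* r2 p); split=> [|p pB|x|p pT].
- exact: (conj r1c r2c).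
- rewrite wave_opE; apply: complex_eq.
    by rewrite Re_mul/= mul0r subr0; exact: (r1E p pB).
  by rewrite Im_mul/= mul0r addr0; exact: (r2E p pB).
- have [E1 E2] := r1T x; have [E3 E4] := r2T x.
  by split; apply: complex_eq; [exact: E1|exact: E3|exact: E2|exact: E4].
- apply: le_trans (modulus_le _) _ => /=.
  have g := growth_le (le_trans ler01 mu1) pT.
  have w0 := weight_ge0 eta.
  have Kt0 : 0 <= 2 * Kt.
    by apply: mulr_ge0 => //; apply: mulr_ge0 => //; apply: addr_ge0;
      apply: mulr_ge0 => //; exact: mulr_ge0.
  have H1 := le_trans (r1B p) (ler_wpM2l Kt0 g).
  have H2 := le_trans (r2B p) (ler_wpM2l Kt0 g).
  apply: le_trans (lerD H1 H2) _.
  rewrite le_eqVlt; apply/orP; left; apply/eqP; rewrite /Kt -/eta.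
  move: (weight eta) (expR _) (`|k|) => x y z; ring.
Qed.

End Oscillation.

(** * The asymptotic expansion *)

Section Expansion.
Context {R : realType} {n : nat}.
Local Notation V := (R * 'rV[R]_n)%type.
Implicit Types (p : V).
Variables (w : 'rV[R]_n) (a b : 'rV[R]_n -> R) (beta : nat -> V -> R[i]).
Hypotheses (w_unit : unit_vector w) (beta_smooth : forall j, smoothC (beta j)).
Variables (s tau : R).

Definition expansion i m p : R[i] :=
  plane_wave w s p * \sum_(i <= j < m) beta j p / tau%:C ^+ j.

Lemma expansion_classCC i m k : classCC k (expansion i m).
Proof.
apply: classCC_mul; first exact: plane_wave_classCC.
apply: classCC_sum => j; apply: classCC_mul; last exact: classCC_cst.
exact: beta_smooth.
Qed.

Lemma expansion_cat i m k p : (i <= m)%N -> (m <= k)%N ->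
  expansion i k p = expansion i m p + expansion m k p.
Proof. by move=> im mk; rewrite /expansion -mulrDr -big_cat_nat. Qed.

Lemma expansion_vanishes (T : R) (Omega : set 'rV[R]_n) i m :
  (forall j, vanishes_before T Omega (beta j)) ->
  vanishes_before T Omega (expansion i m).
Proof.
move=> bZ; apply: vanishes_before_mul; apply: vanishes_before_sum => j.
by under eq_fun do rewrite mulrC; exact: vanishes_before_mul.
Qed.

Lemma expansion_le i m (C : nat -> R) p : 1 < tau -> (0 < i)%N ->
  (forall j, modulus (beta j p) <= C j) ->
  modulus (expansion i m p) <= (\sum_(i <= j < m) C j) / tau.
Proof.
move=> tau1 i0 bC; have tau0 : 0 < tau := lt_trans ltr01 tau1.
rewrite modulusM modulus_expi mul1r mulr_suml.
apply: le_trans (modulus_sum _ _) _.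
rewrite big_nat [leRHS]big_nat; apply: ler_sum => j /andP[ij _].
have C0 : 0 <= C j := le_trans (modulus_ge0 _) (bC j).
rewrite -rmorphXn -fmorphV modulusM modulus_real ger0_norm; last by rewrite invr_ge0 exprn_ge0// ltW.
apply: ler_pM; rewrite ?modulus_ge0 ?invr_ge0 ?exprn_ge0 ?(ltW tau0)//.
by rewrite lef_pV2 ?posrE ?exprn_gt0// -[leLHS]expr1 ler_weXn2l ?(ltW tau1)// (leq_trans i0).
Qed.

(** Telescoping: the transport term of order [j + 1] cancels the wave operator on
   the term of order [j]. *)
Lemma wave_op_expansion (c : R[i]) m p : tau != 0 -> 0 +i* (2 * s) = tau%:C * c ->
  transport_op w a (beta 0) p = 0 ->
  (forall j, c * transport_op w a (beta j.+1) p = wave_op a b (beta j) p) ->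
  wave_op a b (expansion 0 m.+1) p =
  (tau^-1 ^+ m)%:C * (plane_wave w s p * wave_op a b (beta m) p).
Proof.
move=> tau0 sE b0 bS; have pc j : classCC 2 (fun q => plane_wave w s q * beta j q).
  by apply: classCC_mul; [exact: plane_wave_classCC|exact: beta_smooth].
have last1 j : expansion j j.+1 = fun q => (tau^-1 ^+ j)%:C * (plane_wave w s q * beta j q).
  apply/funext => q; rewrite /expansion big_nat1 exprVn fmorphV rmorphXn; ring.
have H j : wave_op a b (expansion j j.+1) p = (tau^-1 ^+ j)%:C *
    (plane_wave w s p * (wave_op a b (beta j) p - tau%:C * (c * transport_op w a (beta j) p))).
  rewrite last1 wave_op_scale//; congr (_ * _).
  by rewrite wave_op_plane_wave// ?sE ?mulrA//; exact: beta_smooth.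
elim: m => [|m IH]; first by rewrite H b0 !mulr0 subr0.
have -> : expansion 0 m.+2 = fun q => expansion 0 m.+1 q + expansion m.+1 m.+2 q.
  by apply/funext => q; exact: expansion_cat.
rewrite wave_op_add; [|exact: expansion_classCC..].
rewrite IH H bS exprS rmorphM/=.
have E : (tau^-1)%:C * tau%:C = 1 :> R[i] by rewrite -rmorphM/= mulVf.
move: (wave_op a b (beta m) p) (wave_op a b (beta m.+1) p) (plane_wave w s p) (tau^-1 ^+ m)%:C => x y e z.
transitivity ((tau^-1)%:C * z * (e * y) + z * (e * x) * (1 - (tau^-1)%:C * tau%:C)); first ring.
by rewrite E subrr mulr0 addr0.
Qed.

End Expansion.

Lemma smooth_space (R : realType) (n : nat) (f : 'rV[R]_n -> R) :
  smooth f -> smooth (fun p : R * 'rV[R]_n => f p.2).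
Proof.
move=> fs k; apply: (@classC_comp_affine _ (R * 'rV[R]_n)%type 'rV[R]_n k (fun p => p.2) (fun p => p.2)) => //.
by move=> p; exact: cvg_snd.
Qed.

Lemma bounded_cylinder (R : realType) (n : nat) (T : R) (Omega : set 'rV[R]_n) :
  0 < T -> bounded_set Omega ->
  exists2 B : R, 0 <= B & cylinder T Omega `<=` cube B.
Proof.
move=> T0 [M [_ HM]]; have MM : M < M + 1 by rewrite ltrDl.
exists (T + `|M + 1|); first by rewrite addr_ge0// ltW.
move=> p [/andP[p0 pT] pO]; split.
  by rewrite ger0_norm ?ltW// ltr_wpDr.
move=> i; apply: le_trans (coord_norm_le _ _) _.
apply: le_trans (HM _ MM _ pO) _; apply: le_trans (ler_norm _) _.
by rewrite lerDr ltW.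
Qed.

Lemma smoothC_bounded (R : realType) (n : nat) (u : R * 'rV[R]_n -> R[i]) (B : R) :
  0 <= B -> smoothC u -> exists M : R, forall p, cube B p -> modulus (u p) <= M.
Proof.
move=> B0 us.
have [M1 _ H1] := continuous_bounded_on_cube B0 (classC_continuous (us 0).1).
have [M2 _ H2] := continuous_bounded_on_cube B0 (classC_continuous (us 0).2).
exists (M1 + M2) => p [p1 p2]; apply: le_trans (modulus_le _) _.
by apply: lerD; [exact: H1|exact: H2].
Qed.

Lemma zero_final_data_add (R : realType) (n : nat) (T : R) (Omega : set 'rV[R]_n)
  (u v : R * 'rV[R]_n -> R[i]) : classCC 1 u -> classCC 1 v ->
  zero_final_data T Omega u -> zero_final_data T Omega v ->
  zero_final_data T Omega (fun p => u p + v p).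
Proof.
move=> u1 v1 uT vT x Ox; have [U DU] := uT x Ox; have [W DW] := vT x Ox.
split; first by rewrite U W addr0.
by rewrite /dt deriveC_add//; rewrite /dt in DU DW; rewrite DU DW addr0.
Qed.

Theorem proposition3p3 (R : realType) (n : nat) (hn : (2 <= n)%N)
    (Omega : set 'rV[R]_n) (Omega_open : open Omega)
    (Omega_connected : connected Omega) (Omega_bounded : bounded_set Omega)
    (Omega_smooth : smooth_boundary Omega)
    (T : R) (T_gt0 : 0 < T)
    (a b : 'rV[R]_n -> R)
    (a_test : test_function Omega a) (b_test : test_function Omega b)
    (l : nat) (hl : (2 <= l)%N) (w : 'rV[R]_n) (w_unit : unit_vector w)
    (N : nat)
    (beta0 : R * 'rV[R]_n -> R[i])
    (beta0_sol : transport_solution T Omega w a 1 (fun=> 0) beta0) :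
  exists (beta : nat -> R * 'rV[R]_n -> R[i])
         (v R0 : R -> R * 'rV[R]_n -> R[i]),
    [/\ beta 0%N = beta0,
        (forall j, (1 <= j <= N)%N ->
          transport_solution T Omega w a (2 * l%:R * 'i)
            (wave_op a b (beta j.-1)) (beta j)),
        (forall tau : R, 1 < tau -> backward_wave_solution T Omega a b (v tau)),
        (forall tau : R, 1 < tau -> forall t x,
          v tau (t, x) =
            expi (- (l%:R * tau * (t + dotv x w))) *
              \sum_(j < N.+1) beta j (t, x) / tau%:C ^+ j
            + R0 tau (t, x)) &
        (forall tau : R, 1 < tau -> zero_final_data T Omega (R0 tau)) /\
        exists2 C : R, 0 < C &
          forall tau : R, 1 < tau ->
            (Linfty_norm (cylinder T Omega) (R0 tau) <= (C / tau)%:E)%E].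
Proof.
have [a0 _ _] := a_test; have [b0 _ _] := b_test.
have a_smooth := smooth_space a0; have b_smooth := smooth_space b0.
set c : R[i] := 2 * l%:R * 'i.
have cE : c = (0 +i* (2 * l%:R)).
  rewrite /c -complexiE -[2]/((2%:R : R[i])) -!(rmorph_nat (real_complex R)).
  by apply: complex_eq; rewrite !(Re_mul, Im_mul)/=; ring.
have l0 : l%:R != 0 :> R by rewrite pnatr_eq0 -lt0n (leq_trans _ hl).
have c0 : c != 0.
  by rewrite cE eq_complex/= mulf_eq0 pnatr_eq0 (negPf l0) andbF.
pose beta := amplitude T w a b c beta0.
have bs j : smoothC (beta j) := amplitude_smooth a_smooth b_smooth c beta0_sol j.
have bE j p : c * transport_op w a (beta j.+1) p = wave_op a b (beta j) p :=
  amplitude_transport a_smooth b_smooth c0 beta0_sol j p.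
have bZ j : vanishes_before T Omega (beta j) :=
  amplitude_vanishes a_smooth b_smooth Omega_open T_gt0 c0 beta0_sol j.
have [B B0 cylB] := bounded_cylinder T_gt0 Omega_bounded.
have [C C0 corr] := oscillating_correction T w a_smooth b_smooth B0
  (wave_op_smooth a_smooth b_smooth (bs N.+3)).
(* The residual of the expansion up to the order [N + 3]. The norm of the source
   is of order [tau ^ 2], which leaves a correction of order [tau ^ (- N - 1)]. *)
have [r rP] := choice (fun tau : R => corr (l%:R * tau) (- tau^-1 ^+ N.+3)).
have [M MP] := choice (fun j => smoothC_bounded B0 (bs j)).
pose ex tau := expansion w beta (l%:R * tau) tau.
have exc tau i m k : classCC k (ex tau i m) by exact: expansion_classCC.
have exT tau i m : zero_final_data T Omega (ex tau i m).
  by apply: vanishes_before_final_data; [exact: exc|exact: expansion_vanishes].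
have rT tau : zero_final_data T Omega (r tau) by move=> x _; have [_ _ H _] := rP tau; exact: H.
have rc tau : classCC 2 (r tau) by have [] := rP tau.
have r1 tau : classCC 1 (r tau) by exact: (@classCC_le _ _ 1 2).
exists beta, (fun tau p => ex tau 0 N.+4 p + r tau p),
  (fun tau p => ex tau N.+1 N.+4 p + r tau p); split.
- by [].
- case=> [//|j] _; split; [exact: bs|by move=> p _; exact: bE|].
  by apply: vanishes_before_final_data; [exact: bs|exact: bZ].
- move=> tau tau1; have tau0 : tau != 0 by rewrite gt_eqF// (lt_trans ltr01).
  split; [exact: classCC_add| |exact: zero_final_data_add].
  move=> p pc; rewrite wave_op_add//.
  have [_ rE _ _] := rP tau; rewrite rE; last exact: cylB.
  rewrite (wave_op_expansion w_unit bs _ tau0 _ _ (fun j => bE j p)).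
  + by rewrite rmorphN/= mulNr subrr.
  + by rewrite cE; apply: complex_eq; rewrite ?(Re_mul, Im_mul)/=; ring.
  + by have [_ H _] := beta0_sol; have := H p pc; rewrite mul1r.
- move=> tau tau1 t x; rewrite addrA; congr (_ + _).
  have N4 : (N.+1 <= N.+4)%N by rewrite !ltnS !leqW.
  apply: etrans (expansion_cat w beta (l%:R * tau) tau (t, x) (leq0n _) N4) _.
  by congr (_ + _); rewrite /expansion big_mkord.
- split=> [tau _|]; first exact: zero_final_data_add.
  pose K := \sum_(N.+1 <= j < N.+4) M j + C * weight (l%:R *: w).
  exists (`|K| + 1) => [|tau tau1]; first by rewrite ltr_wpDl.
  have tau0 : 0 < tau := lt_trans ltr01 tau1.
  apply: ub_ereal_sup => _ [p pc <-]; rewrite lee_fin -/(modulus _).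
  apply: le_trans (modulusD _ _) _.
  have rB : modulus (r tau p) <= C * weight (l%:R *: w) / tau.
    have [_ _ _ H] := rP tau; apply: le_trans (H p pc.1) _.
    have k0 : 0 <= tau^-1 ^+ N.+3 by rewrite exprn_ge0 ?invr_ge0 ?ltW.
    have W0 : 0 <= weight (l%:R *: w) := weight_ge0 _.
    rewrite -mulrA ler_wpM2l// normrN ger0_norm// mulrC.
    have -> : (l%:R * tau) *: w = tau *: (l%:R *: w) by rewrite scalerA mulrC.
    apply: le_trans (ler_wpM2r k0 (weight_scale (l%:R *: w) (ltW tau1))) _.
    rewrite mulrC mulrA mulrC; apply: ler_wpM2l => //.
    rewrite -[N.+3]addn2 [_ ^+ (N.+1 + 2)]exprD -mulrA -exprMn mulVf ?gt_eqF// expr1n mulr1.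
    by rewrite exprS ler_piMr ?invr_ge0 ?(ltW tau0)// exprn_ile1 ?invr_ge0 ?invf_le1 ?(ltW tau0) ?(ltW tau1).
  have eB : modulus (ex tau N.+1 N.+4 p) <= (\sum_(N.+1 <= j < N.+4) M j) / tau.
    by apply: expansion_le => // j; exact/MP/cylB.
  apply: le_trans (lerD eB rB) _; rewrite -mulrDl.
  apply: ler_wpM2r; first by rewrite invr_ge0 ltW.
  by apply: le_trans (ler_norm _) _; rewrite lerDl.
Qed.
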